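(* Let $k\ge1$ be an integer and let $\mathbb{B}_1(\mu)=\bigl(\mu^{\boxplus 2}\bigr)^{\uplus(1/2)}$ for $\mu\in\mathcal{D}_c(k)$. Then $\mathbb{B}_1(\mathcal{D}_c(k))=\mathcal{D}_c^{\textrm{inf-div}}(k)$, the set of distributions in $\mathcal{D}_c(k)$ which are infinitely divisible with respect to $\boxplus$.
   Context: Let $\mathbb{C}\langle X_1,\ldots,X_k\rangle$ be the algebra of non-commutative polynomials, and let $\mathcal{D}_{\mathrm{alg}}(k)$ be the set of linear functionals $\mu:\mathbb{C}\langle X_1,\ldots,X_k\rangle\to\mathbb{C}$ with $\mu(1)=1$. For elements $x_1,\ldots,x_k$ of a non-commutative probability space $(\mathcal{A},\varphi)$ (unital complex algebra with a linear functional, $\varphi(1)=1$), their joint distribution is the $\mu\in\mathcal{D}_{\mathrm{alg}}(k)$ with $\mu(X_{i_1}\cdots X_{i_n})=\varphi(x_{i_1}\cdots x_{i_n})$. $\mathcal{D}_c(k)\subseteq\mathcal{D}_{\mathrm{alg}}(k)$ is the set of joint distributions of $k$-tuples of selfadjoint elements in $C^*$-probability spaces (unital $C^*$-algebra $\mathcal{A}$ with a positive linear functional $\varphi$, $\varphi(1)=1$). Let $\mathbb{C}_0\langle\langle z_1,\ldots,z_k\rangle\rangle$ be the space of formal power series with zero constant term in non-commuting indeterminates $z_1,\ldots,z_k$. For $\mu\in\mathcal{D}_{\mathrm{alg}}(k)$: - the moment series is $M_\mu=\sum_{n\ge1}\sum_{i_1,\ldots,i_n=1}^k\mu(X_{i_1}\cdots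 X_{i_n})z_{i_1}\cdots z_{i_n}$; - the $\eta$-series is $\eta_\mu=M_\mu(1+M_\mu)^{-1}$; - the $R$-transform $R_\mu\in\mathbb{C}_0\langle\langle z_1,\ldots,z_k\rangle\rangle$ is the unique series with $R_\mu\bigl(z_1(1+M_\mu),\ldots,z_k(1+M_\mu)\bigr)=M_\mu$. Both $\mu\mapsto\eta_\mu$ and $\mu\mapsto R_\mu$ are bijections from $\mathcal{D}_{\mathrm{alg}}(k)$ onto $\mathbb{C}_0\langle\langle z_1,\ldots,z_k\rangle\rangle$. For $t>0$, $\mu^{\boxplus t}$ is the unique element of $\mathcal{D}_{\mathrm{alg}}(k)$ with $R_{\mu^{\boxplus t}}=tR_\mu$, and $\mu^{\uplus t}$ is the unique element with $\eta_{\mu^{\uplus t}}=t\eta_\mu$. For a positive integer $N$, $\mu^{\boxplus N}$ is the $N$-fold free additive convolution of $\mu$ with itself. A distribution $\mu\in\mathcal{D}_c(k)$ is infinitely divisible with respect to $\boxplus$ if for every positive integer $N$ there is $\mu_N\in\mathcal{D}_c(k)$ with $\mu_N^{\boxplus N}=\mu$. *)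

(* Defs.v *)
From HB Require Import structures.
From mathcomp Require Import all_boot all_order all_algebra zify.
From mathcomp Require Import all_classical all_reals all_analysis.
From mathcomp Require Import complex.
(* The notations of monalg clash with those of mathcomp-analysis; below,
   [malg M C] is {malg C[M]} and [fmonom I] is the free monoid {fmonom I}. *)
From mathcomp.multinomials Require Import -(notations) monalg.

Set Implicit Arguments.
Unset Strict Implicit.
Unset Printing Implicit Defensive.

Import Order.TTheory GRing.Theory Num.Theory.

Local Open Scope classical_set_scope.
Local Open Scope ring_scope.

(** * Unital C*-algebras *)

(* mathcomp's hierarchy admits no common extension of the (C-valued) norm of
   [normedModType] and of the ring structure other than number domains, hence
   an explicit real-valued norm on an [algType]. *)
HB.mixin Record isCStarAlgebra (R : realType) A of GRing.Algebra R[i] A := {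
  cnorm : A -> R;
  cstar : A -> A;
  cnorm_eq0 : forall a, cnorm a = 0 -> a = 0;
  cnormD : forall a b, cnorm (a + b) <= cnorm a + cnorm b;
  cnormZ : forall (c : R[i]) a, cnorm (c *: a) = complex.Re `|c| * cnorm a;
  cnormM : forall a b, cnorm (a * b) <= cnorm a * cnorm b;
  cnorm_complete : forall u : nat -> A,
    (forall e : R, 0 < e -> exists N, forall m n, (N <= m)%N -> (N <= n)%N ->
       cnorm (u m - u n) < e) ->
    exists l, forall e : R, 0 < e -> exists N, forall n, (N <= n)%N ->
      cnorm (u n - l) < e;
  cstarD : forall a b, cstar (a + b) = cstar a + cstar b;
  cstarZ : forall (c : R[i]) a, cstar (c *: a) = (c^*)%C *: cstar a;
  cstarM : forall a b, cstar (a * b) = cstar b * cstar a;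
  cstarK : forall a, cstar (cstar a) = a;
  cnorm_cstar : forall a, cnorm (cstar a * a) = cnorm a ^+ 2
}.

#[short(type="cstarAlgType")]
HB.structure Definition CStarAlgebra (R : realType) :=
  {A of GRing.Algebra R[i] A & isCStarAlgebra R A}.

Record cstarProbSpace (R : realType) := CStarProbSpace {
  cps_alg :> cstarAlgType R;
  cps_state : {scalar cps_alg};
  cps_state_ge0 : forall a : cps_alg, 0 <= cps_state (cstar a * a);
  cps_state1 : cps_state 1 = 1
}.

(** * Non-commutative polynomials and distributions *)

Definition ncpoly (R : realType) (k : nat) := malg (fmonom 'I_k) R[i].
HB.instance Definition _ R k :=
  GRing.Lalgebra.copy (ncpoly R k) (malg (fmonom 'I_k) R[i]).

Definition ncvar (R : realType) (k : nat) (i : 'I_k) : ncpoly R k :=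
  mkmalgU (fmu i) 1.

(* The set D_alg(k). *)
Record ncdist (R : realType) (k : nat) := NCDist {
  dist_fun :> {scalar (ncpoly R k)};
  dist_fun1 : dist_fun 1 = 1
}.

HB.instance Definition _ R k := gen_eqMixin (ncdist R k).
HB.instance Definition _ R k := gen_choiceMixin (ncdist R k).

Definition joint_distribution (R : realType) (k : nat) (A : algType R[i])
    (phi : {scalar A}) (x : 'I_k -> A) (mu : ncdist R k) :=
  forall w : seq 'I_k,
    mu (\prod_(i <- w) ncvar R i) = phi (\prod_(i <- w) x i).

Definition Dc (R : realType) (k : nat) : set (ncdist R k) :=
  [set mu | exists (A : cstarProbSpace R) (x : 'I_k -> A),
    (forall i, cstar (x i) = x i) /\
    joint_distribution (cps_state A) x mu].

(** * Formal power series in non-commuting indeterminates *)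

(* A series is the family of its coefficients, indexed by words. The type is
   kept distinct from [seq 'I_k -> R[i]], which is a ring for the pointwise
   product. *)
Record ncseries (R : realType) (k : nat) :=
  NCSeries { ncs_coef :> seq 'I_k -> R[i] }.

Section NCSeriesRing.
Variables (R : realType) (k : nat).
Local Notation series := (ncseries R k).
Implicit Types (f g h : series) (w : seq 'I_k) (c : R[i]).

Lemma ncseriesP f g : f =1 g -> f = g.
Proof. by case: f g => f [g] /= /funext ->. Qed.

HB.instance Definition _ := [isNew for @ncs_coef R k].
HB.instance Definition _ := [Choice of series by <:].

Definition ncs_zero : series := NCSeries (fun=> 0).
Definition ncs_opp f : series := NCSeries (fun w => - f w).
Definition ncs_add f g : series := NCSeries (fun w => f w + g w).
Definition ncs_scale c f : series := NCSeries (fun w => c * f w).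

Let ncs_addA : associative ncs_add.
Proof. by move=> f g h; apply: ncseriesP => w; apply: addrA. Qed.

Let ncs_addC : commutative ncs_add.
Proof. by move=> f g; apply: ncseriesP => w; apply: addrC. Qed.

Let ncs_add0 : left_id ncs_zero ncs_add.
Proof. by move=> f; apply: ncseriesP => w; apply: add0r. Qed.

Let ncs_addN : left_inverse ncs_zero ncs_opp ncs_add.
Proof. by move=> f; apply: ncseriesP => w; apply: addNr. Qed.

HB.instance Definition _ := GRing.isZmodule.Build series
  ncs_addA ncs_addC ncs_add0 ncs_addN.

Let ncs_scaleA c d f : ncs_scale c (ncs_scale d f) = ncs_scale (c * d) f.
Proof. by apply: ncseriesP => w; apply: mulrA. Qed.

Let ncs_scale1 : left_id 1 ncs_scale.
Proof. by move=> f; apply: ncseriesP => w; apply: mul1r. Qed.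

Let ncs_scaleDr : right_distributive ncs_scale +%R.
Proof. by move=> c f g; apply: ncseriesP => w; apply: mulrDr. Qed.

Let ncs_scaleDl f : {morph ncs_scale^~ f : c d / c + d}.
Proof. by move=> c d; apply: ncseriesP => w; apply: mulrDl. Qed.

HB.instance Definition _ := GRing.Zmodule_isLmodule.Build R[i] series
  ncs_scaleA ncs_scale1 ncs_scaleDr ncs_scaleDl.

Definition ncs_one : series := NCSeries (fun w => (w == [::])%:R).

Definition ncs_mul f g : series := NCSeries (fun w =>
  \sum_(i < (size w).+1) f (take i w) * g (drop i w)).

Let D (a : 'I_k) f : series := NCSeries (fun w => f (a :: w)).

Let mul_nil f g : ncs_mul f g [::] = f [::] * g [::].
Proof. by rewrite /= big_ord1. Qed.

Let mul_cons f g a w :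
  ncs_mul f g (a :: w) = f [::] * g (a :: w) + ncs_mul (D a f) g w.
Proof. by rewrite /= big_ord_recl. Qed.

Let ncs_mulDl : left_distributive ncs_mul +%R.
Proof.
move=> f g h; apply: ncseriesP => w.
rewrite [RHS]/= -big_split; apply: eq_bigr => i _; exact: mulrDl.
Qed.

Let ncs_mulDr : right_distributive ncs_mul +%R.
Proof.
move=> f g h; apply: ncseriesP => w.
rewrite [RHS]/= -big_split; apply: eq_bigr => i _; exact: mulrDr.
Qed.

Let ncs_mulZl c f g w : ncs_mul (c *: f) g w = c * ncs_mul f g w.
Proof. by rewrite big_distrr; apply: eq_bigr => i _; rewrite /= mulrA. Qed.

Let D_mul a f g : D a (ncs_mul f g) = f [::] *: D a g + ncs_mul (D a f) g.
Proof. by apply: ncseriesP => w; apply: mul_cons. Qed.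

Let ncs_mulA : associative ncs_mul.
Proof.
move=> f g h; apply: ncseriesP => w; elim: w f g => [|a w IH] f g.
  by rewrite !mul_nil mulrA.
rewrite !mul_cons D_mul ncs_mulDl IH mul_nil.
rewrite [in RHS](_ : forall u v : series, (u + v) w = u w + v w) //.
by rewrite ncs_mulZl mulrDr mulrA addrA.
Qed.

Let ncs_mul1 : left_id ncs_one ncs_mul.
Proof.
move=> f; apply: ncseriesP => -[|a w]; first by rewrite mul_nil mul1r.
rewrite mul_cons mul1r /= big1 ?addr0 // => i _.
by rewrite /= mul0r.
Qed.

Let ncs_mulr1 : right_id ncs_one ncs_mul.
Proof.
move=> f; apply: ncseriesP => w; elim: w f => [|a w IH] f.
  by rewrite mul_nil mulr1.
by rewrite mul_cons IH mulr0 add0r.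
Qed.

Let ncs_one_neq0 : ncs_one != 0.
Proof.
by apply/eqP => /(congr1 (fun f : series => f [::]))/eqP; rewrite /= oner_eq0.
Qed.

HB.instance Definition _ := GRing.Zmodule_isNzRing.Build series
  ncs_mulA ncs_mul1 ncs_mulr1 ncs_mulDl ncs_mulDr ncs_one_neq0.

Definition ncs_unit : pred series :=
  fun f => `[< exists g, g * f = 1 /\ f * g = 1 >].

Definition ncs_inv f : series := xget f [set g | g * f = 1 /\ f * g = 1].

Let ncs_invP f : ncs_unit f -> ncs_inv f * f = 1 /\ f * ncs_inv f = 1.
Proof.
by move=> /asboolP[g gP]; rewrite /ncs_inv; case: xgetP => [h -> //|/(_ g)].
Qed.

Let ncs_mulV : {in ncs_unit, left_inverse 1 ncs_inv *%R}.
Proof. by move=> f /ncs_invP[]. Qed.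

Let ncs_mulrV : {in ncs_unit, right_inverse 1 ncs_inv *%R}.
Proof. by move=> f /ncs_invP[]. Qed.

Let ncs_unitP f g : g * f = 1 /\ f * g = 1 -> ncs_unit f.
Proof. by move=> fg; apply/asboolP; exists g. Qed.

Let ncs_inv_out : {in [predC ncs_unit], ncs_inv =1 id}.
Proof.
move=> f fu; rewrite /ncs_inv; case: xgetP => // g _ gP.
by case/negP: fu; apply/asboolP; exists g.
Qed.

HB.instance Definition _ := GRing.NzRing_hasMulInverse.Build series
  ncs_mulV ncs_mulrV ncs_unitP ncs_inv_out.

End NCSeriesRing.

Definition ncindet (R : realType) (k : nat) (i : 'I_k) : ncseries R k :=
  NCSeries (fun w => (w == [:: i])%:R).

(* Substitution f(g_1, ..., g_k), for g_i without constant term: in the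
   coefficient of w, the words of f longer than w then contribute 0. *)
Definition ncsubst (R : realType) (k : nat) (f : ncseries R k)
    (g : 'I_k -> ncseries R k) : ncseries R k := NCSeries (fun w =>
  \sum_(n < (size w).+1) \sum_(v : n.-tuple 'I_k)
    f v * (\prod_(i <- v) g i) w).

(** * Transforms and convolution powers *)

Section Transforms.
Variables (R : realType) (k : nat).
Implicit Types (mu nu : ncdist R k) (r : ncseries R k) (t : R).

Definition moment_series mu : ncseries R k := NCSeries (fun w =>
  if w is [::] then 0 else mu (\prod_(i <- w) ncvar R i)).

Definition eta_series mu : ncseries R k :=
  moment_series mu / (1 + moment_series mu).

Definition is_rtransform mu r :=
  r [::] = 0 /\
  ncsubst r (fun i => ncindet R i * (1 + moment_series mu)) = moment_series mu.

Definition rtransform mu : ncseries R k := xget 0 [set r | is_rtransform mu r].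

Definition boxplus_pow t mu : ncdist R k :=
  xget mu [set nu | rtransform nu = (t%:C)%C *: rtransform mu].

Definition uplus_pow t mu : ncdist R k :=
  xget mu [set nu | eta_series nu = (t%:C)%C *: eta_series mu].

Definition B1 mu : ncdist R k := uplus_pow (2^-1) (boxplus_pow 2 mu).

End Transforms.

(** ** Well-posedness: the [xget]s above pick the unique element with the
    required property, never their default value *)

Section WellPosed.
Variables (R : realType) (k : nat).
Local Notation series := (ncseries R k).
Implicit Types (f g h r : series) (v w : seq 'I_k) (mu nu : ncdist R k).

Lemma causal_fixpoint (T : series -> series) :
  (forall f g w, (forall v, (size v < size w)%N -> f v = g v) ->
     T f w = T g w) ->
  exists! f, T f = f.
Proof.
move=> causT; pose f : series := NCSeries (fun w => iter (size w).+1 T 0 w).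
have stab n m w : (size w < n)%N -> (size w < m)%N ->
    iter n T 0 w = iter m T 0 w.
  elim: n m w => // n IH [//|m] w wn wm /=; apply: causT => v vw.
  by apply: IH; apply: leq_trans vw _.
exists f; split.
  by apply: ncseriesP => w; rewrite {2}/f /=; apply: causT => v vw; apply: stab.
move=> g Tg; apply: ncseriesP => w; have [n] := ubnP (size w).
elim: n w => // n IH w wn; rewrite -Tg /f /=; apply: causT => v vw.
have -> := stab (size w) (size v).+1 v vw (ltnSn _).
by apply: IH; apply: leq_trans vw _.
Qed.

Lemma ncs_coefE : (forall f g w, (f + g) w = f w + g w) *
  (forall f w, (- f) w = - f w) * (forall (c : R[i]) f w, (c *: f) w = c * f w) *
  (forall w, (0 : series) w = 0) * (forall w, (1 : series) w = (w == [::])%:R) *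
  (forall f g w, (f * g) w =
    \sum_(i < (size w).+1) f (take i w) * g (drop i w)).
Proof. by []. Qed.

Lemma ncseries_unit f : f [::] = 1 -> f \is a GRing.unit.
Proof.
move=> f1; have f0 : (f - 1) [::] = 0 by rewrite !ncs_coefE f1 subrr.
have [g [gP _]] : exists! g, 1 - (f - 1) * g = g.
  apply: causal_fixpoint => g h w gh; rewrite !ncs_coefE; congr (_ - _).
  rewrite !big_ord_recl !take0 f0 !mul0r; congr (_ + _).
  apply: eq_bigr => i _; congr (_ * _); apply: gh; rewrite size_drop /= /bump /=.
  have := ltn_ord i; lia.
have [h [hP _]] : exists! h, 1 - h * (f - 1) = h.
  apply: causal_fixpoint => h h' w hh'; rewrite !ncs_coefE; congr (_ - _).
  rewrite !big_ord_recr !drop_size f0 !mulr0; congr (_ + _).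
  apply: eq_bigr => i _; congr (_ * _); apply: hh'; rewrite size_take.
  by have /= iw := ltn_ord i; rewrite /= iw.
have fg : f * g = 1 by rewrite -[f](subrK 1) mulrDl mul1r -[X in _ + X]gP addrC subrK.
have hf : h * f = 1 by rewrite -[f](subrK 1) mulrDr mulr1 -[X in _ + X]hP addrC subrK.
apply/unitrP; exists g; split=> //.
by rewrite -[g in LHS]mul1r -hf -(mulrA h) fg mulr1.
Qed.

Lemma moment_series0 mu : moment_series mu [::] = 0. Proof. by []. Qed.

Lemma eta_series0 mu : eta_series mu [::] = 0.
Proof. by rewrite /eta_series !ncs_coefE /= big_ord1 /= mul0r. Qed.

Lemma eta_seriesM mu : eta_series mu * (1 + moment_series mu) = moment_series mu.
Proof.
rewrite /eta_series divrK //; apply: ncseries_unit.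
by rewrite !ncs_coefE moment_series0 eqxx addr0.
Qed.

Definition wprod (M : series) v : series :=
  \prod_(i <- v) (ncindet R i * (1 + M)).

Lemma indM i f w : (ncindet R i * f) w =
  if w is j :: w' then (j == i)%:R * f w' else 0.
Proof.
have i0 : ncindet R i [::] = 0 by [].
rewrite ncs_coefE; case: w => [|j w]; first by rewrite big_ord1 i0 mul0r.
rewrite big_ord_recl take0 i0 mul0r add0r big_ord_recl.
rewrite [X in X + _](_ : _ = (j == i)%:R * f w); last first.
  by rewrite /= take0 drop0 eqseq_cons eqxx andbT.
rewrite big1 ?addr0 // => m _.
case: w m => [|a w] m; first by case: m.
by rewrite /= eqseq_cons andbF mul0r.
Qed.

Lemma wprod_cons M i v w : wprod M (i :: v) w =
  if w is j :: w' then (j == i)%:R * ((1 + M) * wprod M v) w' else 0.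
Proof. by rewrite /wprod big_cons -mulrA indM. Qed.

Lemma wprod_short (M : series) v w : M [::] = 0 -> (size w <= size v)%N ->
  wprod M v w = (v == w)%:R.
Proof.
move=> M0; elim: v w => [|i v IH] [|j w] //; rewrite ?wprod_cons //.
  by rewrite /wprod big_nil.
move=> wv0; have wv : (size w <= size v)%N by exact: wv0.
rewrite eqseq_cons ncs_coefE big_ord_recl take0 drop0.
rewrite [(1 + M) _]ncs_coefE M0 addr0 [(1 : series) _]ncs_coefE mul1r IH // big1 ?addr0.
  by rewrite eq_sym -natrM mulnb.
move=> m _; rewrite IH; last by rewrite size_drop; apply: leq_trans (leq_subr _ _) wv.
case: eqP => [vE|_]; last by rewrite mulr0.
have /= mw := ltn_ord m; have := congr1 size vE; rewrite size_drop /= /bump /=; lia.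
Qed.

Lemma wprod_causal (M N : series) v w :
  (forall u, (size u < size w)%N -> M u = N u) -> wprod M v w = wprod N v w.
Proof.
elim: v w => [|i v IH] w MN; first by rewrite /wprod !big_nil.
rewrite !wprod_cons; case: w MN => // j w MN; congr (_ * _).
rewrite !ncs_coefE; apply: eq_bigr => m _; rewrite !ncs_coefE.
have mw := ltn_ord m.
congr ((_ + _) * _).
  by apply: MN; rewrite size_take /=; case: ifP => //; lia.
by apply: IH => u uw; apply: MN; move: uw; rewrite size_drop /=; lia.
Qed.

Lemma ncsubstE f (M : series) w : M [::] = 0 ->
  ncsubst f (fun i => ncindet R i * (1 + M)) w =
  f w + \sum_(n < size w) \sum_(v : n.-tuple 'I_k) f v * wprod M v w.
Proof.
move=> M0; rewrite [LHS]big_ord_recr /= addrC; congr (_ + _).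
rewrite (bigD1 (in_tuple w)) //=.
rewrite -[X in _ * X + _]/(wprod M w w) (wprod_short M0 (leqnn _)) eqxx mulr1.
rewrite big1 ?addr0 // => v vw.
rewrite -[X in _ * X]/(wprod M v w) (wprod_short M0) ?size_tuple // (_ : (_ == _) = false) ?mulr0 //.
by apply/negbTE; apply: contra vw => /eqP vw; apply/eqP/val_inj.
Qed.

Lemma rtransform_unique mu : exists! r, is_rtransform mu r.
Proof.
set M := moment_series mu.
have [r [rP ru]] : exists! r, NCSeries (fun w => M w -
    \sum_(n < size w) \sum_(v : n.-tuple 'I_k) r v * wprod M v w) = r.
  apply: causal_fixpoint => f g w fg; congr (_ - _).
  by apply: eq_bigr => n _; apply: eq_bigr => v _; rewrite fg ?size_tuple.
exists r; split.
  split; first by rewrite -rP /= big_ord0 subr0.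
  by apply: ncseriesP => w; rewrite ncsubstE // -{1}rP subrK.
move=> s [_ sP]; apply: ru; apply: ncseriesP => w.
have E : M w = ncsubst s (fun i => ncindet R i * (1 + M)) w by rewrite sP.
by rewrite ncsubstE // in E; rewrite [LHS](congr1 (fun x => x - _) E) addrK.
Qed.

Lemma rtransformP mu : is_rtransform mu (rtransform mu).
Proof.
have [r [rP _]] := rtransform_unique mu.
by rewrite /rtransform; case: xgetP => [s -> //|/(_ r)].
Qed.

Lemma ncmonE w : \prod_(i <- w) ncvar R i = mkmalgU (FMonom w) 1 :> ncpoly R k.
Proof.
elim: w => [|i w IH]; first by rewrite big_nil -fmoneE.
rewrite big_cons IH /ncvar [LHS]fgmulUU mulr1 /mul /= fmmulE; congr (mkmalgU (FMonom _) _).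
by rewrite fmuE.
Qed.

Lemma dist_ext mu nu : moment_series mu = moment_series nu -> mu = nu.
Proof.
move=> mn.
have E w : mu (\prod_(i <- w) ncvar R i) = nu (\prod_(i <- w) ncvar R i).
  case: w => [|i w]; first by rewrite big_nil !dist_fun1.
  exact: (congr1 (fun f : series => f (i :: w)) mn).
have fE : mu =1 nu.
  move=> p; rewrite [p]monalgE !linear_sum; apply: eq_bigr => -[s] _.
  have -> : mkmalgU (FMonom s) (mcoeff (FMonom s) p) =
      mcoeff (FMonom s) p *: mkmalgU (FMonom s) 1 :> ncpoly R k.
    by apply/malgP => u; rewrite mcoeffZ !mcoeffU mulrnAr mulr1.
  by rewrite !linearZ -ncmonE E.
case: mu nu {mn E} fE => [m m1] [n n1] /= /funext fE.
have mn : m = n.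
  case: m n fE {m1 n1} => m cm [n cn] /= E; move: cm cn; rewrite E.
  move=> [[a1] [a2]] [[b1] [b2]]; congr (GRing.Linear.Pack (GRing.Linear.Class _ _)).
    by congr Algebra.isNmodMorphism.Axioms_; apply: Prop_irrelevance.
  by congr GRing.isScalable.Axioms_; apply: Prop_irrelevance.
by move: m1 n1; rewrite mn => m1 n1; congr NCDist; apply: Prop_irrelevance.
Qed.

Lemma dist_ex (M : series) : M [::] = 0 -> exists mu, moment_series mu = M.
Proof.
move=> M0; pose m : fmonom 'I_k -> R[i] := fun u => (1 + M) (fmonom_val u).
pose F : ncpoly R k -> R[i] := mmap idfun m.
have Fadd : zmod_morphism F by exact: mmap_is_additive.
have Fsc : scalable_for *%R F.
  move=> c p; rewrite /F (mmapEw (msuppZ_le c p)) mmapE mulr_sumr.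
  by apply: eq_bigr => i _; rewrite mcoeffZ mulrA.
have FU u : F (mkmalgU u 1) = m u by rewrite /F mmapU mul1r.
pose A := GRing.isZmodMorphism.Build _ _ F Fadd.
pose S := GRing.isScalable.Build R[i] (ncpoly R k) R[i] *%R F Fsc.
pose L : {scalar (ncpoly R k)} := HB.pack F A S.
have L1 : L 1 = 1.
  rewrite [LHS](FU _) /m !ncs_coefE [X in X == _]fm1 [M _](_ : _ = M [::]) ?M0 ?addr0 //.
  by rewrite fm1.
exists (NCDist L1); apply: ncseriesP => -[|i w]; first by rewrite M0.
by rewrite [LHS](congr1 F (ncmonE (i :: w))) FU /m ncs_coefE [(1 : series) _](_ : _ = 0) ?add0r.
Qed.

Lemma rtransform_bij r : r [::] = 0 -> exists! mu, rtransform mu = r.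
Proof.
move=> r0.
have [M [MP Mu]] : exists! M : series, NCSeries (fun w => r w +
    \sum_(n < size w) \sum_(v : n.-tuple 'I_k) r v * wprod M v w) = M.
  apply: causal_fixpoint => f g w fg; congr (_ + _).
  by apply: eq_bigr => n _; apply: eq_bigr => v _; rewrite (wprod_causal _ fg).
have M0 : M [::] = 0 by rewrite -MP /= big_ord0 addr0.
have [mu muM] := dist_ex M0; exists mu; split.
  have [s [sP su]] := rtransform_unique mu.
  rewrite -(su _ (rtransformP mu)); apply: su; split => //.
  by rewrite muM; apply: ncseriesP => w; rewrite ncsubstE // -[in RHS]MP.
move=> nu nuP; apply: dist_ext; rewrite muM; apply: Mu.
have [_ E] := rtransformP nu; rewrite nuP in E.
by apply: ncseriesP => w; rewrite -[in RHS]E ncsubstE.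
Qed.

Lemma eta_series_bij r : r [::] = 0 -> exists! mu, eta_series mu = r.
Proof.
move=> r0.
have [M [MP Mu]] : exists! M : series, r * (1 + M) = M.
  apply: causal_fixpoint => f g w fg; rewrite !ncs_coefE.
  rewrite !big_ord_recl !take0 r0 !mul0r; congr (_ + _).
  apply: eq_bigr => i _; rewrite !ncs_coefE fg // size_drop /= /bump /=.
  have := ltn_ord i; lia.
have M0 : M [::] = 0 by rewrite -MP ncs_coefE big_ord1 r0 mul0r.
have U (N : series) : N [::] = 0 -> 1 + N \is a GRing.unit.
  by move=> N0; apply: ncseries_unit; rewrite !ncs_coefE N0 addr0.
have [mu muM] := dist_ex M0; exists mu; split.
  by rewrite /eta_series muM -{1}MP mulrK ?U.
move=> nu nuP; apply: dist_ext; rewrite muM; apply: Mu.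
by rewrite -nuP eta_seriesM.
Qed.

Lemma boxplus_powP t mu :
  rtransform (boxplus_pow t mu) = (t%:C)%C *: rtransform mu.
Proof.
have [|nu [nuP _]] := @rtransform_bij ((t%:C)%C *: rtransform mu).
  by rewrite !ncs_coefE (rtransformP mu).1 mulr0.
by rewrite /boxplus_pow; case: xgetP => [s -> //|/(_ nu)].
Qed.

Lemma uplus_powP t mu :
  eta_series (uplus_pow t mu) = (t%:C)%C *: eta_series mu.
Proof.
have [|nu [nuP _]] := @eta_series_bij ((t%:C)%C *: eta_series mu).
  by rewrite [LHS](congr1 (fun x => (t%:C)%C * x) (eta_series0 mu)) mulr0.
by rewrite /uplus_pow; case: xgetP => [s -> //|/(_ nu)].
Qed.
End WellPosed.

(** * Infinite divisibility *)

Definition Dc_infdiv (R : realType) (k : nat) : set (ncdist R k) :=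
  [set mu | Dc mu /\ forall N : nat, (0 < N)%N ->
    exists nu : ncdist R k, Dc nu /\ boxplus_pow N%:R nu = mu].

(* Main.v *)
Require Import Defs.
From HB Require Import structures.
From mathcomp Require Import all_boot all_order all_algebra ring lra zify.
From mathcomp Require Import all_classical all_reals all_analysis.
From mathcomp Require Import complex generic_quotient.
From mathcomp.multinomials Require Import -(notations) monalg.

(* [B1 mu] is characterised by [rtransform (B1 mu) = eta_series mu]: if nu is
   the free square of mu, H = M_nu / 2 and la = B1 mu, then 1 + M_la =
   (1 + M_nu) (1 + H)^-1, so omega_i = z_i (1 + M_la) satisfies
   R_mu (omega_i (1 + H)) = H, i.e. M_mu (omega) = H, i.e. eta_mu (omega) = M_la.

   A distribution belongs to [Dc] iff its moments are positive and geometrically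
   bounded. One direction needs square roots of 1 - b in a C*-algebra, the other
   one completes the non-commutative polynomials for the operator seminorm of
   the GNS representation.

   Call a series conditionally positive if it is positive on the polynomials
   without constant term. Up to geometric bounds, mu is positive iff eta_mu is
   conditionally positive (the converse being a Boolean Fock space), and
   conditional positivity of R_la suffices for la to be positive (full Fock
   space). Hence B1 mu and its convolution roots, of R-transforms eta_mu / N,
   are in [Dc]. Conversely, if la is the N-th convolution power of la_N, then
   N M_(la_N) tends to R_la coefficientwise, so that R_la is conditionally
   positive and is the eta-series of a mu in [Dc]. *)

Set Implicit Arguments.
Unset Strict Implicit.
Unset Printing Implicit Defensive.

Import Order.TTheory GRing.Theory Num.Theory.
Import numFieldNormedType.Exports.

Local Open Scope classical_set_scope.
Local Open Scope quotient_scope.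
Local Open Scope ring_scope.

(** * Calculus of non-commutative power series *)

(** [B1] is the Boolean Bercovici-Pata bijection. The identity [rtransform (B1 mu) = eta_series mu]
    trades two nonlinear convolutions for an equality of series, so that it remains to compare
    Boolean and free cumulants of positive functionals. Conditional positivity is the right notion
    because it defines a closed convex cone: it survives division by N and coefficientwise limits.
    Positivity of moments is a nonlinear condition on the R-transform and shows no such stability.
    The two kinds of cumulants behave differently: eta is conditionally positive for every positive
    mu, but the R-transform of a positive la is so only under infinite divisibility, and this is
    where the roots are used. Geometric bounds do not pass to the limit, as those of the roots may
    depend on N; the bound on R_la is drawn from la alone, by inverting the series z_i (1 + M_la).
    C*-algebras occur only in the equivalence of [Dc] and [good]; in between there are only series
    and kernels, with operators acting on finite formal combinations. *)

Lemma ncs_scalerAl (R : realType) (k : nat) (c : R[i]) (f g : ncseries R k) :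
  c *: (f * g) = c *: f * g.
Proof.
apply: ncseriesP => w; rewrite !ncs_coefE mulr_sumr.
by apply: eq_bigr => j _; rewrite ncs_coefE mulrA.
Qed.

Lemma ncs_scalerAr (R : realType) (k : nat) (c : R[i]) (f g : ncseries R k) :
  c *: (f * g) = f * (c *: g).
Proof.
apply: ncseriesP => w; rewrite !ncs_coefE mulr_sumr.
by apply: eq_bigr => j _; rewrite ncs_coefE mulrCA.
Qed.

HB.instance Definition _ (R : realType) (k : nat) :=
  GRing.Lmodule_isLalgebra.Build R[i] (ncseries R k) (@ncs_scalerAl R k).

HB.instance Definition _ (R : realType) (k : nat) :=
  GRing.Lalgebra_isAlgebra.Build R[i] (ncseries R k) (@ncs_scalerAr R k).

Section SeriesCalculus.
Variables (R : realType) (k : nat).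
Local Notation series := (ncseries R k).
Implicit Types (f g h r : series) (v w : seq 'I_k) (i j : 'I_k) (c : R[i]).
Implicit Types (mu nu : ncdist R k).

Definition lderiv i f : series := NCSeries (fun w => f (i :: w)).

Lemma lderivE i f w : lderiv i f w = f (i :: w). Proof. by []. Qed.

Lemma lderivD i f g : lderiv i (f + g) = lderiv i f + lderiv i g.
Proof. by apply: ncseriesP. Qed.

Lemma lderivZ i c f : lderiv i (c *: f) = c *: lderiv i f.
Proof. by apply: ncseriesP. Qed.

Lemma ncs_mul_nil f g : (f * g) [::] = f [::] * g [::].
Proof. by rewrite ncs_coefE big_ord1. Qed.

Lemma ncs_mul_cons f g i w :
  (f * g) (i :: w) = f [::] * g (i :: w) + (lderiv i f * g) w.
Proof. by rewrite !ncs_coefE big_ord_recl. Qed.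

Lemma lderivM i f g : lderiv i (f * g) = f [::] *: lderiv i g + lderiv i f * g.
Proof. by apply: ncseriesP => w; rewrite lderivE ncs_mul_cons. Qed.

Lemma ncs_addE f g w : (f + g) w = f w + g w. Proof. by []. Qed.

Lemma ncs_sumE (I : Type) (s : seq I) (F : I -> series) w :
  (\sum_(x <- s) F x) w = \sum_(x <- s) F x w.
Proof. by elim: s => [|x s IH]; rewrite ?big_nil // !big_cons ncs_coefE IH. Qed.

(** A left factor without constant term consumes at least one letter. All inductions on the length
    of words below rest on this. *)
Lemma ncs_mul_causal f g h w : f [::] = 0 ->
  (forall v, (size v < size w)%N -> g v = h v) -> (f * g) w = (f * h) w.
Proof.
move=> f0 gh; rewrite !ncs_coefE !big_ord_recl take0 f0 !mul0r; congr (_ + _).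
apply: eq_bigr => m _; congr (_ * _); apply: gh.
rewrite size_drop /= /bump /=; have := ltn_ord m; lia.
Qed.

Lemma ncprod_eq0 (g : 'I_k -> series) v w : (forall i, g i [::] = 0) ->
  (size w < size v)%N -> (\prod_(i <- v) g i) w = 0.
Proof.
move=> g0; elim: v w => // i v IH w wv; rewrite big_cons ncs_coefE big1 // => m _.
case: (posnP m) => [m0|m_gt0]; first by rewrite m0 take0 g0 mul0r.
rewrite IH ?mulr0 // size_drop; have := ltn_ord m; move: wv => /=; lia.
Qed.

(** The definition cuts the sum at a length depending on the word; any larger cut-off gives the same
    value, so that coefficients of different words can be compared under a common one. *)
Lemma ncsubst_bound f (g : 'I_k -> series) w N : (forall i, g i [::] = 0) ->
  (size w <= N)%N -> ncsubst f g w =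
  \sum_(n < N.+1) \sum_(v : n.-tuple 'I_k) f v * (\prod_(i <- v) g i) w.
Proof.
move=> g0 wN.
have E M : (size w <= M)%N ->
    \sum_(n < M.+1) \sum_(v : n.-tuple 'I_k) f v * (\prod_(i <- v) g i) w =
    \sum_(n < M.+2) \sum_(v : n.-tuple 'I_k) f v * (\prod_(i <- v) g i) w.
  move=> wM; rewrite [RHS]big_ord_recr /= [X in _ + X]big1 ?addr0 // => v _.
  by rewrite ncprod_eq0 ?mulr0 // size_tuple.
rewrite -(subnKC wN); elim: (N - size w)%N => [|d IH]; first by rewrite addn0.
by rewrite addnS IH E // leq_addr.
Qed.

Lemma big_tupleS (V : nmodType) n (F : seq 'I_k -> V) :
  \sum_(v : n.+1.-tuple 'I_k) F v =
  \sum_(i : 'I_k) \sum_(v : n.-tuple 'I_k) F (i :: v).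
Proof.
rewrite pair_big /=.
rewrite (reindex (fun p : 'I_k * n.-tuple 'I_k => [tuple of p.1 :: p.2])) //=.
exists (fun v : n.+1.-tuple 'I_k => (thead v, [tuple of behead v])).
  by move=> [i v] _; congr pair; apply: val_inj.
by move=> v _; rewrite [v in RHS]tuple_eta.
Qed.

Lemma big_tuple0 (V : nmodType) (F : seq 'I_k -> V) :
  \sum_(v : 0.-tuple 'I_k) F v = F [::].
Proof.
by rewrite (bigD1 [tuple]) //= big1 ?addr0 // => v; case/eqP; rewrite tuple0.
Qed.

Lemma ncsubst_nil f (g : 'I_k -> series) : ncsubst f g [::] = f [::].
Proof.
rewrite /= big_ord1 (@big_tuple0 _ (fun v => f v * (\prod_(i <- v) g i) [::])).
by rewrite big_nil ncs_coefE mulr1.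
Qed.

(** Splitting off the first letter of the words of [f] turns the substitution into a recursion, from
    which its compatibility with products and composition follows by uniqueness or induction. *)
Lemma ncsubst_rec f (g : 'I_k -> series) : (forall i, g i [::] = 0) ->
  ncsubst f g = f [::] *: (1 : series) + \sum_i g i * ncsubst (lderiv i f) g.
Proof.
move=> g0; apply: ncseriesP => w.
rewrite !ncs_coefE ncs_sumE (@ncsubst_bound _ _ _ (size w).+1 g0) //.
rewrite big_ord_recl; congr (_ + _).
  by rewrite (@big_tuple0 _ (fun v => f v * (\prod_(i <- v) g i) w)) big_nil.
under eq_bigr => n _ do
  rewrite (@big_tupleS _ _ (fun v => f v * (\prod_(i <- v) g i) w)).
rewrite exchange_big; apply: eq_bigr => i _.
transitivity ((\sum_(n < (size w).+1) \sum_(v : n.-tuple 'I_k)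
   f (i :: v) *: (g i * \prod_(i <- v) g i)) w).
  rewrite ncs_sumE; apply: eq_bigr => n _; rewrite ncs_sumE.
  by apply: eq_bigr => v _; rewrite ncs_coefE big_cons.
rewrite [X in ncs_coef X w](_ : _ = g i * \sum_(n < (size w).+1)
    \sum_(v : n.-tuple 'I_k) f (i :: v) *: \prod_(i <- v) g i); last first.
  rewrite mulr_sumr; apply: eq_bigr => n _; rewrite mulr_sumr.
  by apply: eq_bigr => v _; exact: scalerAr.
apply: ncs_mul_causal => // v vw.
rewrite (@ncsubst_bound _ _ _ (size w)) //; last exact: ltnW.
rewrite ncs_sumE; apply: eq_bigr => n _; rewrite ncs_sumE.
by apply: eq_bigr => u _; rewrite ncs_coefE.
Qed.

Lemma ncs_rec f : f = f [::] *: (1 : series) + \sum_i ncindet R i * lderiv i f.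
Proof.
apply: ncseriesP => w; rewrite !ncs_coefE ncs_sumE.
under eq_bigr => i _ do rewrite indM.
case: w => [|j w]; first by rewrite eqxx mulr1 big1 // addr0.
rewrite mulr0 add0r (bigD1 j) //= eqxx mul1r big1 ?addr0 // => i.
by rewrite eq_sym => /negbTE ->; rewrite mul0r.
Qed.

Lemma lderiv_sum_indet i (F : 'I_k -> series) :
  lderiv i (\sum_j ncindet R j * F j) = F i.
Proof.
apply: ncseriesP => w; rewrite lderivE ncs_sumE (bigD1 i) // indM eqxx mul1r.
rewrite big1 => [|j ji]; first exact: addr0.
rewrite indM eq_sym (negbTE ji); exact: mul0r.
Qed.

(* The recursion [ncsubst_rec] determines the substitution, since the
   constant terms of the [g i] vanish. *)
Lemma ncsubst_ext (F G : series -> series) (g : 'I_k -> series) :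
  (forall i, g i [::] = 0) ->
  (forall f, F f = f [::] *: (1 : series) + \sum_i g i * F (lderiv i f)) ->
  (forall f, G f = f [::] *: (1 : series) + \sum_i g i * G (lderiv i f)) -> F =1 G.
Proof.
move=> g0 FE GE f; apply: ncseriesP => w.
have [n] := ubnP (size w); elim: n f w => // n IH f w wn.
rewrite FE GE !ncs_coefE !ncs_sumE; congr (_ + _).
apply: eq_bigr => i _; apply: ncs_mul_causal => // v vw.
by apply: IH; apply: leq_trans vw _.
Qed.

Lemma ncsubstC c (g : 'I_k -> series) : (forall i, g i [::] = 0) ->
  ncsubst (c *: (1 : series)) g = c *: (1 : series).
Proof.
move=> g0; apply: ncseriesP => w; rewrite (@ncsubst_bound _ _ _ (size w) g0) //.
rewrite big_ord_recl [X in _ + X]big1 ?addr0 => [|n _].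
  rewrite (@big_tuple0 _ (fun v => (c *: 1 : series) v * (\prod_(i <- v) g i) w)).
  by rewrite big_nil /= mulr1.
rewrite big1 // => v _; rewrite !ncs_coefE.
by case: v => -[|j v] //= _; rewrite mulr0 mul0r.
Qed.

Lemma ncsubstD f h (g : 'I_k -> series) :
  ncsubst (f + h) g = ncsubst f g + ncsubst h g.
Proof.
apply: ncseriesP => w; rewrite ncs_coefE -big_split; apply: eq_bigr => n _ /=.
by rewrite -big_split; apply: eq_bigr => v _; rewrite mulrDl.
Qed.

Lemma ncsubstZ c f (g : 'I_k -> series) : ncsubst (c *: f) g = c *: ncsubst f g.
Proof.
apply: ncseriesP => w; rewrite ncs_coefE mulr_sumr; apply: eq_bigr => n _ /=.
by rewrite mulr_sumr; apply: eq_bigr => v _; rewrite mulrA.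
Qed.

Lemma ncsubst_sum (I : Type) (s : seq I) (F : I -> series) (g : 'I_k -> series) :
  ncsubst (\sum_(x <- s) F x) g = \sum_(x <- s) ncsubst (F x) g.
Proof.
elim: s => [|x s IH]; last by rewrite !big_cons ncsubstD IH.
by rewrite !big_nil -[0](scale0r (0 : series)) ncsubstZ !scale0r.
Qed.

Lemma ncsubst1 (g : 'I_k -> series) : (forall i, g i [::] = 0) ->
  ncsubst 1 g = 1.
Proof. by move=> g0; rewrite -[1](scale1r (1 : series)) ncsubstC // scale1r. Qed.

Lemma ncsubstM f h (g : 'I_k -> series) : (forall i, g i [::] = 0) ->
  ncsubst (f * h) g = ncsubst f g * ncsubst h g.
Proof.
move=> g0; apply: ncseriesP => w.
have [n] := ubnP (size w); elim: n f w => // n IH f w wn.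
rewrite [ncsubst (f * h) g]ncsubst_rec // [ncsubst f g]ncsubst_rec //.
rewrite ncs_mul_nil mulrDl -scalerAl mul1r mulr_suml.
rewrite {1}[ncsubst h g]ncsubst_rec // scalerDr scalerA -addrA.
rewrite !(ncs_addE _ _ w); congr (_ + _).
rewrite scaler_sumr !ncs_sumE -big_split; apply: eq_bigr => i _.
rewrite lderivM ncsubstD ncsubstZ mulrDr scalerAr.
rewrite !(ncs_addE _ _ w); congr (_ + _).
rewrite -mulrA; apply: ncs_mul_causal => // v vw.
by apply: IH; apply: leq_trans vw _.
Qed.

Lemma ncsubst_indet i (g : 'I_k -> series) : (forall i, g i [::] = 0) ->
  ncsubst (ncindet R i) g = g i.
Proof.
move=> g0; rewrite ncsubst_rec //= scale0r add0r (bigD1 i) //=.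
have E j : lderiv j (ncindet R i) = (j == i)%:R *: (1 : series).
  apply: ncseriesP => w; rewrite /= eqseq_cons.
  by case: (j == i); rewrite ?mul0r ?mul1r.
rewrite E eqxx ncsubstC // scale1r mulr1 big1 ?addr0 // => j ji.
by rewrite E (negbTE ji) ncsubstC // scale0r mulr0.
Qed.

Lemma ncsubst_comp f (g h : 'I_k -> series) :
  (forall i, g i [::] = 0) -> (forall i, h i [::] = 0) ->
  ncsubst (ncsubst f g) h = ncsubst f (fun i => ncsubst (g i) h).
Proof.
move=> g0 h0; move: f.
have gh0 i : ncsubst (g i) h [::] = 0 by rewrite ncsubst_nil.
apply: (ncsubst_ext (F := fun f => ncsubst (ncsubst f g) h) gh0) => f.
  rewrite {1}[ncsubst f g]ncsubst_rec // ncsubstD ncsubstC // ncsubst_sum.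
  by congr (_ + _); apply: eq_bigr => i _; rewrite ncsubstM.
exact: ncsubst_rec.
Qed.

Lemma ncsubst_id f : ncsubst f (@ncindet R k) = f.
Proof.
move: f; apply: (ncsubst_ext (F := fun f => ncsubst f (@ncindet R k))
  (g := @ncindet R k) (G := id)) => // f.
  exact: ncsubst_rec.
exact: ncs_rec.
Qed.

Lemma eq_ncsubst f (g h : 'I_k -> series) : g =1 h -> ncsubst f g = ncsubst f h.
Proof. by move=> /funext ->. Qed.

(** Each [h i] consumes a letter before [g] is read, so a coefficient of the solution is determined
    by those of shorter words. *)
Lemma ncsubst_self_unique f (h : 'I_k -> series) g g' :
  (forall i, h i [::] = 0) -> f [::] = 0 ->
  ncsubst f (fun i => h i * (1 + g)) = g ->
  ncsubst f (fun i => h i * (1 + g')) = g' -> g = g'.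
Proof.
move=> h0 f0 gE g'E.
have hg0 (a : series) i : (h i * (1 + a)) [::] = 0 by rewrite ncs_mul_nil h0 mul0r.
apply: ncseriesP => w; have [n] := ubnP (size w); elim: n w => // n IH w wn.
have gg v : (size v < size w)%N -> g v = g' v.
  by move=> vw; apply: IH; apply: leq_trans vw _.
rewrite -gE -g'E.
(* The recursion replaces [f] by its derivatives, so the inner induction is on the length of [u],
   with the series generalised and [w] kept as the bound up to which [gg] applies. *)
have : forall f u, (size u <= size w)%N ->
    ncsubst f (fun i => h i * (1 + g)) u = ncsubst f (fun i => h i * (1 + g')) u.
  move=> f' u; have [m] := ubnP (size u); elim: m f' u => // m IHm f' u um uw.
  rewrite [ncsubst f' (fun i => h i * (1 + g))]ncsubst_rec //.
  rewrite [ncsubst f' (fun i => h i * (1 + g'))]ncsubst_rec //.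
  rewrite !ncs_coefE !ncs_sumE; congr (_ + _); apply: eq_bigr => i _.
  rewrite -!mulrA; transitivity ((h i * ((1 + g') *
      ncsubst (lderiv i f') (fun j => h j * (1 + g)))) u).
    apply: ncs_mul_causal => // v vu; rewrite !ncs_coefE; apply: eq_bigr => a _.
    congr (_ * _); rewrite !ncs_coefE gg //; apply: leq_ltn_trans (leq_trans vu uw).
    by rewrite size_take; case: ifP => // /ltnW.
  apply: ncs_mul_causal => // v vu; rewrite !ncs_coefE; apply: eq_bigr => a _.
  congr (_ * _); apply: IHm; rewrite size_drop; move: um uw vu; lia.
exact.
Qed.

Lemma rtransform_eq mu r : is_rtransform mu r -> rtransform mu = r.
Proof.
move=> rP; have [s [_ su]] := rtransform_unique mu.
by rewrite -(su _ rP) (su _ (rtransformP mu)).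
Qed.

Lemma rtransform_inj : injective (@rtransform R k).
Proof.
move=> mu nu E; have [s [_ su]] := rtransform_bij (rtransformP mu).1.
by rewrite -(su mu erefl) -(su nu (esym E)).
Qed.

Lemma rtransform_B1 mu : rtransform (B1 mu) = eta_series mu.
Proof.
pose nu := boxplus_pow 2 mu; pose M := moment_series nu; pose la := B1 mu.
pose L := moment_series la; pose t : R[i] := (2^-1)%:C%C.
pose H := t *: M.
have t2 : t * (2%:C)%C = 1.
  by rewrite -rmorphM /= mulVf ?rmorph1 // pnatr_eq0.
have M0 : M [::] = 0 := moment_series0 nu.
have L0 : L [::] = 0 := moment_series0 la.
have etaL : eta_series la = t *: eta_series nu := uplus_powP _ _.
have etaM : eta_series nu * (1 + M) = M := eta_seriesM nu.
have unit1 (f : series) : f [::] = 0 -> 1 + f \is a GRing.unit.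
  by move=> f0; apply: ncseries_unit; rewrite !ncs_coefE f0 addr0 eqxx.
have H0 : H [::] = 0 by rewrite ncs_coefE M0 mulr0.
have MH : M = H + H.
  by rewrite /H -scalerDl -{1}[M]scale1r -t2 -[2]/(1 + 1 : R) rmorphD mulrDr mulr1.
have LH : (1 + L) * (1 + H) = 1 + M.
  (* [1 - eta_la = (1 + (1 + M)^-1) / 2 = (1 + H) * (1 + M)^-1] *)
  have LP : L = eta_series la * (1 + L) by rewrite eta_seriesM.
  have e1 : (1 - eta_series la) * (1 + M) = 1 + H.
    by rewrite etaL mulrBl mul1r -scalerAl etaM -/H {1}MH addrA addrK.
  have e2 : (1 - eta_series la) * (1 + L) = 1.
    by rewrite mulrBl mul1r -LP addrK.
  apply: (mulrI (x := 1 - eta_series la)).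
    apply: ncseries_unit; rewrite ncs_addE [X in _ + X](_ : _ = 0) ?addr0 //.
    by rewrite -[LHS]/(- eta_series la [::]) eta_series0 oppr0.
  by rewrite mulrA e2 mul1r e1.
pose om i := ncindet R i * (1 + L).
have om0 i : om i [::] = 0 by rewrite /om indM.
have Rnu : rtransform nu = (2%:C)%C *: rtransform mu := boxplus_powP _ _.
have RH : ncsubst (rtransform mu) (fun i => om i * (1 + H)) = H.
  have [_ RM] := rtransformP nu; rewrite /H -[M in RHS]RM Rnu ncsubstZ scalerA t2.
  by rewrite scale1r; apply: eq_ncsubst => i; rewrite /om -mulrA LH.
(* Both sides solve the fixed-point equation g = R_mu (om_i (1 + g)). *)
have HE : ncsubst (moment_series mu) om = H.
  apply: (ncsubst_self_unique (f := rtransform mu) om0 (rtransformP mu).1) => //.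
  have [_ RM] := rtransformP mu; rewrite -[in RHS]RM ncsubst_comp //.
  apply: eq_ncsubst => i; rewrite ncsubstM // ncsubst_indet // ncsubstD.
  by rewrite ncsubst1.
apply: rtransform_eq; split; first exact: eta_series0.
(* By [HE], the factor [1 + H] is (1 + M_mu) (om), which turns eta_mu (om) into M_mu (om) = H; on
   the other side [LH] and M = H + H give L (1 + H) = H. *)
apply: (mulIr (x := 1 + H)); first exact: unit1.
rewrite -/la -/L -/om -[X in _ * (_ + X)]HE -(ncsubst1 om0) -ncsubstD -ncsubstM //.
rewrite eta_seriesM HE ncsubst1 //.
by move: LH; rewrite mulrDl mul1r MH addrA => /addrI ->.
Qed.

End SeriesCalculus.

(** * Positive semidefinite kernels *)

Section Kernels.
Variable C : numClosedFieldType.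

Lemma conjCD (x y : C) : (x + y)^* = x^* + y^*. Proof. exact: rmorphD. Qed.

Lemma conjCM (x y : C) : (x * y)^* = x^* * y^*. Proof. exact: rmorphM. Qed.

Lemma conjCN (x : C) : (- x)^* = - x^*. Proof. exact: rmorphN. Qed.

(* Finite linear combinations of elements of [S] are encoded as lists of
   pairs (coefficient, element). *)
Definition lin (S : Type) (f : S -> C) (a : seq (C * S)) : C :=
  \sum_(x <- a) x.1 * f x.2.

Lemma lin_nil (S : Type) (f : S -> C) : lin f [::] = 0.
Proof. exact: big_nil. Qed.

Lemma lin_cons (S : Type) (f : S -> C) c s a :
  lin f ((c, s) :: a) = c * f s + lin f a.
Proof. exact: big_cons. Qed.

Definition sesq (S : Type) (K : S -> S -> C) (a b : seq (C * S)) : C :=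
  \sum_(x <- a) \sum_(y <- b) x.1 * y.1^* * K x.2 y.2.

Definition psd (S : Type) (K : S -> S -> C) := forall a, 0 <= sesq K a a.

Lemma eq_psd (S : Type) (K L : S -> S -> C) : K =2 L -> psd K -> psd L.
Proof.
move=> KL Kpsd a; rewrite (_ : sesq L a a = sesq K a a) //.
by apply: eq_bigr => x _; apply: eq_bigr => y _; rewrite KL.
Qed.

Lemma psd_map (S T : Type) (p : S -> T) (K : T -> T -> C) :
  psd K -> psd (fun s t => K (p s) (p t)).
Proof.
move=> Kpsd a; have := Kpsd [seq (x.1, p x.2) | x <- a].
rewrite /sesq big_map; congr (_ <= _); apply: eq_bigr => x _.
by rewrite big_map.
Qed.

(** Extension by zero of a kernel pulled back along a partial map: the entries without image are
    dropped from the list. It serves for kernels that vanish on the vacuum. *)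
Lemma psd_pmap (S T : Type) (p : S -> option T) (K : T -> T -> C) :
  psd K -> psd (fun s t => if p s is Some x then
                  if p t is Some y then K x y else 0 else 0).
Proof.
move=> Kpsd a.
pose b := pmap (fun x : C * S => omap (pair x.1) (p x.2)) a.
have big_b (f : C * T -> C) : \sum_(x <- b) f x =
    \sum_(x <- a) if p x.2 is Some y then f (x.1, y) else 0.
  rewrite /b; elim: (a) => [|x a' IH]; first by rewrite !big_nil.
  by rewrite big_cons /=; case: (p x.2) => [y|] /=; rewrite ?big_cons IH ?add0r.
have := Kpsd b; congr (_ <= _); rewrite /sesq big_b; apply: eq_bigr => x _.
case: (p x.2) => [y|]; last by rewrite big1 // => z _; rewrite mulr0.
rewrite big_b; apply: eq_bigr => z _.
by case: (p z.2) => [u|]; rewrite ?mulr0.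
Qed.

Lemma psd_scale (S : Type) (K : S -> S -> C) (f : S -> C) :
  psd K -> psd (fun s t => f s * (f t)^* * K s t).
Proof.
move=> Kpsd a; have := Kpsd [seq (x.1 * f x.2, x.2) | x <- a].
rewrite /sesq big_map; congr (_ <= _); apply: eq_bigr => x _.
rewrite big_map; apply: eq_bigr => y _ /=; rewrite rmorphM; ring.
Qed.

Lemma psdD (S : Type) (K L : S -> S -> C) :
  psd K -> psd L -> psd (fun s t => K s t + L s t).
Proof.
move=> Kpsd Lpsd a; have := addr_ge0 (Kpsd a) (Lpsd a).
rewrite -big_split; congr (_ <= _); apply: eq_bigr => x _.
by rewrite -big_split; apply: eq_bigr => y _ /=; rewrite mulrDr.
Qed.

Lemma psd1 (S : Type) : psd (fun _ _ : S => 1).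
Proof.
move=> a; have := mul_conjC_ge0 (\sum_(x <- a) x.1); congr (_ <= _).
rewrite rmorph_sum mulr_suml; apply: eq_bigr => x _.
by rewrite mulr_sumr; apply: eq_bigr => y _; rewrite mulr1.
Qed.

Lemma psd_rank1 (S : Type) (f : S -> C) : psd (fun s t => f s * (f t)^*).
Proof.
have := psd_scale f (@psd1 S); apply: eq_psd => s t; exact: mulr1.
Qed.

Lemma psd_ge0 (S : Type) (K : S -> S -> C) s : psd K -> 0 <= K s s.
Proof.
by move=> /(_ [:: (1, s)]); rewrite /sesq !big_seq1 /= conjC1 !mul1r.
Qed.

(** The cross term [c^* * K s t + c * K t s] is real for every [c]; the cases c = 1 and c = 'i
    together determine the symmetry. *)
Lemma psd_herm (S : Type) (K : S -> S -> C) s t : psd K -> K s t = (K t s)^*.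
Proof.
move=> Kpsd.
have E c : c^* * K s t + c * K t s \is Num.real.
  have := Kpsd [:: (1, s); (c, t)]; rewrite /sesq !big_cons !big_nil /=.
  rewrite !addr0 conjC1 !mul1r mulr1 => h.
  have h1 := psd_ge0 s Kpsd; have h2 := psd_ge0 t Kpsd.
  have h3 : 0 <= c * c^* * K t t by rewrite mulr_ge0 ?mul_conjC_ge0.
  have -> : c^* * K s t + c * K t s = (K s s + c^* * K s t + (c * K t s + c * c^* * K t t))
     - K s s - c * c^* * K t t by ring.
  by rewrite !rpredB ?ger0_real.
have := E 1; have := E 'i; rewrite conjC1 !mul1r conjCi => /CrealP + /CrealP.
rewrite !rmorphD !rmorphM rmorphN /= conjCi opprK => e1 e2.
set x := K s t in e1 e2 *; set y := (K t s) in e1 e2 *.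
have e3 : x^* - y^* = - x + y.
  apply: (mulfI (neq0Ci C)).
  transitivity ('i * x^* + - 'i * y^*); first by ring.
  by rewrite e1; ring.
have e4 : (y^* - x) * 2 = 0.
  rewrite mulrBl mulr_natr mulr2n.
  have -> : y^* + y^* = x^* + y^* - (x^* - y^*) by ring.
  rewrite e2 e3; ring.
by apply/eqP; move/eqP: e4; rewrite mulf_eq0 pnatr_eq0 orbF subr_eq0 eq_sym.
Qed.

(* The head of a list is eliminated by a Schur complement; when the pivot
   vanishes, the division by 0 yields 0, which is the right correction. *)
Lemma psd_schur_compl (S : Type) (K : S -> S -> C) (s0 : S) : psd K ->
  psd (fun s t => K s t - K s s0 * (K t s0)^* / K s0 s0).
Proof.
move=> Kpsd a; pose l := lin (K^~ s0) a.
have k0 := psd_ge0 s0 Kpsd; have kr : (K s0 s0)^* = K s0 s0 by rewrite geC0_conj.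
have h c : 0 <= c * c^* * K s0 s0 + c * l^* + l * c^* + sesq K a a.
  have := Kpsd ((c, s0) :: a); rewrite /sesq !big_cons /=.
  congr (_ <= _); rewrite -!addrA; congr (_ + _).
  under [X in _ + X = _]eq_bigr => x _ do rewrite big_cons.
  rewrite big_split /= !addrA; congr (_ + _); congr (_ + _).
    rewrite /l /lin rmorph_sum mulr_sumr; apply: eq_bigr => x _.
    by rewrite (psd_herm s0 x.2 Kpsd) rmorphM mulrA.
  by rewrite /l /lin mulr_suml; apply: eq_bigr => x _; rewrite mulrAC.
have -> : sesq (fun s t => K s t - K s s0 * (K t s0)^* / K s0 s0) a a =
    sesq K a a - l * l^* / K s0 s0.
  rewrite /l /lin rmorph_sum [X in X / _]mulr_suml mulr_suml -sumrB.
  apply: eq_bigr => x _; rewrite mulr_sumr mulr_suml -sumrB.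
  apply: eq_bigr => y _; rewrite rmorphM; ring.
have [e|e] := eqVneq (K s0 s0) 0.
  by rewrite e invr0 mulr0 subr0; apply: Kpsd.
(* This coefficient of [s0] minimises the quadratic form [h]. *)
have := h (- l / K s0 s0); congr (_ <= _).
rewrite rmorphM fmorphV /= kr rmorphN /=; field; exact: e.
Qed.

(** Testing the form on [t] times s minus [K s s0] times s0 leaves t^2 K s s - 2 t n >= 0, where n
    is the squared modulus of [K s s0]; t = n / K s s, or t = 1 when [K s s] vanishes, forces n =
    0. *)
Lemma psd_rowE (S : Type) (K : S -> S -> C) s0 s : psd K -> K s0 s0 = 0 ->
  K s s0 = 0.
Proof.
move=> Kpsd k0; have kss := psd_ge0 s Kpsd.
have h (t : C) : 0 <= t -> 0 <= t * t * K s s - t * (K s s0 * (K s s0)^*) *+ 2.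
  move=> t0; have tr : t^* = t by rewrite geC0_conj.
  have := Kpsd [:: (t, s); (- K s s0, s0)]; rewrite /sesq !big_cons !big_nil /= k0.
  rewrite (psd_herm s0 s Kpsd) rmorphN /= tr !mulr0 !addr0; congr (_ <= _); ring.
have n0 := mul_conjC_ge0 (K s s0); set n := K s s0 * _ in h n0.
have [n00|n00] := eqVneq n 0.
  by apply/eqP; move/eqP: n00; rewrite /n mulf_eq0 conjC_eq0 orbb.
have [e|e] := eqVneq (K s s) 0.
  have := h 1 ler01; rewrite e mulr0 add0r mul1r oppr_ge0 => n2.
  have : n *+ 2 = 0 by apply/eqP; rewrite eq_le n2 mulrn_wge0.
  by move/eqP; rewrite mulrn_eq0 /= (negbTE n00).
have := h (n / K s s) (divr_ge0 n0 kss).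
have -> : n / K s s * (n / K s s) * K s s - n / K s s * n *+ 2 = - (n * n / K s s).
  by field.
rewrite oppr_ge0 => n2.
have : n * n / K s s = 0.
  by apply/eqP; rewrite eq_le n2 divr_ge0 // mulr_ge0.
by move/eqP; rewrite mulf_eq0 invr_eq0 (negbTE e) orbF mulf_eq0 orbb (negbTE n00).
Qed.

(** The Schur product theorem. [K] is its Schur complement at the head of the list plus a rank-one
    kernel: the complement vanishes on the row and column of the head, which falls to the induction
    hypothesis, and the rank-one part only rescales [L]. *)
Lemma psdM (S : Type) (K L : S -> S -> C) :
  psd K -> psd L -> psd (fun s t => K s t * L s t).
Proof.
move=> Kpsd Lpsd a; elim: a K Kpsd => [|[c0 s0] a IH] K Kpsd.
  by rewrite /sesq big_nil.
pose K' s t := K s t - K s s0 * (K t s0)^* / K s0 s0.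
have K'psd : psd K' := psd_schur_compl s0 Kpsd.
have rowl s : K' s s0 = 0.
  rewrite /K' geC0_conj ?psd_ge0 //.
  have [e|e] := eqVneq (K s0 s0) 0; last by rewrite mulfK // subrr.
  by rewrite e invr0 mulr0 subr0 psd_rowE.
have rowr s : K' s0 s = 0 by rewrite psd_herm // rowl conjC0.
have E : sesq (fun s t => K' s t * L s t) ((c0, s0) :: a) ((c0, s0) :: a) =
    sesq (fun s t => K' s t * L s t) a a.
  rewrite /sesq big_cons big1 ?add0r => [|x _]; last by rewrite rowr mul0r mulr0.
  by apply: eq_bigr => x _; rewrite big_cons rowl mul0r mulr0 add0r.
have := psd_scale (fun s => K s s0) Lpsd ((c0, s0) :: a) => P2.
have -> : sesq (fun s t => K s t * L s t) ((c0, s0) :: a) ((c0, s0) :: a) =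
   sesq (fun s t => K' s t * L s t) ((c0, s0) :: a) ((c0, s0) :: a) +
   sesq (fun s t => K s s0 * (K t s0)^* * L s t) ((c0, s0) :: a) ((c0, s0) :: a)
      / K s0 s0.
  rewrite /sesq mulr_suml -big_split; apply: eq_bigr => x _.
  rewrite mulr_suml -big_split; apply: eq_bigr => y _ /=; rewrite /K'; ring.
by rewrite E addr_ge0 ?IH // divr_ge0 // psd_ge0.
Qed.

(** * Moments of symmetric operators for a positive semidefinite form *)

Section Model.
Variables (I S : Type) (K : S -> S -> C) (X : I -> S -> seq (C * S)).
Hypothesis Kpsd : psd K.
Hypothesis Xsym : forall i s t,
  lin (K^~ t) (X i s) = (lin (fun u => (K s u)^*) (X i t))^*.

(* The matrix coefficient <X_w s, t> for the form K: the letters of [w] act in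
   order, the leftmost one first. *)
Fixpoint path_sum (t s : S) (w : seq I) : C :=
  if w is i :: w' then lin (fun u => path_sum t u w') (X i s) else K s t.

Definition act (i : I) (a : seq (C * S)) : seq (C * S) :=
  flatten [seq [seq (x.1 * y.1, y.2) | y <- X i x.2] | x <- a].

Lemma lin_act f i a : lin f (act i a) = lin (fun s => lin f (X i s)) a.
Proof.
rewrite /lin /act; elim: a => [|x a IH]; first by rewrite !big_nil.
rewrite big_cons /= big_cat /= IH big_map; congr (_ + _).
by rewrite mulr_sumr; apply: eq_bigr => y _; rewrite mulrA.
Qed.

Definition orbit_vec s w := foldl (fun a i => act i a) [:: (1, s)] w.

Lemma path_sum_cat t s v u :
  path_sum t s (v ++ u) = lin (fun x => path_sum t x u) (orbit_vec s v).
Proof.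
have E a : lin (fun x => path_sum t x (v ++ u)) a =
    lin (fun x => path_sum t x u) (foldl (fun a i => act i a) a v).
  by elim: v a => //= i v IH a; rewrite -IH lin_act.
by rewrite -E /lin big_seq1 mul1r.
Qed.

Lemma path_sum_rev t s w :
  path_sum t s (rev w) = (lin (fun u => (K s u)^*) (orbit_vec t w))^*.
Proof.
elim/last_ind: w s => [|w i IH] s.
  by rewrite /lin big_seq1 mul1r conjCK.
rewrite rev_rcons /= /orbit_vec -cats1 foldl_cat /= lin_act -/(orbit_vec t w).
rewrite /lin; under eq_bigr => x _ do rewrite IH /lin rmorph_sum mulr_sumr.
rewrite exchange_big /= rmorph_sum; apply: eq_bigr => y _.
have := Xsym i s y.2; rewrite rmorphM /lin /= => <-; rewrite mulr_sumr; apply: eq_bigr => x _.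
by rewrite rmorphM /= conjCK mulrCA.
Qed.

(** By symmetry the letters of [rev q.2] can be moved to the second vector, so the entry at (s, v),
    (t, u) is the product of X_v s and X_u t: a Gram matrix. *)
Lemma path_sum_psd :
  psd (fun p q : S * seq I => path_sum q.1 p.1 (p.2 ++ rev q.2)).
Proof.
move=> a.
pose b := flatten [seq [seq (x.1 * y.1, y.2) | y <- orbit_vec x.2.1 x.2.2] | x <- a].
have := Kpsd b; congr (_ <= _); rewrite /sesq.
have big_b (f : C * S -> C) : \sum_(x <- b) f x =
    \sum_(x <- a) \sum_(y <- orbit_vec x.2.1 x.2.2) f (x.1 * y.1, y.2).
  rewrite /b; elim: (a) => [|x a' IH] /=; first by rewrite !big_nil.
  by rewrite big_cat /= IH big_cons big_map.
rewrite big_b; apply: eq_bigr => x _.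
under eq_bigr => y _ do rewrite big_b.
rewrite exchange_big; apply: eq_bigr => z _ /=.
rewrite path_sum_cat /lin mulr_sumr; apply: eq_bigr => y _.
rewrite path_sum_rev /lin rmorph_sum !mulr_sumr; apply: eq_bigr => u _ /=.
rewrite !rmorphM /= conjCK; ring.
Qed.

(** A weighted l1 estimate that replaces operator norms: it suffices that each [X i] multiplies the
    weight [rho] of a basis vector by at most [B]. *)
Lemma path_sum_bound (rho : S -> C) (B : C) t s w :
  0 <= B -> (forall s, `|K s t| <= rho s) ->
  (forall i s, \sum_(x <- X i s) `|x.1| * rho x.2 <= B * rho s) ->
  `|path_sum t s w| <= B ^+ size w * rho s.
Proof.
move=> B0 rhoK rhoX; elim: w s => [|i w IH] s; first by rewrite mul1r; apply: rhoK.
apply: le_trans (ler_norm_sum _ _ _) _.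
rewrite /= exprSr -mulrA; apply: le_trans (ler_wpM2l (exprn_ge0 _ B0) (rhoX i s)).
rewrite mulr_sumr; apply: ler_sum => x _.
by rewrite normrM mulrCA; apply: ler_wpM2l; rewrite ?IH.
Qed.

End Model.
End Kernels.

(** * Positivity of moments, Boolean cumulants and free cumulants *)

Section Positivity.
Variables (R : realType) (k : nat).
Local Notation series := (ncseries R k).
Local Notation C := (R[i]).
Local Notation block := ('I_k * seq 'I_k)%type.
Implicit Types (f g h r : series) (v w : seq 'I_k) (i j : 'I_k) (c : R[i]).
Implicit Types (mu nu : ncdist R k).

Definition geom_bounded f :=
  exists D : C, 1 <= D /\ forall w, `|f w| <= D ^+ size w.

Definition moments mu : series := 1 + moment_series mu.

Definition good mu :=
  psd (fun v w => moments mu (v ++ rev w)) /\ geom_bounded (moments mu).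

(* A block (i, v) stands for the nonempty word i :: v. *)
Definition bword (b : block) : seq 'I_k := b.1 :: b.2.
Definition badd (b : block) i : block := (b.1, rcons b.2 i).

Definition bker f (b b' : block) : C := f (bword b ++ rev (bword b')).

(** Two nonempty words concatenate to a word of length at least two, so [bker] does not see the
    coefficients of length one; their reality, needed for the symmetry of the Fock space operators,
    is a separate condition. *)
Definition cond_pos f := psd (bker f) /\ forall i, f [:: i] \is Num.real.

Definition tails f v : series :=
  NCSeries (fun u => if u is [::] then 0 else f (v ++ u)).

Lemma lderiv_tails f v i :
  lderiv i (tails f v) = f (rcons v i) *: 1 + tails f (rcons v i).
Proof.
apply: ncseriesP => -[|j u]; rewrite ncs_addE ncs_coefE /= ?mulr1 ?addr0 ?cats1 //.
by rewrite mulr0 add0r cat_rcons.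
Qed.

Lemma bwordD b i : bword (badd b i) = rcons (bword b) i.
Proof. by []. Qed.

Lemma bker_add f b (b' : block) i : bker f (badd b i) b' = bker f b (badd b' i).
Proof. by rewrite /bker !bwordD cat_rcons rev_rcons. Qed.

Lemma bker1 f b i : bker f b (i, [::]) = f (rcons (bword b) i).
Proof. by rewrite /bker cats1. Qed.

Lemma moments_nil mu : moments mu [::] = 1.
Proof. by rewrite /moments ncs_addE moment_series0 addr0. Qed.

Lemma moments_cons mu i w : moments mu (i :: w) = moment_series mu (i :: w).
Proof. by rewrite /moments ncs_addE add0r. Qed.

Lemma lderiv_moments mu i : lderiv i (moments mu) = lderiv i (moment_series mu).
Proof. by apply: ncseriesP => w; rewrite !lderivE moments_cons. Qed.

Lemma moments_unit mu : moments mu \is a GRing.unit.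
Proof. exact/ncseries_unit/moments_nil. Qed.

(** * Positive moments have a conditionally positive eta-series *)

Section EtaOfPositive.
Variable mu : ncdist R k.
Hypothesis pos : psd (fun v w => moments mu (v ++ rev w)).
Local Notation A := (moments mu).

Let A_rev w : (A w)^* = A (rev w).
Proof. by have := psd_herm [::] w pos; rewrite cats0 => <-. Qed.

Let A_shift v : series := NCSeries (fun w => A (v ++ w)).

(** For a one-letter word this is a left derivative of eta. Other words are included because the
    derivatives of these series leave one-letter words; [lderiv_shift] is then a closed recursion,
    the same as the action of the compressed operators below. *)
Let eta_shift v : series := A_shift v * A^-1.

Let invA : A^-1 = 1 - eta_series mu.
Proof.
apply: (mulIr (moments_unit mu)); rewrite mulVr ?moments_unit //.
by rewrite mulrBl mul1r eta_seriesM /moments addrK.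
Qed.

Let invA_nil : A^-1 [::] = 1.
Proof. by rewrite invA -[LHS]/(1 - eta_series mu [::]) eta_series0 subr0. Qed.

Lemma lderiv_eta i : lderiv i (eta_series mu) * A = lderiv i (moment_series mu).
Proof. by rewrite -[in RHS]eta_seriesM lderivM eta_series0 scale0r add0r. Qed.

Let eta_shift1 i : eta_shift [:: i] = lderiv i (eta_series mu).
Proof.
apply: (mulIr (moments_unit mu)); rewrite lderiv_eta divrK ?moments_unit //.
by rewrite -lderiv_moments.
Qed.

Let eta_shift_nil v : eta_shift v [::] = A v.
Proof. by rewrite ncs_mul_nil invA_nil mulr1 /= cats0. Qed.

Let lderiv_shift v i :
  lderiv i (eta_shift v) = eta_shift (rcons v i) - A v *: eta_shift [:: i].
Proof.
rewrite lderivM [X in _ + X * _](_ : _ = A_shift (rcons v i)); last first.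
  by apply: ncseriesP => w; rewrite /= cat_rcons.
rewrite [A_shift v [::]]/= cats0 addrC -/(eta_shift _); congr (_ + _).
rewrite -scalerN eta_shift1; congr (_ *: _).
by apply: ncseriesP => w; rewrite invA lderivE ncs_addE add0r.
Qed.

(* The compression of the multiplication by the i-th variable to the orthogonal
   complement of 1; its matrix coefficients are those of eta. *)
Let K v w := A (v ++ rev w) - A v * (A w)^*.
Let X i v := [:: (1, rcons v i); (- A v, [:: i])].

Let K_psd : psd K.
Proof.
apply: eq_psd (psd_schur_compl [::] pos) => v w.
by rewrite !cats0 moments_nil divr1.
Qed.

Let K_sym i s t :
  lin (K^~ t) (X i s) = (lin (fun u => (K s u)^*) (X i t))^*.
Proof.
rewrite !lin_cons !lin_nil !addr0 !mul1r conjCD conjCM conjCN !conjCK.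
have h1 : (A [:: i])^* = A [:: i] by rewrite A_rev.
have h2 : (A (rcons t i))^* = A (i :: rev t) by rewrite A_rev rev_rcons.
rewrite /K (_ : rev [:: i] = [:: i]) // h1 h2 cats1 rev_rcons cat_rcons cat1s; ring.
Qed.

Let path_eta i v w : path_sum K X [:: i] v w = eta_shift v (rcons w i).
Proof.
elim: w v => [|j w IH] v.
  rewrite -[rcons _ _]/([:: i]) -lderivE lderiv_shift ncs_addE.
  rewrite -[X in _ + X]/(- (A v * eta_shift [:: i] [::])) !eta_shift_nil.
  by rewrite [path_sum _ _ _ _ _]/= /K A_rev cats1.
rewrite rcons_cons -lderivE lderiv_shift ncs_addE.
by rewrite [LHS]/= !lin_cons lin_nil addr0 mul1r !IH mulNr.
Qed.

(** By [path_eta], the coefficient of eta at i v (rev u) j is the inner product, for the compressed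
    operators, of X_v applied to the vector i and X_u applied to the vector j. *)
Lemma eta_cond_pos : cond_pos (eta_series mu).
Proof.
split=> [|i].
  have := psd_map (fun b : block => ([:: b.1], b.2)) (path_sum_psd K_psd K_sym).
  apply: eq_psd => -[i v] [j u]; rewrite path_eta eta_shift1 lderivE /bker /bword /=.
  by rewrite rev_cons -rcons_cat.
by rewrite -lderivE -eta_shift1 eta_shift_nil; apply/CrealP; rewrite A_rev.
Qed.

(** Each letter produces the two terms of [lderiv_shift], both larger by a factor D; hence the ratio
    2 D. *)
Lemma eta_geom_bounded : geom_bounded A -> geom_bounded (eta_series mu).
Proof.
move=> [D [D1 bD]]; have D0 : 0 <= D by apply: le_trans D1.
have E v w : `|eta_shift v w| <= D ^+ size v * (2 * D) ^+ size w.
  elim: w v => [|i w IH] v; first by rewrite eta_shift_nil mulr1.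
  rewrite -lderivE lderiv_shift -[X in `|X|]/(_ - A v * eta_shift [:: i] w).
  apply: le_trans (ler_normB _ _) _; rewrite normrM.
  apply: le_trans (lerD (IH _) (ler_pM _ _ (bD v) (IH _))) _ => //.
  by rewrite size_rcons /= !exprS le_eqVlt; apply/orP; left; apply/eqP; ring.
exists (2 * D); split; first by rewrite mulr_natl mulr2n ler_wpDl.
case=> [|i w]; first by rewrite eta_series0 normr0.
rewrite -lderivE -eta_shift1; apply: le_trans (E _ _) _.
rewrite /= [(2 * D) ^+ (size w).+1]exprS expr1.
by apply: ler_wpM2r; rewrite ?exprn_ge0 ?mulr_ge0 // mulr_natl mulr2n ler_wpDl.
Qed.

End EtaOfPositive.

(** * Fock space models with prescribed Boolean or free cumulants *)

Section Fock.
Variable r : series.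
Hypotheses (r_pos : cond_pos r) (r_bd : geom_bounded r).

Let r_real i : (r [:: i])^* = r [:: i].
Proof. by apply/CrealP; apply r_pos.2. Qed.

Let r_herm b i : (r (rcons (bword b) i))^* = bker r (i, [::]) b.
Proof. by rewrite -bker1 (psd_herm _ _ r_pos.1) conjCK. Qed.

Section Boolean.
Variable mu : ncdist R k.
Hypothesis muP : eta_series mu = r.

(** The Boolean Fock space: [None] is the vacuum, orthogonal to the blocks. Under [X], a letter
    creates a block from the vacuum or extends the present one, and annihilation returns to the
    vacuum. *)
Let K (s t : option block) : C :=
  match s, t with
  | None, None => 1 | Some b, Some c => bker r b c | _, _ => 0
  end.

Let X i (s : option block) : seq (C * option block) :=
  if s is Some b then [:: (1, Some (badd b i)); (r (rcons (bword b) i), None)]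
  else [:: (1, Some (i, [::])); (r [:: i], None)].

Let K_psd : psd K.
Proof.
have := psdD (psd_rank1 (fun s : option block => (~~ isSome s)%:R))
  (psd_pmap id r_pos.1).
by apply: eq_psd => -[b|] [c|]; rewrite /= ?mul0r ?mul1r ?add0r ?conjC0 ?conjC1 ?addr0.
Qed.

Let K_sym i s t :
  lin (K^~ t) (X i s) = (lin (fun u => (K s u)^*) (X i t))^*.
Proof.
rewrite /lin; case: s t => [b|] [c|]; rewrite !big_cons !big_nil /= !rmorphD !rmorphM /=;
  rewrite ?conjC0 ?conjC1 ?conjCK ?mul1r ?mulr1 ?mulr0 ?addr0 ?add0r.
- exact: bker_add.
- by rewrite bker1.
- by rewrite r_herm.
- by rewrite r_real.
Qed.

(** The generating series of the coefficients from [s] to the vacuum: the current block must first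
    be completed to a word of [r], after which any vacuum moment may follow. *)
Let G (s : option block) : series :=
  if s is Some b then tails r (bword b) * moments mu else moments mu.

Let path_G s w : path_sum K X None s w = G s w.
Proof.
elim: w s => [|i w IH] s.
  by case: s => [b|]; rewrite [LHS]/= ?ncs_mul_nil ?mul0r ?moments_nil.
rewrite [LHS]/= /lin -lderivE.
have -> : lderiv i (G s) = \sum_(x <- X i s) x.1 *: G x.2.
  case: s => [b|]; rewrite !big_cons big_nil /= addr0 scale1r.
    by rewrite lderivM scale0r add0r lderiv_tails mulrDl -scalerAl mul1r addrC.
  have tE : lderiv i r = r [:: i] *: 1 + tails r [:: i].
    rewrite -[r in LHS](_ : tails r [::] = _) ?lderiv_tails //.
    by apply: ncseriesP => -[|j v] //=; rewrite -muP eta_series0.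
  by rewrite lderiv_moments -lderiv_eta muP tE mulrDl -scalerAl mul1r addrC.
rewrite ncs_sumE; apply: eq_bigr => x _; rewrite IH.
by [].
Qed.

Lemma good_of_eta : good mu.
Proof.
split.
  have := psd_map (fun w => (None, w)) (path_sum_psd K_psd K_sym).
  by apply: eq_psd => v w; rewrite path_G.
have [D [D1 bD]] := r_bd; have D0 : 0 <= D by apply: le_trans D1.
(* Creation or extension multiplies this weight by D, and the scalar or annihilation term is at most
   D times it by the bound on [r]: two terms, hence 2 D. *)
pose rho (s : option block) := if s is Some b then D ^+ size (bword b) else 1.
exists (2 * D); split; first by rewrite mulr_natl mulr2n ler_wpDl.
move=> w; rewrite -[moments mu w]/(G None w) -path_G.
have -> : (2 * D) ^+ size w = (2 * D) ^+ size w * rho None by rewrite mulr1.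
apply: path_sum_bound; first by rewrite mulr_ge0.
  by case=> [b|] /=; rewrite ?normr0 ?normr1 // exprn_ge0.
move=> i [b|]; rewrite !big_cons big_nil /= normr1 mul1r mulr1 addr0.
  rewrite size_rcons mulr2n mulrDl mul1r mulrDl -exprS lerD //.
  by apply: le_trans (bD _) _; rewrite /= size_rcons.
by rewrite mulr2n mulrDl mul1r mulr1 lerD ?expr1 // (le_trans (bD _)).
Qed.

End Boolean.

Section Free.
Variable mu : ncdist R k.
Hypothesis muP : rtransform mu = r.

(* A list of blocks b_1, ..., b_n stands for the vector b_1 (x) ... (x) b_n of
   the full Fock space over the words without constant term; [X i] is the sum
   of a creation, a scalar, a preservation and an annihilation operator. *)
Fixpoint fock_ker (s t : seq block) : C :=
  match s, t with
  | [::], [::] => 1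
  | b :: s', c :: t' => bker r b c * fock_ker s' t'
  | _, _ => 0
  end.

Let X i (s : seq block) : seq (C * seq block) :=
  [:: (1, (i, [::]) :: s), (r [:: i], s) &
    if s is b :: s' then [:: (1, badd b i :: s'); (r (rcons (bword b) i), s')]
    else [::]].

(** [fock_ker] is the vacuum projection plus the product of a kernel in the heads and itself in the
    tails. Unfolding this n times gives [Kn n], positive by the Schur product theorem and equal to
    [fock_ker] on lists of length at most n, which suffices for a finite combination. *)
Lemma fock_ker_psd : psd fock_ker.
Proof.
pose K1 (s t : seq block) : C := if ohead s is Some b then
  if ohead t is Some c then bker r b c else 0 else 0.
pose Kn := fix Kn (n : nat) (s t : seq block) {struct n} : C :=
  (nilp s)%:R * (nilp t)%:R^* +
  if n is n'.+1 then K1 s t * Kn n' (behead s) (behead t) else 0.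
have Kn_psd n : psd (Kn n).
  elim: n => [|n IH].
    by apply: eq_psd (psd_rank1 (fun s => (nilp s)%:R)) => s t; rewrite /= addr0.
  apply: psdD; first exact: psd_rank1.
  by apply: psdM; [exact: psd_pmap r_pos.1 | exact: psd_map IH].
have KnE n s t : (size s <= n)%N -> Kn n s t = fock_ker s t.
  elim: n s t => [|n IH] [|b s] [|c t] //= sn;
    by rewrite /K1 /= ?conjC1 ?conjC0 ?mul0r ?mul1r ?mulr0 ?add0r ?addr0 ?IH.
move=> a; pose n := \max_(x <- a) size x.2.
have := Kn_psd n a; congr (_ <= _).
rewrite /sesq 2!big_seq; apply: eq_bigr => x xa.
rewrite 2!big_seq; apply: eq_bigr => y ya; rewrite KnE //.
by rewrite /n (big_rem x xa) /= leq_maxl.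
Qed.

Let K_sym i s t :
  lin (fock_ker^~ t) (X i s) = (lin (fun u => (fock_ker s u)^*) (X i t))^*.
Proof.
rewrite /lin; case: s t => [|b s] [|c t];
  rewrite !big_cons !big_nil /= !rmorphD !rmorphM /=;
  rewrite ?conjC0 ?conjC1 ?conjCK ?mul1r ?mulr1 ?mulr0 ?addr0 ?add0r ?r_real //.
- by rewrite r_herm.
- by rewrite bker1.
- rewrite r_herm bker_add bker1; ring.
Qed.

(** The series of all ways to complete the block [v] to a word of [r], with an arbitrary excursion
    above it after each new letter. *)
Let F v : series := ncsubst (tails r v) (fun i => ncindet R i * moments mu).

Let F_nil v : F v [::] = 0.
Proof. by rewrite ncsubst_nil. Qed.

Let lderiv_F v i :
  lderiv i (F v) = moments mu * (r (rcons v i) *: 1 + F (rcons v i)).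
Proof.
have z0 j : (ncindet R j * moments mu) [::] = 0 by rewrite indM.
rewrite /F [ncsubst (tails r v) _]ncsubst_rec // scale0r add0r.
under eq_bigr => j _ do rewrite -mulrA.
by rewrite lderiv_sum_indet lderiv_tails ncsubstD ncsubstC.
Qed.

Let F1 : F [::] = moment_series mu.
Proof.
have [r0 rM] := rtransformP mu; rewrite -[RHS]rM muP; congr (ncsubst _ _).
by apply: ncseriesP => -[|i w] //=; rewrite -muP.
Qed.

Let lderiv_M i :
  lderiv i (moments mu) = moments mu * (r [:: i] *: 1 + F [:: i]).
Proof. by rewrite lderiv_moments -F1 lderiv_F. Qed.

(** The list is a stack with its head on top: to reach the vacuum, a word makes an excursion above
    the stack, then completes the blocks in order, whence the factorisation. *)
Let G (s : seq block) : series := moments mu * \prod_(b <- s) F (bword b).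

Let path_G s w : path_sum fock_ker X [::] s w = G s w.
Proof.
elim: w s => [|i w IH] s.
  rewrite [LHS]/= /G ncs_mul_nil moments_nil mul1r.
  by case: s => [|b s]; rewrite ?big_nil // big_cons ncs_mul_nil F_nil mul0r.
rewrite [LHS]/= -lderivE.
have -> : lderiv i (G s) = \sum_(x <- X i s) x.1 *: G x.2.
  rewrite /G lderivM moments_nil scale1r lderiv_M.
  case: s => [|b s]; rewrite !big_cons !big_nil.
    rewrite [lderiv i 1](_ : _ = 0); last by apply: ncseriesP.
    by rewrite add0r !mulr1 scale1r addr0 mulrDr -scalerAr mulr1 addrC.
  rewrite lderivM F_nil scale0r add0r lderiv_F bwordD.
  rewrite [LHS]addrC /= !scale1r addr0 !mulrDr.
  rewrite ![(moments mu * _ + moments mu * _) * _]mulrDl -!scalerAr -!scalerAl.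
  rewrite !mulr1 -!mulrA.
  by rewrite [X in X + _ = _]addrC [X in _ + X = _]addrC -addrA.
by rewrite ncs_sumE; apply: eq_bigr => x _; rewrite IH.
Qed.

Lemma good_of_rtransform : good mu.
Proof.
split.
  have := psd_map (fun w => ([::], w)) (path_sum_psd fock_ker_psd K_sym).
  by apply: eq_psd => v w; rewrite path_G /G big_nil mulr1.
have [D [D1 bD]] := r_bd; have D0 : 0 <= D by apply: le_trans D1.
pose rho (s : seq block) := \prod_(b <- s) D ^+ size (bword b).
have rho0 s : 0 <= rho s by apply: prodr_ge0 => b _; rewrite exprn_ge0.
(* [X i] is a sum of four operators, each of which multiplies the weight [rho] by at most D. *)
exists (4 * D); split.
  by apply: le_trans D1 _; rewrite -[X in X <= _]mul1r ler_wpM2r // ler1n.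
move=> w; rewrite -[moments mu w]mul1r.
have -> : 1 * moments mu w = G [::] w by rewrite /G big_nil mulr1 mul1r.
have -> : (4 * D) ^+ size w = (4 * D) ^+ size w * rho [::].
  by rewrite /rho big_nil mulr1.
rewrite -path_G; apply: path_sum_bound; first by rewrite mulr_ge0.
  case=> [|b s] /=; first by rewrite normr1 /rho big_nil.
  by rewrite normr0 rho0.
have r1 i : `|r [:: i]| <= D by rewrite (le_trans (bD _)).
have E (a b c d x : C) : a <= x -> b <= x -> c <= x -> d <= x ->
    a + (b + (c + d)) <= 4 * x.
  move=> h1 h2 h3 h4; rewrite [4 * x](_ : _ = x + (x + (x + x))); last by ring.
  by rewrite !lerD.
move=> i s; rewrite -mulrA; case: s => [|b s]; rewrite !big_cons !big_nil.
  (* On the vacuum, preservation and annihilation are absent; two zero terms stand in for them. *)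
  rewrite -[X in _ + (_ + X)](addr0 0); apply: E => //; rewrite /rho ?big_cons;
    by rewrite big_nil ?normr1 ?mul1r ?mulr1 ?expr1 ?r1.
have h : rho (badd b i :: s) = D * rho (b :: s).
  by rewrite /rho !big_cons mulrA -exprS bwordD size_rcons.
have h' : rho ((i, [::]) :: b :: s) = D * rho (b :: s) by rewrite /rho big_cons expr1.
rewrite addr0 /= !h h' normr1 !mul1r; apply: E => //.
  by apply: ler_wpM2r; rewrite ?rho0 ?r1.
rewrite /rho big_cons mulrA; apply: ler_wpM2r; first exact: rho0.
by apply: le_trans (bD _) _; rewrite /= size_rcons -exprS.
Qed.

End Free.
End Fock.
End Positivity.

(** * Geometric bound on the R-transform *)

Section RBound.
Variables (R : realType) (k : nat).
Local Notation series := (ncseries R k).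
Local Notation C := (R[i]).
Implicit Types (f g h r : series) (v w : seq 'I_k) (i j : 'I_k) (c : R[i]).
Implicit Types (mu nu : ncdist R k).

Section TruncatedNorm.
Variable rho : C.
Hypothesis rho0 : 0 <= rho.

(* The weighted l1-norm, sum of [`|f w| * rho ^+ size w] over the words of
   length at most [n]. *)
Fixpoint tnorm n f : C :=
  `|f [::]| + if n is n'.+1 then rho * \sum_i tnorm n' (lderiv i f) else 0.

Lemma tnorm_ge0 n f : 0 <= tnorm n f.
Proof.
elim: n f => [|n IH] f /=; rewrite addr_ge0 // mulr_ge0 // sumr_ge0 // => i _.
Qed.

Lemma tnormS n f : tnorm n f <= tnorm n.+1 f.
Proof.
elim: n f => [|n IH] f; rewrite [tnorm _ f]/= [tnorm _.+1 f]/=.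
  by rewrite lerD2l mulr_ge0 // sumr_ge0 // => i _; rewrite addr_ge0.
by rewrite lerD2l; apply: ler_wpM2l => //; apply: ler_sum => i _; apply: IH.
Qed.

Lemma tnormD n f g : tnorm n (f + g) <= tnorm n f + tnorm n g.
Proof.
elim: n f g => [|n IH] f g /=; first by rewrite !addr0; apply: ler_normD.
rewrite addrACA lerD ?ler_normD // -mulrDr; apply: ler_wpM2l => //.
by rewrite -big_split; apply: ler_sum => i _; rewrite lderivD; apply: IH.
Qed.

Lemma tnormZ n c f : tnorm n (c *: f) = `|c| * tnorm n f.
Proof.
elim: n f => [|n IH] f /=; rewrite mulrDr normrM ?mulr0 //; congr (_ + _).
rewrite mulrCA; congr (_ * _); rewrite mulr_sumr; apply: eq_bigr => i _.
by rewrite lderivZ IH.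
Qed.

Lemma tnormM n f g : tnorm n (f * g) <= tnorm n f * tnorm n g.
Proof.
elim: n f g => [|n IH] f g.
  by rewrite /tnorm !addr0 ncs_mul_nil normrM.
rewrite [tnorm _ (f * g)]/tnorm -/tnorm ncs_mul_nil normrM.
rewrite [tnorm _ f]/tnorm -/tnorm mulrDl.
have E : tnorm n.+1 g = `|g [::]| + rho * \sum_i tnorm n (lderiv i g) by [].
rewrite [X in _ <= `|f [::]| * X + _]E mulrDr -addrA lerD2l.
apply: (@le_trans _ _ (rho * \sum_i (`|f [::]| * tnorm n (lderiv i g) +
    tnorm n (lderiv i f) * tnorm n.+1 g))).
  apply: ler_wpM2l => //; apply: ler_sum => i _; rewrite lderivM.
  apply: le_trans (tnormD _ _ _) _; rewrite tnormZ lerD2l.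
  apply: le_trans (IH _ _) _; apply: ler_wpM2l; first exact: tnorm_ge0.
  exact: tnormS.
by rewrite big_split mulrDr -mulr_sumr -mulr_suml mulrCA !mulrA.
Qed.

Lemma tnorm_coef f w : `|f w| * rho ^+ size w <= tnorm (size w) f.
Proof.
elim: w f => [|i w IH] f; first by rewrite mulr1 /= addr0.
rewrite exprS mulrCA; apply: (@le_trans _ _ (rho * tnorm (size w) (lderiv i f))).
  by apply: ler_wpM2l => //; exact: (IH (lderiv i f)).
rewrite /= ler_wpDl //; apply: ler_wpM2l => //.
by rewrite (bigD1 i) //= ler_wpDr // sumr_ge0 // => j _; apply: tnorm_ge0.
Qed.

Lemma tnormC n c : tnorm n (c *: 1) = `|c|.
Proof.
rewrite tnormZ; case: n => [|n] /=; first by rewrite normr1 addr0 mulr1.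
rewrite big1 ?mulr0 ?addr0 ?normr1 ?mulr1 // => i _.
have -> : lderiv i 1 = 0 *: 1 :> series by rewrite scale0r; apply: ncseriesP.
by rewrite tnormZ normr0 mul0r.
Qed.

Lemma tnorm1 n : tnorm n 1 = 1.
Proof. by rewrite -[X in tnorm n X](scale1r (1 : series)) tnormC normr1. Qed.

Lemma lderiv_subst f (S : series) i :
  lderiv i (ncsubst f (fun j => ncindet R j * S)) =
  S * ncsubst (lderiv i f) (fun j => ncindet R j * S).
Proof.
have z0 j : (ncindet R j * S) [::] = 0 by rewrite indM.
rewrite [X in lderiv i X]ncsubst_rec // lderivD lderivZ.
have -> : lderiv i 1 = 0 :> series by apply: ncseriesP.
rewrite scaler0 add0r.
by under eq_bigr => j _ do rewrite -mulrA; rewrite lderiv_sum_indet.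
Qed.

(** The substitution spends a letter before each [S], so only shorter truncations of [S] matter. A
    derivative of [f] replaces A by A D, and the induction closes since A + 4 k rho D A <= 2 A. *)
Lemma tnorm_subst (D A : C) f (S : series) n :
  1 <= D -> k%:R * rho * D * 4 <= 1 -> 0 <= A ->
  (forall w, `|f w| <= A * D ^+ size w) ->
  (forall m, (m < n)%N -> tnorm m S <= 2) ->
  tnorm n (ncsubst f (fun i => ncindet R i * S)) <= A * 2.
Proof.
move=> D1 rhoD; have D0 : 0 <= D by apply: le_trans D1.
elim: n f A => [|n IH] f A A0 fA S2.
  rewrite /tnorm addr0 ncsubst_nil; apply: le_trans (fA _) _.
  by rewrite mulr1 ler_peMr // ler1n.
rewrite [X in X <= _]/tnorm -/tnorm ncsubst_nil.
apply: (@le_trans _ _ (A + rho * \sum_(i < k) (2 * (A * D * 2)))).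
  apply: lerD; first by have := fA [::]; rewrite mulr1.
  apply: ler_wpM2l => //; apply: ler_sum => i _; rewrite lderiv_subst.
  apply: le_trans (tnormM _ _ _) _; apply: ler_pM; rewrite ?tnorm_ge0 ?S2 //.
  apply: IH; first exact: mulr_ge0.
    by move=> w; rewrite -mulrA -exprS; apply: (fA (i :: w)).
  by move=> m mn; apply: S2; apply: leqW.
rewrite sumr_const card_ord [A * 2]mulr_natr mulr2n lerD2l.
rewrite -[X in _ <= X]mulr1; apply: le_trans (ler_wpM2l A0 rhoD).
rewrite le_eqVlt; apply/orP; left; apply/eqP; rewrite -mulr_natr; ring.
Qed.

End TruncatedNorm.

(** The series K_i = z_i / (1 + R) invert the series z_i (1 + M): both R and M (K) solve g = R (K_i
    (1 + g)). *)
Lemma rtransform_inverse mu :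
  rtransform mu = ncsubst (moment_series mu)
    (fun i => ncindet R i * (1 + rtransform mu)^-1).
Proof.
set r := rtransform mu; have [r0 rM] := rtransformP mu.
have u : 1 + r \is a GRing.unit by apply: ncseries_unit; rewrite ncs_addE r0 addr0.
pose K i := ncindet R i * (1 + r)^-1.
have K0 i : K i [::] = 0 by rewrite /K indM.
apply: (ncsubst_self_unique (f := r) K0 r0).
  by rewrite -[RHS]ncsubst_id; apply: eq_ncsubst => i; rewrite /K divrK.
rewrite -[in RHS]rM -/r ncsubst_comp //; last by move=> i; rewrite indM.
apply: eq_ncsubst => i.
by rewrite ncsubstM // ncsubst_indet // ncsubstD ncsubst1.
Qed.

(** A bootstrap on the truncation length. By [rtransform_inverse], r up to length n + 1 depends on S
    = 1 / (1 + r) only up to length n; then S = 1 - S r gives x <= 1 + x / 2 for the truncated norm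
    x of S, which is finite, so x <= 2. *)
Lemma rtransform_geom_bounded mu :
  geom_bounded (moments mu) -> geom_bounded (rtransform mu).
Proof.
move=> [D [D1 bD]]; have D0 : 0 <= D by apply: le_trans D1.
have Dgt0 : 0 < D by apply: lt_le_trans D1.
(* The estimate of r is 4 k rho D, to be at most 1/2: hence the 8. Using [k.+1] makes E at least 1
   for every k. *)
pose E : C := k.+1%:R * D * 8; pose rho := E^-1.
have E1 : 1 <= E.
  rewrite /E -mulrA -[X in X <= _]mul1r; apply: ler_pM => //; first by rewrite ler1n.
  by apply: le_trans D1 _; rewrite ler_peMr // ler1n.
have E0 : 0 < E by apply: lt_le_trans E1.
have rho0 : 0 <= rho by rewrite invr_ge0 ltW.
have kE : k%:R * rho * D * 8 <= 1.
  have -> : k%:R * rho * D * 8 = (k%:R * D * 8) / E by rewrite /rho; ring.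
  rewrite ler_pdivrMr // mul1r /E; apply: ler_wpM2r => //; apply: ler_wpM2r => //.
  by rewrite ler_nat.
set r := rtransform mu; pose S := (1 + r)^-1.
have [r0 _] := rtransformP mu.
have u : 1 + r \is a GRing.unit by apply: ncseries_unit; rewrite ncs_addE r0 addr0.
have SE : S = 1 - S * r.
  have : S * (1 + r) = 1 by rewrite mulVr.
  by rewrite mulrDr mulr1 => <-; rewrite addrK.
have Mb i w : `|lderiv i (moment_series mu) w| <= D * D ^+ size w.
  by rewrite -lderiv_moments -exprS; apply: bD.
have P n : tnorm rho n S <= 2 /\ tnorm rho n r <= 2^-1.
  elim/ltn_ind: n => n IH.
  have rn : tnorm rho n r <= 2^-1.
    case: n IH => [|n] IH.
      by rewrite /tnorm r0 normr0 addr0 invr_ge0.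
    rewrite [X in X <= _]/tnorm -/tnorm r0 normr0 add0r.
    have -> : 2^-1 = 1 * 2^-1 :> C by rewrite mul1r.
    apply: le_trans (ler_wpM2r _ kE) => //.
    apply: (@le_trans _ _ (rho * \sum_(i < k) (2 * (D * 2)))).
      apply: ler_wpM2l => //; apply: ler_sum => i _.
      rewrite /r rtransform_inverse lderiv_subst -/r.
      apply: le_trans (tnormM rho0 _ _ _) _; apply: ler_pM; rewrite ?tnorm_ge0 //.
        by case: (IH n (ltnSn n)).
      apply: (tnorm_subst rho0 D1) => //; last by move=> m mn; case: (IH m (ltnW mn)).
      apply: le_trans kE; apply: ler_wpM2l; first by rewrite !mulr_ge0.
      by rewrite ler_nat.
    rewrite sumr_const card_ord le_eqVlt; apply/orP; left; apply/eqP.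
    rewrite -mulr_natr; field.
  split=> //.
  have h : tnorm rho n S <= 1 + tnorm rho n S * 2^-1.
    rewrite {1}SE; apply: le_trans (tnormD rho0 _ _ _) _.
    rewrite tnorm1 lerD2l -scaleN1r tnormZ normrN1 mul1r.
    apply: le_trans (tnormM rho0 _ _ _) _; apply: ler_wpM2l => //.
    exact: tnorm_ge0.
  have := ler_wpM2r (x := 2) _ h; rewrite mulrDl mulfVK ?pnatr_eq0 // => /(_ _).
  move=> /(_ (ler0n _ 2)); rewrite mulr_natr mulr2n lerD2r mul1r.
  by [].
exists E; split=> // w.
have := le_trans (tnorm_coef rho0 r w) (proj2 (P (size w))).
rewrite exprVn ler_pdivrMr ?exprn_gt0 // => /le_trans; apply.
by rewrite ler_piMl ?exprn_ge0 ?ltW // invf_lt1 // ltr1n.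
Qed.

End RBound.

(** * Infinitesimal limit of convolution roots *)

Section Asymptotics.
Variable R : realType.
Local Notation C := (R[i]).
Implicit Types (a b : nat -> C).

Definition bnd a := exists B : C, forall n, `|a n| <= B.

(** Decay of order 1 / (n + 1) rather than mere convergence: then n + 1 times an equation turns
    bounded right-hand sides into small unknowns. *)
Definition small a := bnd (fun n => n.+1%:R * a n).

Lemma bnd_cst (c : C) : bnd (fun=> c).
Proof. by exists `|c|. Qed.

Lemma bndD a b : bnd a -> bnd b -> bnd (fun n => a n + b n).
Proof.
move=> [A aA] [B bB]; exists (A + B) => n.
by apply: le_trans (ler_normD _ _) _; apply: lerD.
Qed.

Lemma bndM a b : bnd a -> bnd b -> bnd (fun n => a n * b n).
Proof.
move=> [A aA] [B bB]; exists (A * B) => n.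
by rewrite normrM; apply: ler_pM.
Qed.

Lemma eq_bnd a b : a =1 b -> bnd a -> bnd b.
Proof. by move=> ab [B aB]; exists B => n; rewrite -ab. Qed.

Lemma bnd_sum (I : Type) (s : seq I) (P : pred I) (F : I -> nat -> C) :
  (forall i, P i -> bnd (F i)) -> bnd (fun n => \sum_(i <- s | P i) F i n).
Proof.
move=> bF; elim: s => [|i s IH].
  by apply: eq_bnd (bnd_cst 0) => n; rewrite big_nil.
have [Pi|Pi] := boolP (P i).
  by apply: eq_bnd (bndD (bF i Pi) IH) => n; rewrite big_cons Pi.
by apply: eq_bnd IH => n; rewrite big_cons (negbTE Pi).
Qed.

Lemma eq_small a b : a =1 b -> small a -> small b.
Proof. by move=> ab; apply: eq_bnd => n; rewrite ab. Qed.

Lemma small_bnd a : small a -> bnd a.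
Proof.
move=> [B aB]; exists B => n; apply: le_trans (aB n).
by rewrite normrM normr_nat ler_peMl // ler1n.
Qed.

Lemma smallMl a b : small a -> bnd b -> small (fun n => a n * b n).
Proof. by move=> sa bb; apply: eq_bnd (bndM sa bb) => n; rewrite mulrA. Qed.

Lemma smallMr a b : bnd a -> small b -> small (fun n => a n * b n).
Proof. by move=> ba sb; apply: eq_bnd (bndM ba sb) => n; rewrite mulrCA. Qed.

Lemma small0 : small (fun=> 0).
Proof. by apply: eq_bnd (bnd_cst 0) => n; rewrite mulr0. Qed.

Lemma small_sum (I : Type) (s : seq I) (P : pred I) (F : I -> nat -> C) :
  (forall i, P i -> small (F i)) -> small (fun n => \sum_(i <- s | P i) F i n).
Proof.
by move=> sF; apply: eq_bnd (bnd_sum s sF) => n; rewrite mulr_sumr.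
Qed.

Lemma small_cst (c : C) : small (fun=> c) -> c = 0.
Proof.
move=> [B hB].
have rB n : n.+1%:R * complex.Re `|c| <= complex.Re B.
  have := hB n; rewrite normrM normr_nat normc_def.
  rewrite -(rmorph_nat (real_complex R)) -rmorphM.
  by case: B {hB} => b1 b2; rewrite lecE /= => /andP[_].
have c0 : 0 <= complex.Re `|c| by rewrite normc_def /= Num.Theory.sqrtr_ge0.
have [e|ne] := eqVneq (complex.Re `|c|) 0.
  by apply/eqP; rewrite -normr_eq0; move: e; rewrite normc_def /= => ->.
have c1 : 0 < complex.Re `|c| by rewrite lt_def ne.
have := rB (Num.truncn (complex.Re B / complex.Re `|c|)).
rewrite -ler_pdivlMr // => h.
have := truncnS_gt (complex.Re B / complex.Re `|c|).
by move=> /(le_lt_trans h); rewrite ltxx.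
Qed.

(** [|x| - x] is at most twice the distance from [x] to any nonnegative number. *)
Lemma ge0_small (x : C) a : (forall n, 0 <= a n) ->
  small (fun n => a n - x) -> 0 <= x.
Proof.
move=> a0 ax; suff : `|x| - x = 0 by move/subr0_eq => <-.
apply: small_cst; have [B hB] := ax; exists (B * 2) => n.
rewrite normrM normr_nat.
have e : `| `|x| - x| <= `|a n - x| * 2.
  have -> : `|x| - x = (`|x| - `|a n|) + (a n - x) by rewrite (ger0_norm (a0 n)) addrA subrK.
  apply: le_trans (ler_normD _ _) _; rewrite mulr_natr mulr2n lerD2r.
  by apply: le_trans (ler_dist_dist _ _) _; rewrite distrC.
apply: le_trans (ler_wpM2l (ler0n _ _) e) _; rewrite mulrA ler_wpM2r //.
by have := hB n; rewrite normrM normr_nat.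
Qed.

End Asymptotics.

Section Limit.
Variables (R : realType) (k : nat).
Local Notation series := (ncseries R k).
Local Notation C := (R[i]).
Implicit Types (f g h r : series) (v w : seq 'I_k) (i j : 'I_k) (c : R[i]).
Implicit Types (mu nu : ncdist R k).

Section Words.
Variable M : nat -> series.
Hypothesis M0 : forall n, M n [::] = 0.

Lemma bnd_wprod v w : (forall u, (size u < size w)%N -> bnd (fun n => M n u)) ->
  bnd (fun n => wprod (M n) v w).
Proof.
elim: v w => [|i v IH] w bM.
  by apply: eq_bnd (bnd_cst ((1 : series) w)) => n; rewrite /wprod big_nil.
case: w bM => [|j w] bM.
  by apply: eq_bnd (bnd_cst 0) => n; rewrite wprod_cons.
apply: (@eq_bnd _ (fun n => (j == i)%:R * \sum_(m < (size w).+1)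
    ((1 + M n) (take m w) * wprod (M n) v (drop m w)))).
  by move=> n; rewrite wprod_cons.
apply: bndM (bnd_cst _) _; apply: bnd_sum => m _; apply: bndM.
  by apply: bndD (bnd_cst _) (bM _ _); rewrite /= ltnS size_take; case: ltnP => // /ltnW.
by apply: IH => u uw; apply: bM; move: uw; rewrite size_drop /=; lia.
Qed.

(** A word longer than [v] must take some letters from a factor [1 + M n], hence a small coefficient
    of [M n]. *)
Lemma small_wprod v w : (size v < size w)%N ->
  (forall u, u != [::] -> (size u < size w)%N -> small (fun n => M n u)) ->
  small (fun n => wprod (M n) v w).
Proof.
move=> vw sM.
have bM w' : (size w' <= size w)%N ->
    forall u, (size u < size w')%N -> bnd (fun n => M n u).
  move=> w'w u uw; have [->|u0] := eqVneq u [::].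
    by apply: eq_bnd (bnd_cst 0) => n; rewrite M0.
  by apply: small_bnd; apply: sM => //; apply: leq_trans uw w'w.
elim: v w vw sM bM => [|i v IH] [|j w] // vw sM bM.
  by apply: eq_small (small0 _) => n; rewrite /wprod big_nil.
apply: (@eq_small _ (fun n => (j == i)%:R * \sum_(m < (size w).+1)
    ((1 + M n) (take m w) * wprod (M n) v (drop m w)))).
  by move=> n; rewrite wprod_cons.
apply: smallMr (bnd_cst _) _; apply: small_sum => m _.
(* If the first factor [1 + M n] contributes nothing, both words lose one letter and the induction
   goes on; otherwise its coefficient is small and the rest is bounded. *)
case: (posnP m) => [m0|m_gt0].
  apply: smallMr.
    rewrite m0 take0; apply: eq_bnd (bnd_cst 1) => n.
    by rewrite ncs_addE M0 addr0.
  rewrite m0 drop0; apply: IH => // [u u0 uw|w' w'w u uw].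
    by apply: sM => //; apply: leqW.
  by apply: (bM w') => //; apply: leqW.
have tw : take m w != [::].
  rewrite -size_eq0 size_take; case: ltnP => _; move: m_gt0 vw => /=; lia.
apply: smallMl.
  apply: (@eq_small _ (fun n => M n (take m w))) => [n|].
    rewrite ncs_addE [X in X + _](_ : _ = 0) ?add0r //.
    by rewrite -[LHS]/((take m w == [::])%:R) (negbTE tw).
  by apply: sM => //; rewrite /= ltnS size_take; case: ltnP => // /ltnW.
apply: bnd_wprod => u uw; apply: (bM (drop m w)) => //.
by rewrite size_drop /=; lia.
Qed.

End Words.

(** With N = n + 1, multiplying the equation of the N-th root by N turns its R-transform into the
    fixed series [r]. The difference between N M and [r] is then a sum over words shorter than the
    given one, and tends to 0. *)
Lemma cond_pos_of_infdiv mu :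
  (forall N : nat, (0 < N)%N ->
     exists nu, good nu /\ boxplus_pow N%:R nu = mu) ->
  cond_pos (rtransform mu).
Proof.
move=> infdiv; set r := rtransform mu.
have /choice[nu nuP] : forall n, exists nu, good nu /\ boxplus_pow n.+1%:R nu = mu.
  by move=> n; apply: infdiv.
pose M n := moment_series (nu n).
have M0 n : M n [::] = 0 by [].
have rnu n : n.+1%:R *: rtransform (nu n) = r.
  rewrite /r -(nuP n).2 boxplus_powP; congr (_ *: _).
  by rewrite -[RHS]/(real_complex R _) rmorph_nat.
have ME n w : n.+1%:R * M n w = r w +
    \sum_(m < size w) \sum_(v : m.-tuple 'I_k) r v * wprod (M n) v w.
  have [_ E] := rtransformP (nu n).
  rewrite -[in LHS]/(M n) /M -[X in ncs_coef X w]E ncsubstE // mulrDr.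
  rewrite -(rnu n) ncs_coefE; congr (_ + _).
  rewrite mulr_sumr; apply: eq_bigr => m _; rewrite mulr_sumr.
  by apply: eq_bigr => v _; rewrite ncs_coefE mulrA.
(* The right-hand side of [ME] only reads [M n] on shorter words, so it is bounded by induction, and
   N M is bounded. *)
have sM w : w != [::] -> small (fun n => M n w).
  have [N] := ubnP (size w); elim: N w => // N IH w wN w0.
  apply: eq_bnd (fun n => esym (ME n w)) _.
  apply: bndD (bnd_cst _) _; apply: bnd_sum => m _; apply: bnd_sum => v _.
  apply: bndM (bnd_cst _) _; apply: bnd_wprod => u uw.
  have [->|u0] := eqVneq u [::]; first by apply: eq_bnd (bnd_cst 0) => n; rewrite M0.
  by apply: small_bnd; apply: IH => //; apply: leq_trans uw _.
have sr w : small (fun n => n.+1%:R * M n w - r w).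
  apply: (@eq_small _ (fun n =>
    \sum_(m < size w) \sum_(v : m.-tuple 'I_k) r v * wprod (M n) v w)).
    by move=> n; rewrite ME addrC addKr.
  apply: small_sum => m _; apply: small_sum => v _.
  apply: smallMr (bnd_cst _) _; apply: small_wprod => //; first by rewrite size_tuple.
  by move=> u u0 _; apply: sM.
split=> [a|i].
  pose p n := n.+1%:R * sesq (bker (moments (nu n))) a a.
  apply: (@ge0_small _ _ p) => [n|].
    apply: mulr_ge0 => //.
    exact: (psd_map (@bword k) (nuP n).1.1).
  apply: (@eq_small _ (fun n => \sum_(x <- a) \sum_(y <- a) x.1 * y.1^* *
     (n.+1%:R * M n (bword x.2 ++ rev (bword y.2)) - r (bword x.2 ++ rev (bword y.2))))).
    move=> n; rewrite /p /sesq mulr_sumr -sumrB; apply: eq_bigr => x _.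
    rewrite mulr_sumr -sumrB; apply: eq_bigr => y _.
    by rewrite /bker [bword x.2 ++ _]/= moments_cons -/(M n) mulrBr mulrCA.
  by apply: small_sum => x _; apply: small_sum => y _; apply: smallMr (bnd_cst _) (sr _).
(* On one letter no correction remains: with N = 1 the coefficient of [r] is a first moment, which
   is real. *)
have := ME 0%N [:: i]; rewrite mul1r big_ord1 (@big_tuple0 _ _
  (fun v => r v * wprod (M 0%N) v [:: i])) /wprod big_nil [(1 : series) _]/= mulr0 addr0.
move=> <-; rewrite /M -moments_cons; apply/CrealP.
by rewrite -(psd_herm [:: i] [::] (nuP 0%N).1.1).
Qed.

End Limit.

(** * Distributions of operators are positive *)

Section CStarAlgebras.
Variables (R : realType) (A : cstarAlgType R).
Implicit Types (a b x y : A) (t : R).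

Lemma Re_norm_real (t : R) : 0 <= t -> complex.Re `|t%:C%C| = t.
Proof. by move=> t0; rewrite ger0_norm // lecR. Qed.

Lemma cnorm0 : cnorm (0 : A) = 0.
Proof. by rewrite -(scale0r (0 : A)) cnormZ normr0 mul0r. Qed.

Lemma cnormN a : cnorm (- a) = cnorm a.
Proof. by rewrite -scaleN1r cnormZ normrN1 mul1r. Qed.

Lemma cnorm_ge0 a : 0 <= cnorm a.
Proof.
have := cnormD a (- a); rewrite subrr cnorm0 cnormN -mulr2n.
by rewrite pmulrn_lge0.
Qed.

Lemma cnormB a b : cnorm (a - b) = cnorm (b - a).
Proof. by rewrite -opprB cnormN. Qed.

Lemma cnormZr t a : 0 <= t -> cnorm (t%:C%C *: a) = t * cnorm a.
Proof. by move=> t0; rewrite cnormZ Re_norm_real. Qed.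

Lemma cstar1 : cstar (1 : A) = 1.
Proof.
rewrite -[LHS]mulr1 -{2}[1 : A]cstarK -cstarM mulr1; exact: cstarK.
Qed.

Lemma cstar0 : cstar (0 : A) = 0.
Proof. by rewrite -(scale0r (0 : A)) cstarZ conjc0 !scale0r. Qed.

Lemma cstarN a : cstar (- a) = - cstar a.
Proof. by apply/eqP; rewrite -addr_eq0 -cstarD addNr cstar0. Qed.

Lemma cnorm_star a : cnorm (cstar a) = cnorm a.
Proof.
have E b : cnorm b <= cnorm (cstar b).
  have [->|b0] := eqVneq (cnorm b) 0; first exact: cnorm_ge0.
  have : 0 < cnorm b by rewrite lt_def b0 cnorm_ge0.
  move=> /ler_pM2r <-; rewrite -expr2 -cnorm_cstar; exact: cnormM.
by apply/eqP; rewrite eq_le E andbT -[X in _ <= cnorm X]cstarK E.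
Qed.

Lemma cnorm1_le1 : cnorm (1 : A) <= 1.
Proof.
have := cnorm_cstar (1 : A); rewrite cstar1 mulr1 => /eqP.
rewrite eq_sym expr2 -subr_eq0 -[X in _ - X]mulr1 -mulrBr mulf_eq0 subr_eq0.
by case/orP => /eqP ->.
Qed.

Lemma cnorm_eps_eq0 a : (forall e : R, 0 < e -> cnorm a <= e) -> a = 0.
Proof.
move=> h; apply: cnorm_eq0; apply/eqP; rewrite eq_le cnorm_ge0 andbT.
by apply/ler_addgt0Pr => e e0; rewrite add0r h.
Qed.

(* The square root of 1 - b is 1 - y, where y is the fixed point of the
   contraction y |-> (b + y^2) / 2 of the ball of radius 1/2. *)
Lemma cstar_sqrt b : cstar b = b -> cnorm b <= 4^-1 ->
  exists2 c, cstar c = c & c * c = 1 - b.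
Proof.
move=> bs b4; pose h : R := 2^-1.
have h0 : 0 <= h by rewrite invr_ge0.
pose T y := h%:C%C *: (b + y * y).
pose y n := iter n T 0.
have ys n : cstar (y n) = y n.
  elim: n => [|n IH]; first exact: cstar0.
  by rewrite /= /T cstarZ conjc_real cstarD cstarM bs IH.
have yb n : cnorm (y n) <= h.
  elim: n => [|n IH]; first by rewrite cnorm0.
  (* The hypothesis on [b] keeps the iterates in the ball of radius h, where T (u) - T (v) = h (u (u
     - v) + (u - v) v) contracts by the factor 1/2. *)
  rewrite /= /T cnormZr //; apply: (@le_trans _ _ (h * (4^-1 + h * h))).
    apply: ler_wpM2l => //; apply: le_trans (cnormD _ _) _; apply: lerD => //.
    by apply: le_trans (cnormM _ _) _; apply: ler_pM; rewrite ?cnorm_ge0.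
  rewrite /h; lra.
have sq u v : u * u - v * v = u * (u - v) + (u - v) * v.
  by rewrite mulrBr mulrBl addrA subrK.
have step n : cnorm (y n.+1 - y n) <= h ^+ n.
  elim: n => [|n IH].
    rewrite /= subr0 expr0; apply: le_trans (yb 1%N) _; rewrite /h; lra.
  have -> : y n.+2 - y n.+1 = h%:C%C *: (y n.+1 * y n.+1 - y n * y n).
    by rewrite -[y n.+2]/(T (y n.+1)) -[in LHS]/(T (y n)) -scalerBr opprD addrACA subrr add0r.
  rewrite cnormZr // exprS; apply: ler_wpM2l => //.
  rewrite sq; apply: le_trans (cnormD _ _) _.
  apply: (@le_trans _ _ (h * h ^+ n + h ^+ n * h)).
    by apply: lerD; apply: le_trans (cnormM _ _) _; apply: ler_pM; rewrite ?cnorm_ge0.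
  rewrite /h; lra.
have dist m n : cnorm (y (n + m)%N - y n) <= 2 * h ^+ n - 2 * h ^+ (n + m).
  elim: m => [|m IH]; first by rewrite addn0 !subrr cnorm0.
  rewrite addnS.
  have -> : y (n + m).+1 - y n = (y (n + m).+1 - y (n + m)%N) + (y (n + m)%N - y n).
    by rewrite addrA subrK.
  apply: le_trans (cnormD _ _) _; apply: le_trans (lerD (step _) IH) _.
  rewrite exprS /h; lra.
have hn0 (e : R) : 0 < e -> exists N, forall n, (N <= n)%N -> h ^+ n < e.
  move=> e0; exists (Num.truncn e^-1) => n Nn.
  have : e^-1 < 2 ^+ n.
    apply: lt_le_trans (truncnS_gt _) _; rewrite -natrX ler_nat.
    by apply: leq_ltn_trans Nn (ltn_expl _ _).
  by rewrite /h exprVn invf_plt ?posrE // exprn_gt0.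
have [l lP] : exists l, forall e : R, 0 < e -> exists N, forall n, (N <= n)%N ->
    cnorm (y n - l) < e.
  apply: cnorm_complete => e e0.
  have [|N NP] := hn0 (e / 4); first by rewrite divr_gt0.
  have E n : (N <= n)%N -> cnorm (y n - y N) < e / 2.
    move=> Nn; have := dist (n - N)%N N; rewrite subnKC //.
    have := NP N (leqnn N); have : 0 <= h ^+ n by apply: exprn_ge0.
    lra.
  exists N => m n Nm Nn.
  have -> : y m - y n = (y m - y N) + (y N - y n) by rewrite addrA subrK.
  apply: le_lt_trans (cnormD _ _) _; rewrite (cnormB (y N)).
  have := E m Nm; have := E n Nn; lra.
have ls : cstar l = l.
  apply/eqP; rewrite -subr_eq0; apply/eqP; apply: cnorm_eps_eq0 => e e0.
  have [|N NP] := lP (e / 2); first by rewrite divr_gt0.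
  have -> : cstar l - l = cstar (l - y N) + (y N - l).
    by rewrite cstarD cstarN ys addrA subrK.
  apply: le_trans (cnormD _ _) _; rewrite cnorm_star (cnormB l).
  have := NP N (leqnn N); lra.
have lE : l + l = b + l * l.
  apply/eqP; rewrite -subr_eq0; apply/eqP; apply: cnorm_eps_eq0 => e e0.
  have n0 := cnorm_ge0 l.
  have [|N NP] := lP (e / (3 + cnorm l)); first by rewrite divr_gt0 // ltr_wpDr.
  have yE : y N.+1 + y N.+1 = b + y N * y N.
    rewrite -[y N.+1]/(T (y N)) /T -scalerDl -rmorphD /=.
    by rewrite (_ : h + h = 1) ?scale1r // /h; lra.
  have -> : l + l - (b + l * l) = (l - y N.+1) + (l - y N.+1) + (y N * y N - l * l).
    have -> : l - y N.+1 + (l - y N.+1) = l + l - (b + y N * y N).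
      by rewrite addrACA -opprD yE.
    by rewrite !opprD !addrA subrK.
  have e1 := NP N (leqnn N); have e2 := NP N.+1 (leqnSn N).
  apply: le_trans (cnormD _ _) _.
  apply: (@le_trans _ _ (cnorm (y N.+1 - l) + cnorm (y N.+1 - l) +
      (1 + cnorm l) * cnorm (y N - l))).
    apply: lerD; first by apply: le_trans (cnormD _ _) _; rewrite (cnormB l).
    rewrite sq [X in _ <= X]mulrDl; apply: le_trans (cnormD _ _) _; apply: lerD.
      apply: le_trans (cnormM _ _) _; apply: ler_wpM2r; rewrite ?cnorm_ge0 //.
      by apply: le_trans (yb N) _; rewrite /h; lra.
    by apply: le_trans (cnormM _ _) _; rewrite mulrC.
  rewrite ltr_pdivlMr in e1; last by rewrite ltr_wpDr.
  rewrite ltr_pdivlMr in e2; last by rewrite ltr_wpDr.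
  have q1 : cnorm (y N.+1 - l) <= e / (3 + cnorm l) by rewrite ltW // NP.
  have q2 : cnorm (y N - l) <= e / (3 + cnorm l) by rewrite ltW // NP.
  set d := e / (3 + cnorm l) in q1 q2.
  have dE : d * (3 + cnorm l) = e by rewrite /d divfK // gt_eqF // ltr_wpDr.
  rewrite -dE; have : (1 + cnorm l) * cnorm (y N - l) <= (1 + cnorm l) * d.
    by apply: ler_wpM2l => //; rewrite addr_ge0.
  lra.
exists (1 - l); first by rewrite cstarD cstarN cstar1 ls.
have -> : b = l + l - l * l by rewrite lE addrK.
by rewrite mulrBl mul1r mulrBr mulr1 !opprB -addrA (addrCA (- l)) opprD.
Qed.

End CStarAlgebras.

Section DistributionsOfOperators.
Variables (R : realType) (A : cstarProbSpace R).
Local Notation C := (R[i]).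
Local Notation phi := (cps_state A).

(** By [cstar_sqrt], 1 - (a^* a) / t is the square of a selfadjoint element, so the state is
    nonnegative on it. The loss of a factor 4 is harmless for geometric bounds. *)
Lemma state_cnorm_le (a : A) (t : R) : 0 < t -> cnorm a ^+ 2 <= t / 4 ->
  phi (cstar a * a) <= t%:C%C.
Proof.
move=> t0 at4; pose b : A := (t^-1)%:C%C *: (cstar a * a).
have bs : cstar b = b by rewrite /b cstarZ conjc_real cstarM cstarK.
have b4 : cnorm b <= 4^-1.
  rewrite /b cnormZr; last by rewrite invr_ge0 ltW.
  rewrite cnorm_cstar [t^-1 * _]mulrC ler_pdivrMr //.
  by rewrite mulrC.
have [c cs cE] := cstar_sqrt bs b4.
have := cps_state_ge0 c; rewrite cs cE linearB /= cps_state1 subr_ge0.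
rewrite /b linearZ /= => h.
have tC : 0 <= t%:C%C :> C by rewrite lecR ltW.
have := ler_wpM2l tC h; rewrite mulrA -rmorphM /= divff ?gt_eqF // mul1r mulr1.
by [].
Qed.

Lemma psd_state : psd (fun x y : A => phi (x * cstar y)).
Proof.
move=> a; pose p : A := \sum_(x <- a) x.1 *: x.2.
have := cps_state_ge0 (cstar p); rewrite cstarK; congr (_ <= _).
have cs : cstar p = \sum_(x <- a) x.1^* *: cstar x.2.
  rewrite /p; elim: (a) => [|x s IH]; first by rewrite !big_nil cstar0.
  by rewrite !big_cons cstarD cstarZ IH.
rewrite cs /p mulr_suml linear_sum; apply: eq_bigr => x _.
rewrite mulr_sumr linear_sum; apply: eq_bigr => y _.
by rewrite -scalerAl -scalerAr scalerA linearZ.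
Qed.

Lemma state_CS (a : A) : `|phi a| ^+ 2 <= phi (a * cstar a).
Proof.
have := psd_ge0 a (psd_schur_compl 1 psd_state).
by rewrite cstar1 !mulr1 cps_state1 divr1 subr_ge0 normCK.
Qed.

End DistributionsOfOperators.

Lemma good_of_Dc (R : realType) (k : nat) (mu : ncdist R k) : Dc mu -> good mu.
Proof.
move=> [A [x [xs xmu]]]; pose phi := cps_state A.
pose X w : A := \prod_(i <- w) x i.
have mE w : moments mu w = phi (X w).
  rewrite -xmu; case: w => [|i w]; last by rewrite moments_cons.
  by rewrite moments_nil big_nil dist_fun1.
have Xs w : cstar (X w) = X (rev w).
  rewrite /X; elim: w => [|i w IH]; first by rewrite big_nil cstar1.
  by rewrite big_cons cstarM IH xs rev_cons big_rcons.
split.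
  apply: eq_psd (psd_map X (@psd_state _ A)) => v w.
  by rewrite mE Xs /X big_cat.
pose D : R := 1 + \sum_i cnorm (x i).
have D1 : 1 <= D by rewrite ler_wpDr // sumr_ge0 // => i _; apply: cnorm_ge0.
have D0 : 0 <= D by apply: le_trans D1.
have xD i : cnorm (x i) <= D.
  rewrite /D (bigD1 i) //= addrCA ler_wpDr // addr_ge0 // sumr_ge0 // => j _.
  exact: cnorm_ge0.
have XD w : cnorm (X w) <= D ^+ size w.
  rewrite /X; elim: w => [|i w IH]; first by rewrite big_nil cnorm1_le1.
  rewrite big_cons exprS; apply: le_trans (cnormM _ _) _.
  by apply: ler_pM; rewrite ?cnorm_ge0.
(* The factor 2 absorbs the 4 of [state_cnorm_le] once the word has a letter; the empty word is
   treated apart. *)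
exists (2 * D)%:C%C; split.
  by rewrite -[1]/(1%:C%C) lecR; lra.
case=> [|i w]; first by rewrite moments_nil normr1.
set u := i :: w; rewrite -rmorphXn mE.
have n1 : `|phi (X u)| \is Num.nneg by rewrite nnegrE.
have n2 : ((2 * D) ^+ size u)%:C%C \is @Num.nneg R[i].
  by rewrite nnegrE lecR exprn_ge0 ?mulr_ge0.
rewrite -(ler_pXn2r (ltn0Sn 1) n1 n2).
apply: le_trans (state_CS _) _.
rewrite -{1}(cstarK (X u)) -rmorphXn; apply: state_cnorm_le.
  by rewrite !exprn_gt0 ?mulr_gt0 // (lt_le_trans _ D1).
rewrite cnorm_star; apply: (@le_trans _ _ ((D ^+ size u) ^+ 2)).
  by rewrite ler_pXn2r ?nnegrE ?cnorm_ge0 ?exprn_ge0.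
rewrite exprMn exprMn ler_pdivlMr // mulrC ler_wpM2r ?exprn_ge0 //.
rewrite -exprM -[4](_ : 2 ^+ 2 = 4); last by rewrite -natrX.
by rewrite ler_weXn2l ?ler1n // mulSn.
Qed.

(** * Completion of a pre-C*-algebra *)

Section RealSequences.
Variable R : realType.

Definition eps_cauchy (V : zmodType) (N : V -> R) (u : nat -> V) := forall e : R,
  0 < e -> exists n0, forall m n, (n0 <= m)%N -> (n0 <= n)%N -> N (u m - u n) < e.

Definition eps_null (V : zmodType) (N : V -> R) (u : nat -> V) := forall e : R,
  0 < e -> exists n0, forall n, (n0 <= n)%N -> N (u n) < e.

Lemma real_cauchy_cvg (a : nat -> R) :
  eps_cauchy Num.norm a -> exists l, eps_null Num.norm (fun n => a n - l).
Proof.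
move=> ca; have : cauchy (a @ \oo).
  apply: cauchy_exP => e e0; have [n0 h] := ca e e0.
  exists (a n0); exists n0 => // n /= nn; rewrite /ball /= /ball_ /=.
  by apply: h.
move=> /cauchy_cvgP /cvg_ex[l al]; exists l => e e0.
have /cvgrPdist_lt/(_ e e0)[n0 _ h] := al.
by exists n0 => n nn; rewrite distrC; apply: h.
Qed.

Lemma Re_norm_le (z : R[i]) : `|complex.Re z| <= complex.Re `|z|.
Proof. by have := normc_ge_Re z; rewrite normc_def lecR. Qed.

Lemma Re_normD (x y : R[i]) :
  complex.Re `|x + y| <= complex.Re `|x| + complex.Re `|y|.
Proof. by have := ler_normD x y; rewrite !normc_def -rmorphD lecR. Qed.

Lemma Re_normM (x y : R[i]) :
  complex.Re `|x * y| = complex.Re `|x| * complex.Re `|y|.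
Proof. by rewrite normrM !normc_def -rmorphM. Qed.

Lemma Re_norm_ge0 (x : R[i]) : 0 <= complex.Re `|x|.
Proof. by rewrite normc_def sqrtr_ge0. Qed.

Lemma Re_norm_eq0 (x : R[i]) : complex.Re `|x| = 0 -> x = 0.
Proof.
by move=> e; apply/eqP; rewrite -normr_eq0; move: e; rewrite normc_def /= => ->.
Qed.

Lemma Im_norm_le (z : R[i]) : `|complex.Im z| <= complex.Re `|z|.
Proof.
have -> : complex.Re `|z| = complex.Re `|'i%C * z|.
  by rewrite Re_normM (_ : complex.Re `|'i%C : R[i]| = 1) ?mul1r // normc_def /= expr0n expr1n add0r sqrtr1.
apply: le_trans (Re_norm_le _); case: z => x y /=.
by rewrite mul0r mul1r sub0r normrN.
Qed.

Lemma Re_norm_split (z : R[i]) :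
  complex.Re `|z| <= `|complex.Re z| + `|complex.Im z|.
Proof.
rewrite normc_def /= -[X in _ <= X]ger0_norm ?addr_ge0 // -sqrtr_sqr.
rewrite ler_wsqrtr // sqrrD !real_normK ?num_real // addrAC lerDl.
by rewrite mulrn_wge0 // mulr_ge0.
Qed.

(** The modulus with values in [R], to be compared with real seminorms. *)
Definition Cnorm (z : R[i]) : R := complex.Re `|z|.

Lemma complex_cauchy_cvg (a : nat -> R[i]) :
  eps_cauchy Cnorm a -> exists l, eps_null Cnorm (fun n => a n - l).
Proof.
move=> ca.
have [x hx] : exists l, eps_null Num.norm (fun n => complex.Re (a n) - l).
  apply: real_cauchy_cvg => e e0; have [n0 h] := ca e e0; exists n0 => m n hm hn.
  by apply: le_lt_trans (h m n hm hn); rewrite -raddfB; exact: Re_norm_le.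
have [y hy] : exists l, eps_null Num.norm (fun n => complex.Im (a n) - l).
  apply: real_cauchy_cvg => e e0; have [n0 h] := ca e e0; exists n0 => m n hm hn.
  by apply: le_lt_trans (h m n hm hn); rewrite -raddfB; exact: Im_norm_le.
exists (x +i* y)%C => e e0.
have [|n1 h1] := hx (e / 2); first by rewrite divr_gt0.
have [|n2 h2] := hy (e / 2); first by rewrite divr_gt0.
exists (maxn n1 n2) => n; rewrite geq_max => /andP[nn1 nn2].
apply: le_lt_trans (Re_norm_split _) _.
rewrite [e]splitr !raddfB /=; apply: ltrD; [exact: h1 | exact: h2].
Qed.

End RealSequences.

(** [pnorm] is only a seminorm, and completeness is absent; Cauchy sequences modulo null ones repair
    both at once. [pstate_le] is the continuity that extends the state. *)
Record preCStar (R : realType) := PreCStar {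
  pcs_alg :> algType R[i];
  pnorm : pcs_alg -> R;
  pstar : pcs_alg -> pcs_alg;
  pstate : {scalar pcs_alg};
  pnorm_ge0 : forall a, 0 <= pnorm a;
  pnormD : forall a b, pnorm (a + b) <= pnorm a + pnorm b;
  pnormZ : forall (c : R[i]) a, pnorm (c *: a) = Cnorm c * pnorm a;
  pnormM : forall a b, pnorm (a * b) <= pnorm a * pnorm b;
  pstarD : forall a b, pstar (a + b) = pstar a + pstar b;
  pstarZ : forall (c : R[i]) a, pstar (c *: a) = (c^*)%C *: pstar a;
  pstarM : forall a b, pstar (a * b) = pstar b * pstar a;
  pstarK : forall a, pstar (pstar a) = a;
  pnorm_pstar : forall a, pnorm (pstar a * a) = pnorm a ^+ 2;
  pnorm_star : forall a, pnorm (pstar a) = pnorm a;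
  pstate_ge0 : forall a, 0 <= pstate (pstar a * a);
  pstate1 : pstate 1 = 1;
  pstate_le : forall a, Cnorm (pstate a) <= pnorm a
}.

Section Completion.
Variables (R : realType) (X : preCStar R).
Local Notation N := (@pnorm R X).
Local Notation seqX := (nat -> X).
Implicit Types (u v : seqX) (a b : X).
Local Notation cauchyX := (@eps_cauchy R X N).
Local Notation nullX := (@eps_null R X N).

Lemma pnorm0 : N 0 = 0.
Proof. by rewrite -(scale0r (0 : X)) pnormZ /Cnorm normr0 mul0r. Qed.

Lemma pnormN a : N (- a) = N a.
Proof. by rewrite -scaleN1r pnormZ /Cnorm normrN normr1 mul1r. Qed.

Lemma pnormB a b : N (a - b) = N (b - a).
Proof. by rewrite -opprB pnormN. Qed.

Lemma pnorm_dist a b : `|N a - N b| <= N (a - b).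
Proof.
have E x y : N x - N y <= N (x - y).
  by rewrite lerBlDr; apply: le_trans (pnormD _ _); rewrite subrK.
by rewrite ler_norml E andbT lerNl opprB pnormB E.
Qed.

Lemma null0 : nullX (fun=> 0).
Proof. by move=> e e0; exists 0%N => n _; rewrite pnorm0. Qed.

Lemma null_le u v (c : R) :
  (forall n, N (v n) <= c * N (u n)) -> nullX u -> nullX v.
Proof.
move=> vu nu e e0.
have c0 : 0 < `|c| + 1 by rewrite ltr_wpDl.
have [|n0 h] := nu (e / (`|c| + 1)); first by rewrite divr_gt0.
exists n0 => n nn; have := h n nn; rewrite ltr_pdivlMr //.
apply: le_lt_trans; apply: le_trans (vu n) _; rewrite mulrC; apply: ler_wpM2l.
  exact: pnorm_ge0.
by apply: le_trans (ler_norm _) _; rewrite lerDl.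
Qed.

Lemma nullD u v : nullX u -> nullX v -> nullX (fun n => u n + v n).
Proof.
move=> nu nv e e0.
have [|n1 h1] := nu (e / 2); first by rewrite divr_gt0.
have [|n2 h2] := nv (e / 2); first by rewrite divr_gt0.
exists (maxn n1 n2) => n; rewrite geq_max => /andP[nn1 nn2].
apply: le_lt_trans (pnormD _ _) _.
by rewrite [e]splitr; apply: ltrD; [exact: h1 | exact: h2].
Qed.

Lemma eq_null u v : u =1 v -> nullX u -> nullX v.
Proof. by move=> /funext ->. Qed.

Lemma nullN u : nullX u -> nullX (fun n => - u n).
Proof. by apply: (null_le (c := 1)) => n; rewrite pnormN mul1r. Qed.

Lemma cauchyC a : cauchyX (fun=> a).
Proof. by move=> e e0; exists 0%N => m n _ _; rewrite subrr pnorm0. Qed.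

Lemma cauchy_bounded u : cauchyX u -> exists2 B, 0 <= B & forall n, N (u n) <= B.
Proof.
move=> cu; have [n0 h] := cu 1 ltr01.
have S0 : 0 <= \sum_(i < n0) N (u i) by apply: sumr_ge0 => i _; apply: pnorm_ge0.
exists (\sum_(i < n0) N (u i) + (N (u n0) + 1)).
  by rewrite addr_ge0 // addr_ge0 // pnorm_ge0.
move=> n; case: (ltnP n n0) => nn.
  rewrite (bigD1 (Ordinal nn)) //= -addrA lerDl addr_ge0 //.
    by apply: sumr_ge0 => i _; apply: pnorm_ge0.
  by rewrite addr_ge0 // pnorm_ge0.
rewrite -[X in N X](subrK (u n0)); apply: le_trans (pnormD _ _) _.
by rewrite ler_wpDl // addrC lerD2l ltW // h.
Qed.

Lemma cauchyD u v : cauchyX u -> cauchyX v -> cauchyX (fun n => u n + v n).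
Proof.
move=> cu cv e e0.
have [|n1 h1] := cu (e / 2); first by rewrite divr_gt0.
have [|n2 h2] := cv (e / 2); first by rewrite divr_gt0.
exists (maxn n1 n2) => m n; rewrite !geq_max => /andP[m1 m2] /andP[nn1 nn2].
rewrite opprD addrACA; apply: le_lt_trans (pnormD _ _) _.
by rewrite [e]splitr; apply: ltrD; [exact: h1 | exact: h2].
Qed.

Lemma cauchyZ (c : R[i]) u : cauchyX u -> cauchyX (fun n => c *: u n).
Proof.
move=> cu e e0; have c0 : 0 <= Cnorm c by apply: Re_norm_ge0.
have c1 : 0 < Cnorm c + 1 by rewrite ltr_wpDl.
have [|n1 h1] := cu (e / (Cnorm c + 1)); first by rewrite divr_gt0.
exists n1 => m n hm hn; rewrite -scalerBr pnormZ.
have := h1 m n hm hn; rewrite ltr_pdivlMr // mulrC; apply: le_lt_trans.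
by rewrite ler_wpM2r ?pnorm_ge0 // lerDl.
Qed.

Lemma cauchyN u : cauchyX u -> cauchyX (fun n => - u n).
Proof.
move=> /(cauchyZ (-1)); congr (cauchyX _); apply/funext => n; exact: scaleN1r.
Qed.

Lemma cauchyM u v : cauchyX u -> cauchyX v -> cauchyX (fun n => u n * v n).
Proof.
move=> cu cv e e0.
have [A A0 uA] := cauchy_bounded cu; have [B B0 vB] := cauchy_bounded cv.
have A1 : 0 < A + 1 by rewrite ltr_wpDl.
have B1 : 0 < B + 1 by rewrite ltr_wpDl.
have [|n1 h1] := cu (e / 2 / (B + 1)); first by rewrite !divr_gt0.
have [|n2 h2] := cv (e / 2 / (A + 1)); first by rewrite !divr_gt0.
exists (maxn n1 n2) => m n; rewrite !geq_max => /andP[m1 m2] /andP[nn1 nn2].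
have -> : u m * v m - u n * v n = (u m - u n) * v m + u n * (v m - v n).
  by rewrite mulrBl mulrBr addrA subrK.
apply: le_lt_trans (pnormD _ _) _; rewrite [e]splitr; apply: ltrD.
  apply: le_lt_trans (pnormM _ _) _.
  have := h1 m n m1 nn1; rewrite ltr_pdivlMr //; apply: le_lt_trans.
  by apply: ler_wpM2l; rewrite ?pnorm_ge0 // (le_trans (vB m)) // lerDl.
apply: le_lt_trans (pnormM _ _) _.
have := h2 m n m2 nn2; rewrite ltr_pdivlMr // mulrC; apply: le_lt_trans.
by apply: ler_wpM2r; rewrite ?pnorm_ge0 // (le_trans (uA n)) // lerDl.
Qed.

Lemma pstarB a b : pstar (a - b) = pstar a - pstar b.
Proof. by rewrite pstarD -scaleN1r pstarZ -[(_^*)%C]/((-1)^*) rmorphN1 scaleN1r. Qed.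

Lemma cauchy_star u : cauchyX u -> cauchyX (fun n => pstar (u n)).
Proof.
move=> cu e e0; have [n0 h] := cu e e0; exists n0 => m n hm hn.
by rewrite -pstarB pnorm_star h.
Qed.

Record cseq := CSeq { cseq_val :> seqX; cseqP : cauchyX cseq_val }.
HB.instance Definition _ := gen_eqMixin cseq.
HB.instance Definition _ := gen_choiceMixin cseq.

Definition ceq (s t : cseq) : bool := `[< nullX (fun n => s n - t n) >].

Lemma ceq_refl : reflexive ceq.
Proof. by move=> s; apply/asboolP; apply: eq_null null0 => n; rewrite subrr. Qed.

Lemma ceq_sym : symmetric ceq.
Proof.
move=> s t; apply/asboolP/asboolP => /nullN;
  by apply: eq_null => n; rewrite opprB.
Qed.

Lemma ceq_trans : transitive ceq.
Proof.
move=> t s r /asboolP h1 /asboolP h2; apply/asboolP.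
by apply: eq_null (nullD h1 h2) => n; rewrite addrA subrK.
Qed.

Definition ceq_equiv := EquivRel ceq ceq_refl ceq_sym ceq_trans.

Definition completion := {eq_quot ceq_equiv}.

End Completion.

(** * Algebra structure of the completion *)

Section CompletionQuotient.
Variables (R : realType) (X : preCStar R).
Local Notation N := (@pnorm R X).
Local Notation cauchyX := (@eps_cauchy R X N).
Local Notation nullX := (@eps_null R X N).
Local Notation Q := (completion X).
Implicit Types (u v : nat -> X) (x y z : Q) (c : R[i]).

HB.instance Definition _ := Choice.copy Q {eq_quot ceq_equiv X}.

(** Made total by the class of 0 on sequences that are not Cauchy, so that the operations can be
    written without carrying proofs. *)
Definition climit u : Q :=
  if pselect (cauchyX u) is left h then \pi_({eq_quot ceq_equiv X}) (CSeq h)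
  else \pi_({eq_quot ceq_equiv X}) (CSeq (cauchyC 0)).

Definition crepr x : nat -> X := repr (x : {eq_quot ceq_equiv X}).

Lemma climit_eqP u v : cauchyX u -> cauchyX v ->
  climit u = climit v <-> nullX (fun n => u n - v n).
Proof.
move=> cu cv; rewrite /climit.
case: pselect => // {}cu; case: pselect => // {}cv.
by split=> [/eqmodP/asboolP|h] //; apply/eqmodP/asboolP.
Qed.

Lemma eq_climit u v : u =1 v -> climit u = climit v.
Proof. by move=> /funext ->. Qed.

Lemma crepr_cauchy x : cauchyX (crepr x).
Proof. exact: cseqP. Qed.

Lemma creprK x : climit (crepr x) = x.
Proof.
rewrite /climit; case: pselect => [h|/(_ (crepr_cauchy x))] //.
rewrite -[RHS](reprK (x : {eq_quot ceq_equiv X})); congr (\pi _).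
by rewrite /crepr in h *; case: (repr _) h => s cs h; congr CSeq; apply: Prop_irrelevance.
Qed.

Lemma climit_surj x : exists2 u, cauchyX u & x = climit u.
Proof. by exists (crepr x); [exact: crepr_cauchy | rewrite creprK]. Qed.

Lemma crepr_climit u : cauchyX u -> nullX (fun n => crepr (climit u) n - u n).
Proof.
by move=> cu; apply/climit_eqP; rewrite ?creprK //; apply: crepr_cauchy.
Qed.

Definition completion_add x y := climit (fun n => crepr x n + crepr y n).
Definition completion_opp x := climit (fun n => - crepr x n).
Definition completion_zero := climit (fun=> 0).
Definition completion_mul x y := climit (fun n => crepr x n * crepr y n).
Definition completion_one := climit (fun=> 1).
Definition completion_scale c x := climit (fun n => c *: crepr x n).
Definition completion_star x := climit (fun n => pstar (crepr x n)).

Lemma completion_addE u v : cauchyX u -> cauchyX v ->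
  completion_add (climit u) (climit v) = climit (fun n => u n + v n).
Proof.
move=> cu cv; apply/climit_eqP; try by apply: cauchyD => //; apply: crepr_cauchy.
have := nullD (crepr_climit cu) (crepr_climit cv).
by apply: eq_null => n; rewrite opprD addrACA.
Qed.

Lemma completion_oppE u : cauchyX u ->
  completion_opp (climit u) = climit (fun n => - u n).
Proof.
move=> cu; apply/climit_eqP; try by apply: cauchyN => //; apply: crepr_cauchy.
have := nullN (crepr_climit cu).
by apply: eq_null => n; rewrite opprD.
Qed.

Lemma completion_scaleE c u : cauchyX u ->
  completion_scale c (climit u) = climit (fun n => c *: u n).
Proof.
move=> cu; apply/climit_eqP; try by apply: cauchyZ => //; apply: crepr_cauchy.
apply: (null_le (c := Cnorm c)) (crepr_climit cu) => n.
by rewrite -scalerBr pnormZ.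
Qed.

Lemma completion_starE u : cauchyX u ->
  completion_star (climit u) = climit (fun n => pstar (u n)).
Proof.
move=> cu; apply/climit_eqP; try by apply: cauchy_star => //; apply: crepr_cauchy.
apply: (null_le (c := 1)) (crepr_climit cu) => n.
by rewrite -pstarB pnorm_star mul1r.
Qed.

Lemma completion_mulE u v : cauchyX u -> cauchyX v ->
  completion_mul (climit u) (climit v) = climit (fun n => u n * v n).
Proof.
move=> cu cv; have cu' := crepr_cauchy (climit u).
apply/climit_eqP; try by apply: cauchyM => //; apply: crepr_cauchy.
have [A A0 uA] := cauchy_bounded cu'; have [B B0 vB] := cauchy_bounded cv.
set u' := crepr _; set v' := crepr _.
apply: (@eq_null _ _ (fun n => u' n * (v' n - v n) + (u' n - u n) * v n)).
  by move=> n; rewrite mulrBr mulrBl addrA subrK.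
apply: nullD.
  apply: (null_le (c := A)) (crepr_climit cv) => n.
  by apply: le_trans (pnormM _ _) _; apply: ler_wpM2r; rewrite ?pnorm_ge0.
apply: (null_le (c := B)) (crepr_climit cu) => n.
apply: le_trans (pnormM _ _) _; rewrite mulrC; apply: ler_wpM2r => //.
exact: pnorm_ge0.
Qed.

Lemma completion_addA : associative completion_add.
Proof.
move=> x y z; have [u cu ->] := climit_surj x; have [v cv ->] := climit_surj y.
have [w cw ->] := climit_surj z.
rewrite !completion_addE //; try exact: cauchyD.
by apply: eq_climit => n; rewrite addrA.
Qed.

Lemma completion_addC : commutative completion_add.
Proof.
move=> x y; have [u cu ->] := climit_surj x; have [v cv ->] := climit_surj y.
by rewrite !completion_addE //; apply: eq_climit => n; rewrite addrC.
Qed.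

Lemma completion_add0 : left_id completion_zero completion_add.
Proof.
move=> x; have [u cu ->] := climit_surj x.
rewrite completion_addE //; last exact: cauchyC.
by apply: eq_climit => n; rewrite add0r.
Qed.

Lemma completion_addN : left_inverse completion_zero completion_opp completion_add.
Proof.
move=> x; have [u cu ->] := climit_surj x.
rewrite completion_oppE // completion_addE //; last exact: cauchyN.
by apply: eq_climit => n; rewrite addNr.
Qed.

HB.instance Definition _ := GRing.isZmodule.Build Q
  completion_addA completion_addC completion_add0 completion_addN.

Lemma completion_mulA : associative completion_mul.
Proof.
move=> x y z; have [u cu ->] := climit_surj x; have [v cv ->] := climit_surj y.
have [w cw ->] := climit_surj z.
rewrite !completion_mulE //; try exact: cauchyM.
by apply: eq_climit => n; rewrite mulrA.
Qed.

Lemma completion_mul1 : left_id completion_one completion_mul.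
Proof.
move=> x; have [u cu ->] := climit_surj x.
rewrite completion_mulE //; last exact: cauchyC.
by apply: eq_climit => n; rewrite mul1r.
Qed.

Lemma completion_mulr1 : right_id completion_one completion_mul.
Proof.
move=> x; have [u cu ->] := climit_surj x.
rewrite completion_mulE //; last exact: cauchyC.
by apply: eq_climit => n; rewrite mulr1.
Qed.

Lemma completion_mulDl : left_distributive completion_mul completion_add.
Proof.
move=> x y z; have [u cu ->] := climit_surj x; have [v cv ->] := climit_surj y.
have [w cw ->] := climit_surj z.
rewrite !(completion_addE, completion_mulE) //; try exact: cauchyM; try exact: cauchyD.
by apply: eq_climit => n; rewrite mulrDl.
Qed.

Lemma completion_mulDr : right_distributive completion_mul completion_add.
Proof.
move=> x y z; have [u cu ->] := climit_surj x; have [v cv ->] := climit_surj y.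
have [w cw ->] := climit_surj z.
rewrite !(completion_addE, completion_mulE) //; try exact: cauchyM; try exact: cauchyD.
by apply: eq_climit => n; rewrite mulrDr.
Qed.

(** The state bounds the seminorm of 1 from below, so the completion is not the zero ring. *)
Lemma pnorm1_ge1 : 1 <= N 1.
Proof. by have := pstate_le (1 : X); rewrite pstate1 /Cnorm normr1. Qed.

Lemma completion_one_neq0 : completion_one != 0.
Proof.
apply/eqP => /climit_eqP -/(_ (cauchyC _) (cauchyC _)) /(_ 1 ltr01)[n0 /(_ n0)].
by rewrite subr0 ltNge pnorm1_ge1 => /(_ (leqnn _)).
Qed.

HB.instance Definition _ := GRing.Zmodule_isNzRing.Build Q
  completion_mulA completion_mul1 completion_mulr1 completion_mulDl
  completion_mulDr completion_one_neq0.

Lemma completion_scaleA c d x :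
  completion_scale c (completion_scale d x) = completion_scale (c * d) x.
Proof.
have [u cu ->] := climit_surj x.
rewrite !completion_scaleE //; try exact: cauchyZ.
by apply: eq_climit => n; rewrite scalerA.
Qed.

Lemma completion_scale1 : left_id 1 completion_scale.
Proof.
move=> x; have [u cu ->] := climit_surj x.
by rewrite completion_scaleE //; apply: eq_climit => n; rewrite scale1r.
Qed.

Lemma completion_scaleDr : right_distributive completion_scale +%R.
Proof.
move=> c x y; have [u cu ->] := climit_surj x; have [v cv ->] := climit_surj y.
rewrite -![_ + _]/(completion_add _ _) !(completion_scaleE, completion_addE) //;
  try exact: cauchyZ; try exact: cauchyD.
by apply: eq_climit => n; rewrite scalerDr.
Qed.

Lemma completion_scaleDl x : {morph completion_scale^~ x : c d / c + d}.
Proof.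
move=> c d; have [u cu ->] := climit_surj x.
rewrite -![_ + _ in RHS]/(completion_add _ _) !(completion_scaleE, completion_addE) //;
  try exact: cauchyZ.
by apply: eq_climit => n; rewrite scalerDl.
Qed.

HB.instance Definition _ := GRing.Zmodule_isLmodule.Build R[i] Q
  completion_scaleA completion_scale1 completion_scaleDr completion_scaleDl.

Lemma completion_scaleAl c x y : c *: (x * y) = c *: x * y.
Proof.
have [u cu ->] := climit_surj x; have [v cv ->] := climit_surj y.
rewrite -![_ * _]/(completion_mul _ _) -![_ *: _]/(completion_scale _ _).
rewrite !(completion_scaleE, completion_mulE) //; try exact: cauchyZ; try exact: cauchyM.
by apply: eq_climit => n; rewrite scalerAl.
Qed.

HB.instance Definition _ := GRing.Lmodule_isLalgebra.Build R[i] Q completion_scaleAl.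

Lemma completion_scaleAr c x y : c *: (x * y) = x * (c *: y).
Proof.
have [u cu ->] := climit_surj x; have [v cv ->] := climit_surj y.
rewrite -![_ * _]/(completion_mul _ _) -![_ *: _]/(completion_scale _ _).
rewrite !(completion_scaleE, completion_mulE) //; try exact: cauchyZ; try exact: cauchyM.
by apply: eq_climit => n; rewrite scalerAr.
Qed.

HB.instance Definition _ := GRing.Lalgebra_isAlgebra.Build R[i] Q completion_scaleAr.

Lemma climitD u v : cauchyX u -> cauchyX v ->
  climit u + climit v = climit (fun n => u n + v n).
Proof. exact: completion_addE. Qed.

Lemma climitM u v : cauchyX u -> cauchyX v ->
  climit u * climit v = climit (fun n => u n * v n).
Proof. exact: completion_mulE. Qed.

Lemma climitZ c u : cauchyX u -> c *: climit u = climit (fun n => c *: u n).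
Proof. exact: completion_scaleE. Qed.

Lemma climitB u v : cauchyX u -> cauchyX v ->
  climit u - climit v = climit (fun n => u n - v n).
Proof.
move=> cu cv; rewrite -[- climit v]/(completion_opp _) completion_oppE //.
by rewrite climitD //; apply: cauchyN.
Qed.

End CompletionQuotient.

(** * Norm, involution and state on the completion *)

Section CompletionNorm.
Variables (R : realType) (X : preCStar R).
Local Notation N := (@pnorm R X).
Local Notation cauchyX := (@eps_cauchy R X N).
Local Notation nullX := (@eps_null R X N).
Local Notation Q := (completion X).
Implicit Types (u v : nat -> X) (x y z : Q) (c : R[i]).

Lemma eps_null_cvg (a : nat -> R) l :
  eps_null Num.norm (fun n => a n - l) <-> a @ \oo --> l.
Proof.
split=> [h|/cvgrPdist_lt h e e0].
  apply/cvgrPdist_lt => e e0; have [n0 hn] := h e e0.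
  by exists n0 => // n /= nn; rewrite distrC hn.
by have [n0 _ hn] := h e e0; exists n0 => n nn; rewrite distrC; apply: hn.
Qed.

Lemma eps_null_norm u : nullX u <-> (fun n => N (u n)) @ \oo --> (0 : R).
Proof.
rewrite -eps_null_cvg; split=> h e e0; have [n0 hn] := h e e0; exists n0 => n nn.
  by rewrite subr0 ger0_norm ?pnorm_ge0 // hn.
by have := hn n nn; rewrite subr0 ger0_norm ?pnorm_ge0.
Qed.

Definition completion_norm x : R :=
  xget 0 [set l : R | (fun n => N (crepr x n)) @ \oo --> l].

Lemma cauchy_norm u : cauchyX u -> eps_cauchy Num.norm (fun n => N (u n)).
Proof.
move=> cu e e0; have [n0 h] := cu e e0; exists n0 => m n hm hn.
by apply: le_lt_trans (h m n hm hn); apply: pnorm_dist.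
Qed.

Lemma completion_norm_cvg u : cauchyX u ->
  (fun n => N (u n)) @ \oo --> completion_norm (climit u).
Proof.
move=> cu; have E : (fun n => N (crepr (climit u) n)) @ \oo -->
    completion_norm (climit u).
  rewrite /completion_norm; case: xgetP => [l -> //|].
  have [l hl] := real_cauchy_cvg (cauchy_norm (crepr_cauchy (climit u))).
  by move=> /(_ l); case; apply/eps_null_cvg.
have /eps_null_norm Z := crepr_climit cu.
have Z' : (fun n => N (u n) - N (crepr (climit u) n)) @ \oo --> (0 : R).
  apply/eps_null_cvg => e e0; have /eps_null_cvg/(_ e e0)[n0 h] := Z.
  exists n0 => n nn; have := h n nn; rewrite !subr0 (ger0_norm (pnorm_ge0 _)).
  by apply: le_lt_trans; rewrite pnormB; apply: pnorm_dist.
rewrite -[X in _ --> X]add0r.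
rewrite (_ : (fun n => N (u n)) = (fun n => N (u n) - N (crepr (climit u) n)) +
    (fun n => N (crepr (climit u) n))).
  exact: cvgD.
by apply/funext => n; rewrite fctE subrK.
Qed.

Lemma completion_normE u (l : R) : cauchyX u -> (fun n => N (u n)) @ \oo --> l ->
  completion_norm (climit u) = l.
Proof. by move=> cu; apply: cvg_unique => //; exact: completion_norm_cvg. Qed.

Lemma completion_norm_le u (B : R) (n0 : nat) : cauchyX u ->
  (forall n, (n0 <= n)%N -> N (u n) <= B) -> completion_norm (climit u) <= B.
Proof.
move=> cu uB; have h : \forall n \near \oo, N (u n) <= B by exists n0.
by move: h; apply: ler_cvg_to; [exact: completion_norm_cvg | exact: cvg_cst].
Qed.

Lemma completion_normC (a : X) : completion_norm (climit (fun=> a)) = N a.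
Proof. by apply: completion_normE; [exact: cauchyC | exact: cvg_cst]. Qed.

Lemma completion_norm_eq0 x : completion_norm x = 0 -> x = 0.
Proof.
have [u cu ->] := climit_surj x => u0.
apply/climit_eqP => //; first exact: cauchyC.
have := completion_norm_cvg cu; rewrite u0 => /eps_null_norm.
by apply: eq_null => n; rewrite subr0.
Qed.

Lemma completion_normD x y :
  completion_norm (x + y) <= completion_norm x + completion_norm y.
Proof.
have [u cu ->] := climit_surj x; have [v cv ->] := climit_surj y.
rewrite climitD //; apply: (ler_cvg_to (completion_norm_cvg (cauchyD cu cv))
  (cvgD (completion_norm_cvg cu) (completion_norm_cvg cv))).
by apply: nearW => n; apply: pnormD.
Qed.

Lemma completion_normZ c x :
  completion_norm (c *: x) = complex.Re `|c| * completion_norm x.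
Proof.
have [u cu ->] := climit_surj x; rewrite climitZ //.
apply: completion_normE; first exact: cauchyZ.
under eq_fun => n do rewrite pnormZ.
by apply: cvgM; [exact: cvg_cst | exact: completion_norm_cvg].
Qed.

Lemma completion_normM x y :
  completion_norm (x * y) <= completion_norm x * completion_norm y.
Proof.
have [u cu ->] := climit_surj x; have [v cv ->] := climit_surj y.
rewrite climitM //; apply: (ler_cvg_to (completion_norm_cvg (cauchyM cu cv))
  (cvgM (completion_norm_cvg cu) (completion_norm_cvg cv))).
by apply: nearW => n; apply: pnormM.
Qed.

Lemma completion_norm_opp x : completion_norm (- x) = completion_norm x.
Proof. by rewrite -scaleN1r completion_normZ normrN normr1 mul1r. Qed.

(** Constant sequences are dense: elements [p n] of X within 1 / (n + 1) of [s n] form a Cauchy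
    sequence, whose class is the limit. *)
Lemma completion_complete (s : nat -> Q) : (forall e : R, 0 < e -> exists n0,
    forall m n, (n0 <= m)%N -> (n0 <= n)%N -> completion_norm (s m - s n) < e) ->
  exists l, forall e : R, 0 < e -> exists n0, forall n, (n0 <= n)%N ->
    completion_norm (s n - l) < e.
Proof.
move=> cs.
have dense n : exists p : X, completion_norm (s n - climit (fun=> p)) <= n.+1%:R^-1.
  have [u cu ->] := climit_surj (s n).
  have [|n0 h] := cu n.+1%:R^-1; first by rewrite invr_gt0.
  exists (u n0); rewrite climitB //; last exact: cauchyC.
  apply: (@completion_norm_le _ _ n0) => [|m nm].
    by apply: cauchyD => //; apply: cauchyN; apply: cauchyC.
  by apply/ltW/h.
have [p hp] := choice dense.
have inv_small (e : R) : 0 < e -> exists n0, forall n, (n0 <= n)%N -> n.+1%:R^-1 < e.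
  move=> e0; exists (Num.truncn e^-1) => n nn.
  rewrite invf_plt ?posrE //; apply: lt_le_trans (truncnS_gt _) _.
  by rewrite ler_nat ltnS.
have cp : cauchyX p.
  move=> e e0; have e3 : 0 < e / 3 by rewrite divr_gt0.
  have [n1 h1] := cs _ e3; have [n2 h2] := inv_small _ e3.
  exists (maxn n1 n2) => m n; rewrite !geq_max => /andP[m1 m2] /andP[nn1 nn2].
  rewrite -completion_normC.
  have -> : climit (fun=> p m - p n) =
      - (s m - climit (fun=> p m)) + (s m - s n) + (s n - climit (fun=> p n)).
    rewrite -climitB; try exact: cauchyC.
    by rewrite opprB !addrA !subrK.
  have := completion_normD (- (s m - climit (fun=> p m)) + (s m - s n)) (s n - climit (fun=> p n)).
  have := completion_normD (- (s m - climit (fun=> p m))) (s m - s n).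
  rewrite completion_norm_opp; have := h1 m n m1 nn1.
  have := le_lt_trans (hp m) (h2 m m2); have := le_lt_trans (hp n) (h2 n nn2).
  set a1 := completion_norm _; set a2 := completion_norm _; lra.
exists (climit p) => e e0; have e2 : 0 < e / 3 by rewrite divr_gt0.
have [n1 h1] := cp _ e2; have [n2 h2] := inv_small _ e2.
exists (maxn n1 n2) => n; rewrite geq_max => /andP[nn1 nn2].
have -> : s n - climit p = (s n - climit (fun=> p n)) + (climit (fun=> p n) - climit p).
  by rewrite addrA subrK.
have := completion_normD (s n - climit (fun=> p n)) (climit (fun=> p n) - climit p).
have : completion_norm (climit (fun=> p n) - climit p) <= e / 3.
  rewrite climitB //; last exact: cauchyC.
  apply: (@completion_norm_le _ _ n1) => [|m nm].
    by apply: cauchyD; [exact: cauchyC | exact: cauchyN].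
  exact/ltW/h1.
have := le_lt_trans (hp n) (h2 n nn2); lra.
Qed.

Lemma completion_starD x y :
  completion_star (x + y) = completion_star x + completion_star y.
Proof.
have [u cu ->] := climit_surj x; have [v cv ->] := climit_surj y.
rewrite climitD // !completion_starE //; try exact: cauchyD.
rewrite climitD; try exact: cauchy_star.
by apply: eq_climit => n; rewrite pstarD.
Qed.

Lemma completion_starZ c x :
  completion_star (c *: x) = (c^*)%C *: completion_star x.
Proof.
have [u cu ->] := climit_surj x.
rewrite climitZ // !completion_starE //; try exact: cauchyZ.
rewrite climitZ; try exact: cauchy_star.
by apply: eq_climit => n; rewrite pstarZ.
Qed.

Lemma completion_starM x y :
  completion_star (x * y) = completion_star y * completion_star x.
Proof.
have [u cu ->] := climit_surj x; have [v cv ->] := climit_surj y.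
rewrite climitM // !completion_starE //; try exact: cauchyM.
rewrite climitM; try exact: cauchy_star.
by apply: eq_climit => n; rewrite pstarM.
Qed.

Lemma completion_starK x : completion_star (completion_star x) = x.
Proof.
have [u cu ->] := climit_surj x.
rewrite !completion_starE //; try exact: cauchy_star.
by apply: eq_climit => n; rewrite pstarK.
Qed.

Lemma completion_cstar x :
  completion_norm (completion_star x * x) = completion_norm x ^+ 2.
Proof.
have [u cu ->] := climit_surj x; have cs := cauchy_star cu.
rewrite completion_starE // climitM //.
apply: completion_normE; first exact: cauchyM.
under eq_fun => n do rewrite pnorm_pstar expr2.
by rewrite expr2; apply: cvgM; exact: completion_norm_cvg.
Qed.

HB.instance Definition _ := isCStarAlgebra.Build R Q
  completion_norm_eq0 completion_normD completion_normZ completion_normM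
  completion_complete completion_starD completion_starZ completion_starM
  completion_starK completion_cstar.

Local Notation phi := (pstate X).

Lemma Cnorm_lim_unique (a : nat -> R[i]) l l' :
  eps_null (@Cnorm R) (fun n => a n - l) -> eps_null (@Cnorm R) (fun n => a n - l') ->
  l = l'.
Proof.
move=> h h'; apply/eqP; rewrite -subr_eq0; apply/eqP; apply: Re_norm_eq0.
apply/eqP; rewrite eq_le Re_norm_ge0 andbT; apply/ler_addgt0Pr => e e0.
have [|n1 h1] := h (e / 2); first by rewrite divr_gt0.
have [|n2 h2] := h' (e / 2); first by rewrite divr_gt0.
have := h1 (maxn n1 n2) (leq_maxl _ _); have := h2 (maxn n1 n2) (leq_maxr _ _).
set b := a _; move=> e1 e2; rewrite add0r.
have -> : l - l' = (b - l') + - (b - l) by rewrite opprB [RHS]addrC addrA subrK.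
apply: le_trans (Re_normD _ _) _; rewrite normrN; move: e1 e2; rewrite /Cnorm; lra.
Qed.

Definition completion_state x : R[i] :=
  xget 0 [set l | eps_null (@Cnorm R) (fun n => phi (crepr x n) - l)].

Lemma completion_stateP u : cauchyX u ->
  eps_null (@Cnorm R) (fun n => phi (u n) - completion_state (climit u)).
Proof.
move=> cu; have E : eps_null (@Cnorm R)
    (fun n => phi (crepr (climit u) n) - completion_state (climit u)).
  rewrite /completion_state; case: xgetP => [l -> //|].
  have [|l hl] := @complex_cauchy_cvg R (fun n => phi (crepr (climit u) n)).
    move=> e e0; have [n0 h] := crepr_cauchy (climit u) e0.
    exists n0 => m n hm hn; rewrite -linearB; apply: le_lt_trans (pstate_le _) _.
    exact: h.
  by move=> /(_ l).
have Z := crepr_climit cu => e e0.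
have [|n1 h1] := E (e / 2); first by rewrite divr_gt0.
have [|n2 h2] := Z (e / 2); first by rewrite divr_gt0.
exists (maxn n1 n2) => n; rewrite geq_max => /andP[nn1 nn2].
rewrite -(subrK (phi (crepr (climit u) n)) (phi (u n))) -addrA.
apply: le_lt_trans (Re_normD _ _) _; rewrite -linearB [e]splitr; apply: ltrD.
  by apply: le_lt_trans (pstate_le _) _; rewrite pnormB; apply: h2.
exact: h1.
Qed.

Lemma completion_stateE u l : cauchyX u ->
  eps_null (@Cnorm R) (fun n => phi (u n) - l) -> completion_state (climit u) = l.
Proof. by move=> cu; apply: Cnorm_lim_unique; apply: completion_stateP. Qed.

Lemma completion_state_additive : zmod_morphism completion_state.
Proof.
move=> x y; have [u cu ->] := climit_surj x; have [v cv ->] := climit_surj y.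
rewrite climitB //; apply: completion_stateE; first by apply: cauchyD => //; exact: cauchyN.
move=> e e0.
have [|n1 h1] := completion_stateP cu (e := e / 2); first by rewrite divr_gt0.
have [|n2 h2] := completion_stateP cv (e := e / 2); first by rewrite divr_gt0.
exists (maxn n1 n2) => n; rewrite geq_max => /andP[nn1 nn2].
rewrite linearB opprD addrACA -opprD.
apply: le_lt_trans (Re_normD _ _) _; rewrite normrN [e]splitr; apply: ltrD.
  exact: h1.
exact: h2.
Qed.

Lemma completion_state_scalable : scalable_for *%R completion_state.
Proof.
move=> c x; have [u cu ->] := climit_surj x.
rewrite climitZ //; apply: completion_stateE; first exact: cauchyZ.
move=> e e0; have c1 : 0 < Cnorm c + 1 by rewrite ltr_wpDl // Re_norm_ge0.
have [|n1 h1] := completion_stateP cu (e := e / (Cnorm c + 1)); first by rewrite divr_gt0.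
exists n1 => n nn; have := h1 n nn; rewrite ltr_pdivlMr // mulrC; apply: le_lt_trans.
rewrite linearZ /= -mulrBr /Cnorm Re_normM; apply: ler_wpM2r; first exact: Re_norm_ge0.
by rewrite lerDl.
Qed.

HB.instance Definition _ :=
  GRing.isZmodMorphism.Build Q R[i] completion_state completion_state_additive.
HB.instance Definition _ := GRing.isScalable.Build R[i] Q R[i] *%R
  completion_state completion_state_scalable.

Lemma completion_stateC (a : X) : completion_state (climit (fun=> a)) = phi a.
Proof.
apply: completion_stateE; first exact: cauchyC.
by move=> e e0; exists 0%N => n _; rewrite subrr /Cnorm normr0.
Qed.

Lemma completion_state_ge0 x : 0 <= completion_state (cstar x * x).
Proof.
have [u cu ->] := climit_surj x; have cs := cauchy_star cu.
rewrite -[cstar _]/(completion_star _) completion_starE // climitM //.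
have h := completion_stateP (cauchyM cs cu).
set l := completion_state _ in h *.
suff /eqP : `|l| - l = 0 by rewrite subr_eq0 => /eqP <-.
apply: Re_norm_eq0; apply/eqP; rewrite eq_le Re_norm_ge0 andbT.
apply/ler_addgt0Pr => e e0; rewrite add0r.
have [|n0 hn] := h (e / 2); first by rewrite divr_gt0.
have := hn n0 (leqnn _); set b := phi _ => hb.
have b0 : 0 <= b by apply: pstate_ge0.
have -> : `|l| - l = (`|l| - `|b|) + (b - l) by rewrite (ger0_norm b0) addrA subrK.
apply: le_trans (Re_normD _ _) _.
have : complex.Re `| `|l| - `|b| | <= complex.Re `|b - l|.
  by have := ler_dist_dist l b; rewrite [`|b - l|]distrC [`|l - b|]normc_def
    [`| _ - _|]normc_def lecR !normc_def.
move: hb; rewrite /Cnorm; lra.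
Qed.

Lemma completion_state1 : completion_state 1 = 1.
Proof. by rewrite -[LHS]/(completion_state (climit (fun=> 1))) completion_stateC pstate1. Qed.

Definition completion_space : cstarProbSpace R :=
  @CStarProbSpace R Q completion_state completion_state_ge0 completion_state1.

Lemma climit_prod (I : Type) (s : seq I) (F : I -> X) :
  climit (fun=> \prod_(i <- s) F i) = \prod_(i <- s) climit (fun=> F i).
Proof.
elim: s => [|i s IH]; first by rewrite !big_nil.
rewrite !big_cons -IH climitM; try exact: cauchyC.
by [].
Qed.

Lemma Dc_of_preCStar (k : nat) (x : 'I_k -> X) (mu : ncdist R k) :
  (forall i, pstar (x i) = x i) -> joint_distribution phi x mu -> Dc mu.
Proof.
move=> xs xmu; exists completion_space, (fun i => climit (fun=> x i)); split=> [i|w].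
  rewrite -[LHS]/(completion_star _) completion_starE; last exact: cauchyC.
  by apply: eq_climit => n; rewrite xs.
by rewrite xmu -climit_prod -completion_stateC.
Qed.

End CompletionNorm.

(** * The GNS seminorm *)

Lemma psd_CS (C : numClosedFieldType) (S : Type) (K : S -> S -> C) s t :
  psd K -> `|K s t| ^+ 2 <= K s s * K t t.
Proof.
move=> Kpsd; have [e|e] := eqVneq (K t t) 0.
  by rewrite (psd_rowE _ Kpsd e) normr0 expr0n e mulr0.
have := psd_ge0 s (psd_schur_compl t Kpsd).
have t0 : 0 < K t t by rewrite lt_def e psd_ge0.
by rewrite subr_ge0 ler_pdivrMr // normCK.
Qed.

Lemma bounded_powers_le1 (R : realType) (x B : R) :
  (forall n, x ^+ n <= B) -> x <= 1.
Proof.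
move=> xB; rewrite leNgt; apply/negP => x1.
have bern n : 1 + n%:R * (x - 1) <= x ^+ n.
  elim: n => [|n IH]; first by rewrite mul0r addr0.
  rewrite exprS; apply: le_trans (ler_wpM2l _ IH); last by apply: ltW; lra.
  rewrite -natr1; have : 0 <= n%:R * (x - 1) * (x - 1).
    by rewrite !mulr_ge0 // subr_ge0 ltW.
  lra.
have x0 : 0 < x - 1 by rewrite subr_gt0.
have := truncnS_gt (B / (x - 1)); rewrite ltr_pdivrMr // => h.
have := le_trans (bern (Num.truncn (B / (x - 1))).+1) (xB _); lra.
Qed.

Section GNS.
Variables (R : realType) (I : Type).
Local Notation C := R[i].
Variables (P : algType C) (mon : seq I -> P) (star : P -> P) (mu : {scalar P}).
Implicit Types (p q a b : P) (c : C) (w v u : seq I) (i : I).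
Hypotheses (mon_nil : mon [::] = 1)
  (mon_cat : forall v w, mon (v ++ w) = mon v * mon w)
  (mon_span : forall p, exists s : seq (C * seq I), p = \sum_(x <- s) x.1 *: mon x.2)
  (starD : forall p q, star (p + q) = star p + star q)
  (star_mon : forall c w, star (c *: mon w) = c^* *: mon (rev w))
  (mu1 : mu 1 = 1)
  (mu_psd : psd (fun v w => mu (mon (v ++ rev w))))
  (mu_bounded : exists D : C, 1 <= D /\ forall w, `|mu (mon w)| <= D ^+ size w).

(** Additive properties need only be checked on multiples of monomials; this spanning property is
    all that is known of the abstract algebra [P]. *)
Let mon_ind (Q : P -> Prop) : (forall c w, Q (c *: mon w)) ->
  (forall p q, Q p -> Q q -> Q (p + q)) -> forall p, Q p.
Proof.
move=> Qm QD p; have [s ->] := mon_span p; elim: s => [|x s IH].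
  by rewrite big_nil -(scale0r (mon [::])); apply: Qm.
by rewrite big_cons; apply: QD.
Qed.

Let starZ c p : star (c *: p) = c^* *: star p.
Proof.
elim/mon_ind: p => [d w|p q IHp IHq].
  by rewrite scalerA !star_mon scalerA conjCM.
by rewrite scalerDr !starD IHp IHq scalerDr.
Qed.

Let starM p q : star (p * q) = star q * star p.
Proof.
elim/mon_ind: p => [c w|p p' IH IH']; last first.
  by rewrite mulrDl !starD IH IH' mulrDr.
elim/mon_ind: q => [d u|q q' IH IH']; last first.
  by rewrite mulrDr !starD IH IH' mulrDl.
rewrite -scalerAl -scalerAr scalerA -mon_cat !star_mon.
by rewrite -scalerAl -scalerAr scalerA -mon_cat rev_cat conjCM mulrC.
Qed.

Let starK p : star (star p) = p.
Proof.
elim/mon_ind: p => [c w|p q IHp IHq].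
  by rewrite !star_mon conjCK revK.
by rewrite !starD IHp IHq.
Qed.

Let star1 : star 1 = 1.
Proof.
have := star_mon 1 [::]; by rewrite !scale1r conjC1 scale1r mon_nil.
Qed.

Let star_var i : star (mon [:: i]) = mon [:: i].
Proof. by have := star_mon 1 [:: i]; rewrite conjC1 !scale1r. Qed.

Let star_sum (J : Type) (s : seq J) (F : J -> P) :
  star (\sum_(x <- s) F x) = \sum_(x <- s) star (F x).
Proof.
elim: s => [|x s IH]; last by rewrite !big_cons starD IH.
by rewrite !big_nil -[X in star X](scale0r (1 : P)) starZ conjC0 scale0r.
Qed.

Let mu_ge0 p : 0 <= mu (star p * p).
Proof.
have [s sE] := mon_span (star p).
have -> : star p * p = star p * star (star p) by rewrite starK.
have := mu_psd s; congr (_ <= _); rewrite sE star_sum /sesq mulr_suml linear_sum.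
apply: eq_bigr => x _; rewrite mulr_sumr linear_sum; apply: eq_bigr => y _ /=.
have -> : x.1 *: mon x.2 * star (y.1 *: mon y.2) =
    (x.1 * y.1^*) *: mon (x.2 ++ rev y.2).
  by rewrite star_mon -scalerAl -scalerAr scalerA mon_cat.
by rewrite linearZ.
Qed.

Definition form p q : C := mu (star q * p).

Lemma form_psd : psd form.
Proof.
move=> s; pose p : P := \sum_(x <- s) x.1 *: x.2.
have := mu_ge0 p; congr (_ <= _).
have E : star p = \sum_(x <- s) x.1^* *: star x.2.
  by rewrite /p star_sum; apply: eq_bigr => x _; apply: starZ.
rewrite E /p mulr_suml linear_sum /=.
under eq_bigr => y _ do rewrite mulr_sumr linear_sum.
rewrite exchange_big; apply: eq_bigr => x _; apply: eq_bigr => y _ /=.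
by rewrite -scalerAl -scalerAr scalerA linearZ /= mulrC [x.1 * _]mulrC mulrC.
Qed.

Definition gns_norm p : R := Num.sqrt (complex.Re (form p p)).
Local Notation h := gns_norm.

Lemma gns_norm_ge0 p : 0 <= h p. Proof. exact: sqrtr_ge0. Qed.

Lemma formE p : form p p = (h p ^+ 2)%:C%C.
Proof.
have := psd_ge0 p form_psd; rewrite /h; case: (form p p) => x y.
by rewrite lecE /= => /andP[/eqP -> x0]; rewrite sqr_sqrtr.
Qed.

Lemma form_CS p q : Cnorm (form p q) <= h p * h q.
Proof.
have := psd_CS p q form_psd; rewrite !formE -rmorphM -exprMn.
rewrite normc_def -rmorphXn lecR ler_pXn2r ?nnegrE ?sqrtr_ge0 //.
  by rewrite /Cnorm normc_def.
by rewrite mulr_ge0 ?gns_norm_ge0.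
Qed.

Lemma form_adj a p q : form (a * p) q = form p (star a * q).
Proof. by rewrite /form starM starK mulrA. Qed.

Lemma gns_normZ c p : h (c *: p) = Cnorm c * h p.
Proof.
apply/eqP; rewrite -(@eqrXn2 _ 2) ?gns_norm_ge0 ?mulr_ge0 ?gns_norm_ge0 ?Re_norm_ge0 //.
apply/eqP; apply: complexI; rewrite -formE exprMn [RHS]rmorphM /= -formE.
rewrite /form starZ -scalerAl -scalerAr scalerA linearZ /=; congr (_ * _).
by rewrite mulrC -normCK /Cnorm normc_def -rmorphXn.
Qed.

Lemma gns_normD p q : h (p + q) <= h p + h q.
Proof.
rewrite -(@ler_pXn2r _ 2) ?nnegrE ?addr_ge0 ?gns_norm_ge0 //.
have E : form (p + q) (p + q) = form p p + form q q + (form p q + form q p).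
  by rewrite /form starD mulrDl !mulrDr !linearD /=; ring.
have e1 : h (p + q) ^+ 2 = h p ^+ 2 + h q ^+ 2 +
    (complex.Re (form p q) + complex.Re (form q p)).
  by move/(congr1 (@complex.Re R)): E; rewrite !formE !raddfD.
have := le_trans (le_trans (ler_norm _) (Re_norm_le _)) (form_CS p q).
have := le_trans (le_trans (ler_norm _) (Re_norm_le _)) (form_CS q p).
rewrite e1 sqrrD mulr2n (mulrC (h q)); lra.
Qed.

Definition op_bound a : set R :=
  [set B | 0 <= B /\ forall q, h (a * q) <= B * h q].

(** The seminorm of left multiplication by [a] for the GNS seminorm, without a quotient by the null
    vectors of [form]. *)
Definition op_norm a : R := inf (op_bound a).

Lemma op_norm_le a B : op_bound a B -> op_norm a <= B.
Proof. by move=> aB; apply: ge_inf => //; exists 0 => x []. Qed.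

Let bounded_sandwich (D : C) : 1 <= D -> (forall w, `|mu (mon w)| <= D ^+ size w) ->
  forall p q, exists B, forall u, `|mu (p * mon u * q)| <= B * D ^+ size u.
Proof.
move=> D1 bD; have D0 : 0 <= D by apply: le_trans D1.
have D00 n : 0 <= D ^+ n by apply: exprn_ge0.
move=> p q; elim/mon_ind: p => [c v|p p' [B hB] [B' hB']]; last first.
  exists (B + B') => u; rewrite !mulrDl linearD.
  by apply: le_trans (ler_normD _ _) _; apply: lerD.
elim/mon_ind: q => [d w|q q' [B hB] [B' hB']]; last first.
  exists (B + B') => u; rewrite mulrDr linearD mulrDl.
  by apply: le_trans (ler_normD _ _) _; apply: lerD.
exists (`|c * d| * (D ^+ size v * D ^+ size w)) => u.
have -> : c *: mon v * mon u * (d *: mon w) = (c * d) *: mon ((v ++ u) ++ w).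
  by rewrite -!scalerAl -scalerAr scalerA !mon_cat.
rewrite linearZ normrM -mulrA; apply: ler_wpM2l => //; apply: le_trans (bD _) _.
by rewrite !size_cat !exprD -!mulrA [D ^+ size w * _]mulrC.
Qed.

(** Let g m be the seminorm of the m-th power of the variable applied to q. Symmetry and
    Cauchy-Schwarz make g log-convex, so its ratios increase and g m >= r^m g 0 for the first ratio
    r. The moments bound g m by a constant times D^m; the constant depends on q, but forces r <= D,
    a bound uniform in i and q. *)
Lemma var_bounded : exists2 D, 0 <= D & forall i q, h (mon [:: i] * q) <= D * h q.
Proof.
have [D [D1 bD]] := mu_bounded.
have Dr : D = (complex.Re D)%:C%C.
  by move: D1; case: (D) => x y; rewrite lecE /= => /andP[/eqP -> _].
move: (complex.Re D) Dr D1 bD => {}D -> D1 bD.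
have {}D1' : 1 <= D by move: D1; rewrite lecR.
have D0 : 0 < D by apply: lt_le_trans D1'.
exists D => [|i q]; first exact: ltW.
pose g m := h (mon (nseq m i) * q).
have gS m : mon [:: i] * (mon (nseq m i) * q) = mon (nseq m.+1 i) * q.
  by rewrite mulrA -mon_cat.
have g0 m : 0 <= g m by apply: gns_norm_ge0.
have convex m : g m.+1 ^+ 2 <= g m * g m.+2.
  have := form_CS (mon (nseq m i) * q) (mon (nseq m.+2 i) * q).
  rewrite -{1}[mon (nseq m.+2 i) * q]gS -{1}(star_var i) -form_adj gS formE.
  by rewrite /Cnorm Re_norm_real ?exprn_ge0 ?gns_norm_ge0.
have [B growth] : exists B : R, forall m, g m ^+ 2 <= B * (D ^+ 2) ^+ m.
  have [B hB] := bounded_sandwich D1 bD (star q) q.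
  have B0 : 0 <= B by have := hB [::]; rewrite mulr1; apply: le_trans.
  have Br : B = (complex.Re B)%:C%C.
    by move: B0; case: (B) => x y; rewrite lecE /= => /andP[/eqP -> _].
  exists (complex.Re B) => m.
  have ns : star (mon (nseq m i)) = mon (nseq m i).
    by rewrite -{1}[mon _]scale1r star_mon conjC1 scale1r rev_nseq.
  have e : form (mon (nseq m i) * q) (mon (nseq m i) * q) =
      mu (star q * mon (nseq m i ++ nseq m i) * q).
    by rewrite /form starM ns mon_cat !mulrA.
  rewrite -lecR -formE [X in _ <= X]rmorphM /= -Br e.
  apply: le_trans (real_ler_norm _) _.
    by rewrite -e ger0_real // psd_ge0 //; exact: form_psd.
  apply: le_trans (hB _) _; rewrite size_cat size_nseq addnn -mul2n exprM.
  by rewrite !rmorphXn.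
have -> : h q = g 0%N by rewrite /g mon_nil mul1r.
have -> : h (mon [:: i] * q) = g 1%N by [].
rewrite leNgt; apply/negP => lt1.
have g00 : 0 < g 0%N.
  rewrite lt_def g0 andbT; apply/eqP => e; have := convex 0%N.
  move: lt1; rewrite e mul0r mulr0 => lt1.
  by rewrite leNgt exprn_gt0.
pose r := g 1%N / g 0%N.
have rD : D < r by rewrite ltr_pdivlMr.
have r0 : 0 < r by apply: lt_trans rD.
have step m : 0 < g m /\ r * g m <= g m.+1.
  elim: m => [|m [gm IH]]; first by rewrite /r divfK ?gt_eqF.
  have gm1 : 0 < g m.+1 by apply: lt_le_trans IH; apply: mulr_gt0.
  split=> //; rewrite -(ler_pM2l gm); apply: le_trans (convex m).
  by rewrite expr2 mulrA ler_pM2r // mulrC.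
have pow m : r ^+ m * g 0%N <= g m.
  elim: m => [|m IH]; first by rewrite mul1r.
  rewrite exprS -mulrA; apply: le_trans (step m).2.
  by rewrite ler_pM2l.
have rd0 : 0 <= r / D by rewrite divr_ge0 // ltW.
suff : (r / D) ^+ 2 <= 1.
  rewrite expr_le1 // ler_pdivrMr // mul1r => rle.
  by have := lt_le_trans rD rle; rewrite ltxx.
apply: (@bounded_powers_le1 _ _ (B / g 0%N ^+ 2)) => m.
have gm := pow m; have gg := growth m.
have big : (r ^+ m * g 0%N) ^+ 2 <= B * (D ^+ 2) ^+ m.
  apply: le_trans gg; rewrite ler_pXn2r ?nnegrE ?g0 //.
  by rewrite mulr_ge0 ?g0 // exprn_ge0 // ltW.
rewrite ler_pdivlMr ?exprn_gt0 // expr_div_n expr_div_n mulrAC.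
rewrite ler_pdivrMr ?exprn_gt0 ?exprn_gt0 //.
by move: big; rewrite exprMn -[(r ^+ m) ^+ 2]exprM mulnC exprM.
Qed.

Lemma op_bound_nonempty a : op_bound a !=set0.
Proof.
have [D D0 hD] := var_bounded.
have E w q : h (mon w * q) <= D ^+ size w * h q.
  elim: w => [|i w IH]; first by rewrite mon_nil !mul1r.
  rewrite -cat1s mon_cat -mulrA exprS -mulrA; apply: le_trans (hD _ _) _.
  by apply: ler_wpM2l.
elim/mon_ind: a => [c w|a b [A [A0 hA]] [B [B0 hB]]].
  exists (Cnorm c * D ^+ size w); split.
    by rewrite mulr_ge0 ?Re_norm_ge0 ?exprn_ge0.
  move=> q; rewrite -scalerAl gns_normZ -mulrA.
  by apply: ler_wpM2l (E _ _); exact: Re_norm_ge0.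
exists (A + B); split; first exact: addr_ge0.
by move=> q; rewrite !mulrDl; apply: le_trans (gns_normD _ _) _; apply: lerD.
Qed.

Lemma op_normP a q : h (a * q) <= op_norm a * h q.
Proof.
have [q0|q0] := eqVneq (h q) 0.
  have [B [_ hB]] := op_bound_nonempty a.
  by have := hB q; rewrite q0 !mulr0.
have qp : 0 < h q by rewrite lt_def q0 gns_norm_ge0.
rewrite -ler_pdivrMr //; apply: lb_le_inf; first exact: op_bound_nonempty.
by move=> B [_ hB]; rewrite ler_pdivrMr.
Qed.

Lemma op_norm_ge0 a : 0 <= op_norm a.
Proof. by apply: lb_le_inf; [exact: op_bound_nonempty | move=> B []]. Qed.

Lemma op_normD a b : op_norm (a + b) <= op_norm a + op_norm b.
Proof.
apply: op_norm_le; split=> [|q]; first by rewrite addr_ge0 ?op_norm_ge0.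
by rewrite !mulrDl; apply: le_trans (gns_normD _ _) _; apply: lerD; exact: op_normP.
Qed.

Lemma op_normM a b : op_norm (a * b) <= op_norm a * op_norm b.
Proof.
apply: op_norm_le; split=> [|q]; first by rewrite mulr_ge0 ?op_norm_ge0.
rewrite -mulrA -[X in _ <= X]mulrA; apply: le_trans (op_normP _ _) _.
by apply: ler_wpM2l; [exact: op_norm_ge0 | exact: op_normP].
Qed.

Lemma op_normZ c a : op_norm (c *: a) = Cnorm c * op_norm a.
Proof.
have E d b : op_norm (d *: b) <= Cnorm d * op_norm b.
  apply: op_norm_le; split=> [|q]; first by rewrite mulr_ge0 ?op_norm_ge0 ?Re_norm_ge0.
  rewrite -scalerAl gns_normZ -mulrA; apply: ler_wpM2l (op_normP _ _).
  exact: Re_norm_ge0.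
apply/eqP; rewrite eq_le E /=; have [->|c0] := eqVneq c 0.
  by rewrite /Cnorm normr0 mul0r op_norm_ge0.
have cn : Cnorm c * Cnorm c^-1 = 1.
  by rewrite /Cnorm -Re_normM divff // normr1.
rewrite -{1}[a](scale1r) -(mulVf c0) -scalerA.
apply: le_trans (ler_wpM2l (Re_norm_ge0 c) (E c^-1 (c *: a))) _.
by rewrite mulrA cn mul1r.
Qed.

(** Cauchy-Schwarz for the vectors [star a * (a * q)] and q. It yields both the isometry of the star
    and the C*-identity. *)
Lemma gns_norm_adj a q : h (a * q) ^+ 2 <= h (star a * (a * q)) * h q.
Proof.
have := form_CS (star a * (a * q)) q.
by rewrite form_adj starK formE /Cnorm Re_norm_real // exprn_ge0 // gns_norm_ge0.
Qed.

Lemma op_norm_star a : op_norm (star a) = op_norm a.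
Proof.
have E b : op_norm (star b) <= op_norm b.
  apply: op_norm_le; split=> [|q]; first exact: op_norm_ge0.
  have := gns_norm_adj (star b) q; rewrite starK => h1.
  have h2 := op_normP b (star b * q).
  have [e|e] := eqVneq (h (star b * q)) 0.
    by rewrite e mulr_ge0 ?op_norm_ge0 ?gns_norm_ge0.
  have p : 0 < h (star b * q) by rewrite lt_def e gns_norm_ge0.
  rewrite -(ler_pM2l p) -expr2; apply: le_trans h1 _.
  rewrite [X in _ <= X]mulrCA [X in _ <= X]mulrA; apply: ler_wpM2r h2; exact: gns_norm_ge0.
by apply/eqP; rewrite eq_le E -{1}(starK a) E.
Qed.

Lemma op_norm_cstar a : op_norm (star a * a) = op_norm a ^+ 2.
Proof.
apply/eqP; rewrite eq_le; apply/andP; split.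
  by rewrite expr2 -[X in _ <= X * _]op_norm_star; apply: op_normM.
have n0 := op_norm_ge0 (star a * a).
rewrite -[X in _ <= X]sqr_sqrtr //; rewrite ler_pXn2r ?nnegrE ?op_norm_ge0 ?sqrtr_ge0 //.
apply: op_norm_le; split=> [|q]; first exact: sqrtr_ge0.
rewrite -(@ler_pXn2r _ 2) ?nnegrE ?mulr_ge0 ?sqrtr_ge0 ?gns_norm_ge0 //.
rewrite exprMn [X in _ <= X * _]sqr_sqrtr //; apply: le_trans (gns_norm_adj _ _) _.
rewrite expr2 [X in _ <= X]mulrA; apply: ler_wpM2r; first exact: gns_norm_ge0.
by rewrite mulrA; apply: op_normP.
Qed.

Lemma gns_norm1 : h 1 = 1.
Proof. by rewrite /h /form star1 mulr1 mu1 sqrtr1. Qed.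

Lemma op_norm_state a : Cnorm (mu a) <= op_norm a.
Proof.
have := form_CS (a * 1) 1; rewrite /form star1 mul1r gns_norm1 mulr1 => /le_trans.
by apply; have := op_normP a 1; rewrite gns_norm1 !mulr1.
Qed.

Definition gns_algebra : preCStar R :=
  @PreCStar R P op_norm star mu op_norm_ge0 op_normD op_normZ op_normM
    starD starZ starM starK op_norm_cstar op_norm_star mu_ge0 mu1 op_norm_state.

Lemma Dc_of_span (k : nat) (x : 'I_k -> I) (nu : ncdist R k) :
  joint_distribution mu (fun j : 'I_k => mon [:: x j]) nu -> Dc nu.
Proof.
by apply: (@Dc_of_preCStar R gns_algebra k (fun j : 'I_k => mon [:: x j])) => j; apply: star_var.
Qed.

End GNS.

(** * Involution on non-commutative polynomials *)

Section NcPolynomials.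
Variables (R : realType) (k : nat).
Local Notation P := (ncpoly R k).
Local Notation C := R[i].
Implicit Types (p q : P) (c : C) (w v u : seq 'I_k) (i : 'I_k).

Definition ncmon w : P := \prod_(i <- w) ncvar R i.

Lemma ncmon_nil : ncmon [::] = 1.
Proof. exact: big_nil. Qed.

Lemma ncmon_cat v w : ncmon (v ++ w) = ncmon v * ncmon w.
Proof. exact: big_cat. Qed.

Lemma mkmalgU_ncmon c w : mkmalgU (FMonom w) c = c *: ncmon w.
Proof.
rewrite /ncmon ncmonE; apply/malgP => u; rewrite mcoeffZ !mcoeffU.
by rewrite mulrnAr mulr1.
Qed.

Lemma ncpoly_decomp p : p = \sum_(m <- finmap.enum_fset (msupp p)) mcoeff m p *: ncmon m.
Proof.
rewrite {1}[p]monalgE; apply: eq_bigr => -[w] _; exact: mkmalgU_ncmon.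
Qed.

Lemma ncpoly_scaleAr c p q : c *: (p * q) = p * (c *: q).
Proof.
have E (r : P) : c *: r = r * (c *: 1).
  rewrite {1 2}[r]ncpoly_decomp scaler_sumr mulr_suml; apply: eq_bigr => -[w] _.
  rewrite scalerA -ncmon_nil -!mkmalgU_ncmon.
  by rewrite [RHS]fgmulUU mulrC /mul /= fmmulE cats0.
by rewrite (E (p * q)) (E q) mulrA.
Qed.

HB.instance Definition _ := GRing.Lalgebra_isAlgebra.Build C P ncpoly_scaleAr.

(** An additive map suffices for [mmap], so that the antilinear star can be defined by extension
    from monomials. *)
Definition conj_scalar c : P := c^* *: 1.

Lemma conj_scalar_additive : zmod_morphism conj_scalar.
Proof. by move=> c d; rewrite /conj_scalar rmorphB scalerBl. Qed.

HB.instance Definition _ := GRing.isZmodMorphism.Build C P conj_scalar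
  conj_scalar_additive.

Definition ncstar : P -> P :=
  mmap conj_scalar (fun m : fmonom 'I_k => ncmon (rev m)).

Lemma ncstarD p q : ncstar (p + q) = ncstar p + ncstar q.
Proof. exact: raddfD. Qed.

Lemma ncstar_mon c w : ncstar (c *: ncmon w) = c^* *: ncmon (rev w).
Proof. by rewrite -mkmalgU_ncmon /ncstar mmapU /conj_scalar -scalerAl mul1r. Qed.

End NcPolynomials.

Lemma Dc_of_good (R : realType) (k : nat) (mu : ncdist R k) : good mu -> Dc mu.
Proof.
move=> [mu_psd [D [D1 bD]]].
have mE w : mu (ncmon R w) = moments mu w.
  case: w => [|i w]; last by rewrite moments_cons.
  by rewrite moments_nil /ncmon big_nil dist_fun1.
apply: (@Dc_of_span R 'I_k (ncpoly R k) (@ncmon R k) (@ncstar R k) mu _ _ _ _ _ _ _ _ _ id).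
- exact: ncmon_nil.
- exact: ncmon_cat.
- move=> p; exists [seq (mcoeff m p, m : seq 'I_k) | m <- finmap.enum_fset (msupp p)].
  by rewrite big_map; exact: ncpoly_decomp.
- exact: ncstarD.
- exact: ncstar_mon.
- exact: dist_fun1.
- by apply: eq_psd mu_psd => v w; rewrite mE.
- by exists D; split=> // w; rewrite mE.
- move=> w; congr (mu _); apply: eq_bigr => i _.
  by rewrite /ncmon big_seq1.
Qed.

(** * Proof of the theorem *)

Lemma cond_pos_scale (R : realType) (k : nat) (c : R[i]) (r : ncseries R k) :
  0 <= c -> cond_pos r -> cond_pos (c *: r).
Proof.
move=> c0 [rpsd rreal]; split=> [a|i].
  have := mulr_ge0 c0 (rpsd a); congr (_ <= _).
  rewrite /sesq mulr_sumr; apply: eq_bigr => x _; rewrite mulr_sumr.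
  by apply: eq_bigr => y _; rewrite /bker ncs_coefE mulrCA.
by rewrite ncs_coefE rpredM // ger0_real.
Qed.

Lemma geom_bounded_scale (R : realType) (k : nat) (c : R[i]) (r : ncseries R k) :
  `|c| <= 1 -> geom_bounded r -> geom_bounded (c *: r).
Proof.
move=> c1 [D [D1 rD]]; exists D; split=> // w.
by rewrite ncs_coefE normrM; apply: le_trans (rD w); rewrite ler_piMl.
Qed.

Theorem mainTheorem4 (R : realType) (k : nat) (hk : (0 < k)%N) :
  @B1 R k @` @Dc R k = @Dc_infdiv R k.
Proof.
apply/seteqP; split=> [la [mu /good_of_Dc mu_good <-]|la [la_Dc la_div]].
  have eta_pos := eta_cond_pos mu_good.1.
  have eta_bd := eta_geom_bounded mu_good.2.
  split=> [|N N0].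
    exact: Dc_of_good (good_of_rtransform eta_pos eta_bd (rtransform_B1 mu)).
  pose c : R[i] := N%:R^-1.
  have c0 : 0 <= c by rewrite invr_ge0.
  have c1 : `|c| <= 1 by rewrite ger0_norm // invf_le1 ?ltr0n // ler1n.
  have r0 : (c *: eta_series mu) [::] = 0.
    by rewrite -[LHS]/(c * eta_series mu [::]) eta_series0 mulr0.
  have [nu [nuE _]] := rtransform_bij r0; exists nu; split.
    apply: Dc_of_good; apply: good_of_rtransform nuE.
      exact: cond_pos_scale.
    exact: geom_bounded_scale.
  apply: rtransform_inj; rewrite boxplus_powP nuE rtransform_B1 scalerA.
  rewrite (_ : (N%:R)%:C%C = N%:R); last by rewrite rmorph_nat.
  by rewrite mulfV ?scale1r // pnatr_eq0 -lt0n.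
have r_pos : cond_pos (rtransform la).
  apply: cond_pos_of_infdiv => N /la_div[nu [/good_of_Dc nu_good nuE]].
  by exists nu.
(* The bound comes from [la] itself; those of its roots need not be uniform in N. *)
have r_bd := rtransform_geom_bounded (good_of_Dc la_Dc).2.
have [mu [muE _]] := eta_series_bij (rtransformP la).1.
exists mu; first exact: Dc_of_good (good_of_eta r_pos r_bd muE).
by apply: rtransform_inj; rewrite rtransform_B1 muE.
Qed.
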